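(* Suppose that (A1)–(A8) hold. Let $n\in\mathbb N$, $L>0$, and let $(\mathbf c_t,\mathbf u_t)\in AC([0,1];\Omega_L^n)$ be a curve of maximal slope for $J_n$ with respect to the strong upper gradient $|\partial J_n|$. Then $$\mu_t:=\frac1n\sum_{j=1}^n\delta_{(c_t^j,u_t^j)}\in\mathcal P_2(\Omega_L)$$ is a curve of maximal slope for $\mathcal J$ (in $(\mathcal P_2(\Omega_L),\mathcal W_2)$) with respect to the strong upper gradient $|\partial\mathcal J|$.
   Context: Let $\mathcal C$ be a separable Banach space, $\mathcal M=\mathcal C^*$ its topological dual with the dual norm, and $Y$ a Hilbert space. Let $K:\mathcal M\to Y$, $\mathcal F:Y\to\mathbb R$, $\mathcal R:\mathcal M\to[0,+\infty]$ and $J(u):=\mathcal F(Ku)+\mathcal R(u)$ for $u\in\mathcal M$. Put $\mathrm{Dom}(\mathcal R):=\{u\in\mathcal M:\mathcal R(u)<+\infty\}$. Let $B:=\{u\in\mathcal M:\mathcal R(u)\le1\}$ and let $\tilde{\mathcal B}:=\overline{\mathrm{Ext}(B)}^{*}$ be the weak$^*$-closure of its set of extremal points. Fix a weak$^*$-closed subset $\mathcal B\subset\tilde{\mathcal B}$ and a metric $d_{\mathcal B}$ metrizing the weak$^*$-convergence on $\mathcal B$, such that $(\mathcal B,d_{\mathcal B})$ is geodesically complete, i.e. any two points are joined by a geodesic; a geodesic in a metric space $(X,d)$ is a curve $\gamma:[0,1]\to X$ with $d(\gamma_s,\gamma_t)=|s-t|d(\gamma_0,\gamma_1)$ for all $s,t$.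 Assumptions: (A1) $K$ is linear and weak$^*$-to-weak continuous. (A2) $\mathcal F$ is bounded from below, convex, and twice Fréchet differentiable on $Y$. (A3) $\mathcal R$ is convex, weak$^*$-lower semicontinuous and positively one-homogeneous: $\mathcal R(\lambda u)=\lambda\mathcal R(u)$ for all $\lambda\ge0$, $u\in\mathcal M$. (A4) For every $\alpha\ge0$ the sublevel set $\{u\in\mathcal M:\mathcal R(u)\le\alpha\}$ is weak$^*$-compact. (A5) $K$ is sequentially weak$^*$-to-strong continuous on $\mathrm{Dom}(\mathcal R)$. (A6) (no loss of mass) For every $n\in\mathbb N$, $\alpha^1,\dots,\alpha^n\ge0$ and $u^1,\dots,u^n\in\mathcal B$: $\mathcal R(\sum_j\alpha^ju^j)=\sum_j\alpha^j\mathcal R(u^j)$. (A7) $0\notin\mathcal B$. (A8) There is a constant $C=C(K,\mathcal B)>0$ such that for $m\in\{1,2\}$ and all geodesics $u_t:[0,1]\to\mathcal B$, $\sup_{t\in[0,1]}\big\|\frac{d^m}{dt^m}K(u_t)\big\|_Y\le C\,d_{\mathcal B}^m(u_0,u_1)$, where the derivatives are understood weakly, i.e. tested against elements of $Y$. Notation: $\Omega_L^n:=[0,L]^n\times\mathcal B^n$, with elements $(\mathbf c,\mathbf u)=((c^1,\dots,c^n),(u^1,\dots,u^n))$ and metric $d_n((\mathbf c,\mathbf u),(\tilde{\mathbf c},\tilde{\mathbf u})):=\big(\frac1n\sum_{j=1}^n(|c^j-\tilde c^j|^2+d_{\mathcal B}^2(u^j,\tilde u^j))\big)^{1/2}$;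 $\Omega_L:=\Omega_L^1$, $d_\Omega:=d_1$; $J_n(\mathbf c,\mathbf u):=J\big(\frac1n\sum_{j=1}^n(c^j)^2u^j\big)$ on $\Omega_L^n$. $\mathcal P_2(\Omega_L)$ is the set of Borel probability measures on $\Omega_L$ with the 2-Wasserstein distance $\mathcal W_2$ induced by $d_\Omega$, and $$\mathcal J(\nu):=\mathcal F\Big(\int_{\Omega_L}c^2Ku\,d\nu(c,u)\Big)+\int_{\Omega_L}c^2\,d\nu(c,u),\quad\nu\in\mathcal P_2(\Omega_L).$$ Metric notions, for a complete metric space $(X,d)$ and $F:X\to(-\infty,+\infty]$: Local slope: $|\partial F|(u):=\limsup_{w\to u}\frac{(F(u)-F(w))^+}{d(u,w)}$ (here $|\partial J_n|$ is taken in $(\Omega_L^n,d_n)$ and $|\partial\mathcal J|$ in $(\mathcal P_2(\Omega_L),\mathcal W_2)$). $AC([0,1];X)$: curves with $d(\gamma_s,\gamma_t)\le\int_s^tm(r)\,dr$ for some $m\in L^1(0,1)$ and all $s\le t$. Metric derivative: $|\gamma'|(t):=\lim_{h\to0}d(\gamma(t+h),\gamma(t))/|h|$. Strong upper gradient: $g:X\to[0,\infty]$ is a strong upper gradient for $F$ if for every $\gamma\in AC([0,1];X)$ the function $g\circ\gamma$ is Borel and $|F(\gamma(t))-F(\gamma(s))|\le\int_s^tg(\gamma(r))|\gamma'|(r)\,dr$ for all $0<s\le t<1$. Curve of maximal slope (on $[0,1]$) for $F$ with respect to its strong upper gradient $g$: an absolutely continuous $\gamma:[0,1]\to X$ such that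 $F\circ\gamma$ is a.e. equal to a non-increasing map $\varphi$ with $\varphi'(t)\le-\frac12|\gamma'|^2(t)-\frac12g^2(\gamma(t))$ for a.e. $t\in(0,1)$.
   Formalization: The formal theorem additionally assumes R(u)=1 for every u in 𝓑 that is not an extremal point of B; without it (A1)–(A8) allow R(u)<1 at weak* limits of extremal points, J_n and 𝒥 then disagree, and the claim fails. *)

(* Defs.v *)
From HB Require Import structures.
From mathcomp Require Import all_boot all_order all_algebra.
From mathcomp Require Import sesquilinear.
From mathcomp Require Import all_classical all_reals all_analysis.
From mathcomp Require Import measurable_realfun.
Set Implicit Arguments.
Unset Strict Implicit.
Unset Printing Implicit Defensive.
Import Order.TTheory GRing.Theory Num.Theory.
Import numFieldNormedType.Exports.
Local Open Scope classical_set_scope.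
Local Open Scope ring_scope.

Section dual_lmodule.
Context (R : realType) (V : normedModType R).

Definition dual_pred : {pred V -> R^o} :=
  mem [set f : V -> R^o | linear f /\ continuous f].

Fact dual_submod_closed : submod_closed dual_pred.
Proof.
split=> [|a f g].
  apply/mem_set; split=> [b x y|x]; last exact: cst_continuous.
  by rewrite /= scaler0 addr0.
move=> /set_mem[lf cf] /set_mem[lg cg]; apply/mem_set; split=> [b x y|x] /=.
  rewrite -[LHS]/(a * f (b *: x + y) + g (b *: x + y)).
  rewrite -[RHS]/(b * (a * f x + g x) + (a * f y + g y)) lf lg.
  rewrite -[b *: f x]/(b * f x) -[b *: g x]/(b * g x).
  by rewrite !mulrDr addrACA mulrCA.
by apply: cvgD; [apply: cvgZl_tmp; exact: cf|exact: cg].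
Qed.

HB.instance Definition _ :=
  GRing.isSubmodClosed.Build R (V -> R^o) dual_pred dual_submod_closed.

Record dual := Dual { dual_val :> V -> R^o; _ : dual_val \in dual_pred }.
HB.instance Definition _ := [isSub for dual_val].
HB.instance Definition _ := [Choice of dual by <:].
HB.instance Definition _ := [SubChoice_isSubLmodule of dual by <:].

End dual_lmodule.

Section dual_norm.
Context (R : realType) (V : normedModType R).
Implicit Types f g : dual V.

Definition dual_norm f : R := sup [set `|f x| | x in [set x | `|x| <= 1]].

Lemma dual_linear f : linear f.
Proof. by case: f => f /= /set_mem[]. Qed.

Lemma dual_continuous f : continuous f.
Proof. by case: f => f /= /set_mem[]. Qed.

Lemma dualDE f g x : (f + g : dual V) x = f x + g x.
Proof. by []. Qed.

Lemma dualZE (a : R) f x : (a *: f : dual V) x = a * f x.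
Proof. by []. Qed.

Let unit_values f := [set `|f x| | x in [set x | `|x| <= 1]].

Let unit_values0 f : unit_values f !=set0.
Proof. by exists `|f 0|, 0 => //=; rewrite normr0 ler01. Qed.

Lemma dual_norm_has_sup f : has_sup (unit_values f).
Proof.
split; first exact: unit_values0.
pose F : {linear V -> R^o} :=
  HB.pack (f : V -> R^o) (GRing.isLinear.Build _ _ _ _ f (@dual_linear f)).
have /(continuous_linear_bounded (0 : V)) /bounded_funP :
    {for 0, continuous F} by exact: dual_continuous.
move=> /(_ 1)[M FM]; exists M => _ [x x1 <-]; exact: FM.
Qed.

Lemma dual_norm_ub f x : `|x| <= 1 -> `|f x| <= dual_norm f.
Proof.
move=> x1; apply: ub_le_sup; last by exists x.
by have [] := dual_norm_has_sup f.
Qed.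

Lemma dual_norm_le f M : (forall x, `|x| <= 1 -> `|f x| <= M) ->
  dual_norm f <= M.
Proof.
move=> fM; apply: ge_sup; first exact: unit_values0.
by move=> _ [x x1 <-]; exact: fM.
Qed.

Lemma dual_normD f g : dual_norm (f + g) <= dual_norm f + dual_norm g.
Proof.
apply: dual_norm_le => x x1; rewrite dualDE (le_trans (ler_normD _ _))//.
by rewrite lerD// dual_norm_ub.
Qed.

Lemma dual_normZ_le (a : R) f : dual_norm (a *: f) <= `|a| * dual_norm f.
Proof.
apply: dual_norm_le => x x1.
by rewrite dualZE normrM ler_wpM2l// dual_norm_ub.
Qed.

Lemma dual_normZ (a : R) f : dual_norm (a *: f) = `|a| * dual_norm f.
Proof.
apply/eqP; rewrite eq_le dual_normZ_le/=.
have [->|a0] := eqVneq a 0.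
  rewrite normr0 mul0r; apply: (le_trans (normr_ge0 ((0 *: f : dual V) 0))).
  by apply: dual_norm_ub; rewrite normr0.
rewrite -ler_pdivlMl ?normr_gt0// -normfV.
by rewrite -[in leLHS](scalerK a0 f); exact: dual_normZ_le.
Qed.

Lemma dual_norm_eq0 f : dual_norm f = 0 -> f = 0.
Proof.
move=> f0; apply/val_inj/funext => x /=.
have lf := dual_linear f.
have fZ (a : R) y : f (a *: y) = a * f y.
  have f00 : f 0 = 0.
    by have := lf (-1) 0 0; rewrite scaleN1r oppr0 addr0 scaleN1r addNr.
  by have := lf a y 0; rewrite !addr0 f00 addr0.
have [->|x0] := eqVneq x 0.
  by have := fZ 0 0; rewrite scale0r mul0r.
have nx0 : `|x| != 0 by rewrite normr_eq0.
have : `|f (`|x|^-1 *: x)| <= 0.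
  rewrite -f0; apply: dual_norm_ub.
  by rewrite normrZ normfV normr_id mulVf.
rewrite normr_le0 fZ mulf_eq0 invr_eq0 (negPf nx0)/=.
by move/eqP.
Qed.

HB.instance Definition _ := Lmodule_isNormed.Build R (dual V)
  dual_normD dual_normZ dual_norm_eq0.

End dual_norm.

Section weak_topologies.
Context (R : realType) (V : normedModType R).

(* The weak* topology on the dual, as opposed to its norm topology. *)
Definition weakstar : Type :=
  initial_topology (fun f : dual V => (f : V -> R^o) : {ptws V -> R^o}).
HB.instance Definition _ := Topological.on weakstar.

Definition weak : Type := initial_topology
  (fun x : V => (fun f : dual V => f x) : {ptws dual V -> R^o}).
HB.instance Definition _ := Topological.on weak.

End weak_topologies.

Definition separable (T : topologicalType) : Prop :=
  exists2 D : set T, countable D & dense D.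

Section real_vector_spaces.
Context (R : realType) (E : lmodType R).

Definition extreme_points (A : set E) : set E :=
  [set u | A u /\ forall v w (t : R), A v -> A w -> 0 < t -> t < 1 ->
    u = t *: v + (1 - t) *: w -> v = u /\ w = u].

Definition econvex (F : E -> \bar R) : Prop :=
  forall u v (t : R), 0 <= t -> t <= 1 ->
  (F (t *: u + (1 - t) *: v)%R <= t%:E * F u + (1 - t)%:E * F v)%E.

Definition edom (F : E -> \bar R) : set E := [set u | (F u < +oo)%E].

End real_vector_spaces.

Definition twice_differentiable (R : realType) (V : normedModType R)
    (F : V -> R^o) : Prop :=
  exists DF : V -> dual V,
    (forall x, differentiable F x /\ 'd F x = DF x :> (V -> R^o)) /\
    (forall x, differentiable DF x).

Section metric_notions.
Context (R : realType) (X : Type) (d : X -> X -> R).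

Record is_metric : Prop := IsMetric {
  metric_pos : forall x y, 0 <= d x y;
  metric_eq0 : forall x y, d x y = 0 <-> x = y;
  metric_symm : forall x y, d x y = d y x;
  metric_tri : forall x y z, d x z <= d x y + d y z }.

Definition metric_open : set (set X) :=
  [set A | forall x, A x -> exists2 e : R, 0 < e & forall y, d x y < e -> A y].

Definition geodesic (g : R -> X) : Prop :=
  forall s t, 0 <= s <= 1 -> 0 <= t <= 1 ->
  d (g s) (g t) = `|s - t| * d (g 0) (g 1).

Definition geodesically_complete : Prop :=
  forall x y, exists g, [/\ geodesic g, g 0 = x & g 1 = y].

(* The outer maxe only matters at an isolated point, where the supremum of the
   empty set is -oo: the slope is then 0. *)
Definition local_slope (F : X -> \bar R) (x : X) : \bar R :=
  maxe 0%E (ereal_inf [set ereal_sup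
    [set (maxe 0 (F x - F y) * ((d x y)^-1)%:E)%E | y in [set y | 0 < d x y < r]]
    | r in [set r : R | 0 < r]]).

(* A curve defined on [0, 1] is given by a function on R of which only the
   values on [0, 1] matter. *)
Definition AC01 (g : R -> X) : Prop :=
  exists2 m : R -> R, lebesgue_measure.-integrable `]0, 1[ (EFin \o m) &
  forall s t, 0 <= s -> s <= t -> t <= 1 ->
  ((d (g s) (g t))%:E <= \int[lebesgue_measure]_(r in `]s, t[) (m r)%:E)%E.

Definition metric_derivative (g : R -> X) (t : R) : R :=
  lim (d (g (t + h)) (g t) / `|h| @[h --> 0^']).

Definition strong_upper_gradient (F : X -> \bar R) (G : X -> \bar R) : Prop :=
  (forall x, 0 <= G x)%E /\
  forall g, AC01 g ->
  measurable_fun (`[0, 1]%classic : set R) (G \o g) /\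
  forall s t, 0 < s -> s <= t -> t < 1 ->
  (`|F (g t) - F (g s)| <=
    \int[lebesgue_measure]_(r in `[s, t])
      (G (g r) * (metric_derivative g r)%:E))%E.

(* Since phi is differentiable a.e., it is finite on ]0, 1[, so that there is
   no loss in taking it real-valued. *)
Definition max_slope_curve (F : X -> \bar R) (G : X -> \bar R) (g : R -> X)
  : Prop :=
  [/\ strong_upper_gradient F G, AC01 g &
   exists phi : R -> R,
   [/\ (forall s t, 0 < s -> s <= t -> t < 1 -> phi t <= phi s),
       {ae lebesgue_measure, forall t, 0 < t < 1 ->
          F (g t) = (phi t)%:E} &
       {ae lebesgue_measure, forall t, 0 < t < 1 ->
          derivable phi t 1 /\
          ((derive1 phi t)%:E <= - (2^-1 * metric_derivative g t ^+ 2)%:E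
                             - 2^-1%:E * G (g t) ^+ 2)%E}]].

End metric_notions.

Definition pointed_at (X : choiceType) (x0 : X) : Type := X.
HB.instance Definition _ (X : choiceType) (x0 : X) := Choice.on (pointed_at x0).
HB.instance Definition _ (X : choiceType) (x0 : X) :=
  isPointed.Build (pointed_at x0) x0.

(* X with the Borel sigma-algebra of d. Measurable types are pointed, hence the
   base point x0; the sigma-algebra does not depend on it. *)
Definition borel (R : realType) (X : choiceType) (d : X -> X -> R) (x0 : X)
  : Type := g_sigma_algebraType (metric_open d : set (set (pointed_at x0))).
HB.instance Definition _ (R : realType) (X : choiceType) (d : X -> X -> R)
  (x0 : X) := Measurable.on (borel d x0).

Section wasserstein.
Context (disp : measure_display) (T : measurableType disp) (R : realType).
Context (d : T -> T -> R).

Definition couplings (mu nu : probability T R) : set (probability (T * T)%type R) :=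
  [set pi | forall A, measurable A ->
              pi (A `*` setT) = mu A /\ pi (setT `*` A) = nu A].

Definition wasserstein2 (mu nu : probability T R) : R :=
  Num.sqrt (fine (ereal_inf
    [set \int[pi]_z ((d z.1 z.2) ^+ 2)%:E | pi in couplings mu nu]))%E.

End wasserstein.

Section empirical_measure.
Context (disp : measure_display) (T : measurableType disp) (R : realType).
Context (n : nat) (x : 'I_n -> T).
Local Open Scope ereal_scope.

Definition sum_dirac (A : set T) : \bar R := \sum_(j < n) \d_(x j) A.

Let sum_dirac0 : sum_dirac set0 = 0. Proof. by rewrite /sum_dirac big1. Qed.

Let sum_dirac_ge0 B : 0 <= sum_dirac B. Proof. exact: sume_ge0. Qed.

Let sum_dirac_sigma_additive : semi_sigma_additive sum_dirac.
Proof.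
move=> F mF tF mUF; rewrite [X in _ --> X](_ : _ =
    lim ((fun n => \sum_(0 <= i < n) sum_dirac (F i)) @ \oo)).
  by apply: is_cvg_ereal_nneg_natsum => k _; exact: sume_ge0.
rewrite nneseries_sum//; apply: eq_bigr => /= i _.
exact: measure_semi_bigcup.
Qed.

HB.instance Definition _ := isMeasure.Build _ _ _ sum_dirac
  sum_dirac0 sum_dirac_ge0 sum_dirac_sigma_additive.

Definition empirical (n_gt0 : (0 < n)%N) : set T -> \bar R :=
  mscale ((n%:R : R)^-1%:nng)%R sum_dirac.

Variable n_gt0 : (0 < n)%N.

HB.instance Definition _ := Measure.on (empirical n_gt0).

Let empiricalT : empirical n_gt0 setT = 1.
Proof.
rewrite /empirical /mscale/= /sum_dirac.
under eq_bigr do rewrite diracT.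
rewrite sumEFin -EFinM sumr_const card_ord mulVf//.
by rewrite pnatr_eq0 -lt0n.
Qed.

HB.instance Definition _ :=
  Measure_isProbability.Build _ _ _ (empirical n_gt0) empiricalT.

End empirical_measure.

Section bochner.
Context (disp : measure_display) (T : measurableType disp) (R : realType).
Context (Y : normedModType R) (nu : probability T R).

Definition simple_map (s : T -> Y) : Prop :=
  finite_set (range s) /\ forall y, measurable (s @^-1` [set y]).

Definition simple_integral (s : T -> Y) : Y :=
  \sum_(y \in range s) fine (nu (s @^-1` [set y])) *: y.

Definition is_bochner_integral (f : T -> Y) (z : Y) : Prop :=
  exists s : nat -> T -> Y,
  [/\ forall k, simple_map (s k),
      forall k, measurable_fun setT (fun x => `|f x - s k x|),
      (\int[nu]_x `|f x - s k x|%:E)%E @[k --> \oo] --> 0%E &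
      simple_integral (s k) @[k --> \oo] --> z].

(* 0 by convention if f is not Bochner integrable. *)
Definition bochner_integral (f : T -> Y) : Y :=
  xget 0 (is_bochner_integral f).

End bochner.

(* One-sided derivatives at the endpoints of [0, 1]. *)
Definition has_derivative_on01 (R : realType) (f f' : R -> R) : Prop :=
  forall t, 0 <= t <= 1 ->
  (f s - f t) / (s - t) @[s --> within `[0, 1] t^'] --> f' t.

Definition weak_derivative_on01 (R : realType) (Y : lmodType R)
    (dot : {dot Y for idfun}) (f f' : R -> Y) : Prop :=
  forall y, has_derivative_on01 (fun t => dot (f t) y) (fun t => dot (f' t) y).

Section atoms.
Context (R : realType) (C : normedModType R).
Context (atoms : set (dual C)) (dB : atoms -> atoms -> R).

Definition metrizes_weakstar : Prop :=
  forall (F : set_system atoms) (u : atoms), Filter F ->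
  dB v u @[v --> F] --> (0 : R) <->
  ((val v : dual C) : weakstar C) @[v --> F] --> ((val u : dual C) : weakstar C).

Definition OmegaN (L : R) (n : nat) : Type :=
  (('I_n -> `[0, L]%classic) * ('I_n -> atoms))%type.

Definition dist_OmegaN (L : R) (n : nat) (x y : OmegaN L n) : R :=
  Num.sqrt (n%:R^-1 * \sum_(j < n)
    (`|val (x.1 j) - val (y.1 j)| ^+ 2 + dB (x.2 j) (y.2 j) ^+ 2)).

(* OmegaN L 1, up to the identification of 1-tuples with their entry. *)
Definition Omega (L : R) : Type := (`[0, L]%classic * atoms)%type.

Definition dist_Omega (L : R) (x y : Omega L) : R :=
  Num.sqrt (`|val x.1 - val y.1| ^+ 2 + dB x.2 y.2 ^+ 2).

Definition P2 (L : R) (x0 : Omega L) : Type :=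
  probability (borel (@dist_Omega L) x0) R.

Definition W2 (L : R) (x0 : Omega L) : P2 x0 -> P2 x0 -> R :=
  wasserstein2 (@dist_Omega L : borel (@dist_Omega L) x0 -> _ -> R).

Definition curve_measure (L : R) (x0 : Omega L) (n : nat) (n_gt0 : (0 < n)%N)
    (x : OmegaN L n) : P2 x0 :=
  empirical R (fun j => (x.1 j, x.2 j) : borel (@dist_Omega L) x0) n_gt0.

Context (Y : normedModType R) (K : dual C -> Y) (F : Y -> R).
Context (Reg : dual C -> \bar R).

Definition objective (u : dual C) : \bar R := ((F (K u))%:E + Reg u)%E.

Definition objectiveN (L : R) (n : nat) (x : OmegaN L n) : \bar R :=
  objective (n%:R^-1 *: \sum_(j < n) val (x.1 j) ^+ 2 *: val (x.2 j)).

Definition lifted_objective (L : R) (x0 : Omega L) (nu : P2 x0) : \bar R :=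
  ((F (bochner_integral nu (fun x => val x.1 ^+ 2 *: K (val x.2))))%:E +
   \int[nu]_x (val x.1 ^+ 2)%:E)%E.

End atoms.

Arguments W2 {R C atoms} dB {L} x0.
Arguments lifted_objective {R C atoms} dB {Y} K F {L} x0.
Arguments dist_OmegaN {R C atoms} dB {L n}.
Arguments objectiveN {R C atoms Y} K F Reg {L n}.

(* Main.v *)
(* Write phi (c, u) = c^2 (l (K u) + 1) with l the gradient of F at the mean of
   c^2 K u under the measure at hand. By convexity of F, an energy drop from a measure to
   another one is at most the drop of the integral of phi, which a transport plan bounds by
   (int s^2)^(1/2) W + C W^2, where s is the slope of phi penalized by C d. Hence the slope
   of the lifted objective is at most (int s^2)^(1/2). At an empirical measure the atoms can
   be moved independently, each along a geodesic of (c, u) on which phi is convex up to a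
   quadratic error, and the slope of J_n is therefore at least the same quantity. As moreover
   the objectives agree on empirical measures (Reg = 1 on atoms) and the map to empirical
   measures is 1-Lipschitz, every curve of maximal slope for J_n is mapped to one for the
   lifted objective. That the slope of the lifted objective is a strong upper gradient follows
   from its being Lipschitz along absolutely continuous curves. *)

(* The slope of phi has to be measurable and to control phi globally, since a transport plan of
   small cost may still move some mass far. The penalized slope does both, and its penalty is
   lossless: its constant is that of the quadratic error along geodesics, so a distant point that
   nearly attains the supremum yields, by moving towards it, a nearby point with the same rate of
   descent. This is where geodesic completeness and the bounds on the second derivatives of K enter.
   Two more obstacles shape the proof. The metric derivative is a bare [lim], so its existence a.e.
   along absolutely continuous curves must be proved before two of them can be compared. And the
   triangle inequality for the Wasserstein distance is obtained without disintegration: weak*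
   compactness makes the atoms totally bounded, so couplings can be glued cell by cell over a finite
   measurable partition, up to an arbitrarily small error. The same partitions give the
   measurability of the distance and of Lipschitz functions. *)
Require Import Defs.
From HB Require Import structures.
From mathcomp Require Import all_boot all_order all_algebra.
From mathcomp Require Import finmap sesquilinear.
From mathcomp Require Import all_classical all_reals all_analysis.
From mathcomp Require Import measurable_realfun.
From mathcomp Require Import ring lra.
Set Implicit Arguments.
Unset Strict Implicit.
Unset Printing Implicit Defensive.
Import Order.TTheory GRing.Theory Num.Theory.
Import numFieldNormedType.Exports.
Local Open Scope classical_set_scope.
Local Open Scope ring_scope.

(** * Absolutely continuous curves and metric derivatives *)

Section absolute_continuity.
Context (R : realType).
Notation mu := (@lebesgue_measure R).
Implicit Types (f g h : R -> R) (s t : R).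

Lemma ae_lebesgueS (P Q : R -> Prop) : (forall x, P x -> Q x) ->
  {ae mu, forall x, P x} -> {ae mu, forall x, Q x}.
Proof. by move=> PQ; apply: filterS => //; exact: (ae_filter_ringOfSetsType mu). Qed.

Lemma ae_lebesgueI (P Q : R -> Prop) : {ae mu, forall x, P x} ->
  {ae mu, forall x, Q x} -> {ae mu, forall x, P x /\ Q x}.
Proof. by move=> p q; apply: filterI => //; exact: (ae_filter_ringOfSetsType mu). Qed.

Lemma Rintegral_Ny_oc h s t : mu.-integrable setT (EFin \o h) -> s <= t ->
  \int[mu]_(r in `]-oo, t]) h r - \int[mu]_(r in `]-oo, s]) h r =
  \int[mu]_(r in `]s, t]) h r.
Proof.
move=> ih st; apply: Rintegral_itvB => //.
exact: integrableS ih.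
Qed.

Lemma Rintegral_Ny_continuous h : mu.-integrable setT (EFin \o h) ->
  continuous (fun t => \int[mu]_(r in `]-oo, t]) h r).
Proof.
move=> ih t; apply/cvgrPdist_le => /= e e0.
have [d [d0 hd]] := integral_normr_continuous ih e0.
have key s u : s <= u -> u - s < d ->
    `|\int[mu]_(r in `]-oo, u]) h r - \int[mu]_(r in `]-oo, s]) h r| <= e.
  move=> su usd; rewrite Rintegral_Ny_oc//.
  apply: (le_trans (le_normr_Rintegral _ _)) => //; first exact: integrableS ih.
  apply/ltW/hd => //=; rewrite lebesgue_measure_itv/= lte_fin.
  by case: ifP => _; rewrite ?EFinD// -EFinD lte_fin.
near=> u; have ud : `|t - u| < d.
  near: u; apply: (@cvgr_dist_lt _ _ _ _ _ id t) => //; exact: cvg_id.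
case: (leP t u) => tu.
  by rewrite distrC; apply: key => //; move: ud; rewrite distrC ger0_norm ?subr_ge0.
by apply: key; rewrite ?(ltW tu)//; move: ud; rewrite gtr0_norm ?subr_gt0.
Unshelve. all: by end_near. Qed.

(** With [H] the primitive of [h], both [g] and [H - g] are nondecreasing, and their Stieltjes
    measures add up to [h] times Lebesgue measure. The measure of [g] thus lies below an absolutely
    continuous one, and Radon-Nikodym applies. *)
Lemma nondecreasing_dominated_density g h : mu.-integrable setT (EFin \o h) ->
  (forall r, 0 <= h r) -> {homo g : s t / s <= t} ->
  (forall s t, s <= t -> g t - g s <= \int[mu]_(r in `]s, t]) h r) ->
  exists k : R -> R, mu.-integrable setT (EFin \o k) /\
    forall s t, s <= t -> g t - g s = \int[mu]_(r in `]s, t]) k r.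
Proof.
move=> ih h0 ndg gh.
pose H t := \int[mu]_(r in `]-oo, t]) h r.
have HB s t : s <= t -> H t - H s = \int[mu]_(r in `]s, t]) h r.
  exact: Rintegral_Ny_oc.
have cH : continuous H by exact: Rintegral_Ny_continuous.
have ndH : {homo H : s t / s <= t}.
  move=> s t st; rewrite -subr_ge0 HB//; exact: Rintegral_ge0.
pose N t := H t - g t.
have ndN : {homo N : s t / s <= t}.
  by move=> s t st; have := gh _ _ st; rewrite -HB// /N; lra.
have cg : continuous g.
  move=> t; apply/cvgrPdist_le => /= e e0.
  have := cH t => /cvgrPdist_le /(_ _ e0); apply: filterS => u.
  have key x y : x <= y -> `|g y - g x| <= `|H y - H x|.
    move=> xy; rewrite !ger0_norm ?subr_ge0 ?ndg ?ndH// HB//; exact: gh.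
  case: (leP t u) => tu; apply: le_trans.
    by rewrite distrC [leRHS]distrC key.
  by rewrite key// ltW.
have cN : continuous N by move=> t; apply: cvgB; [exact: cH|exact: cg].
pose iH := isCumulative.Build R _ R H ndH (right_continuousW cH).
pose ig := isCumulative.Build R _ R g ndg (right_continuousW cg).
pose iN := isCumulative.Build R _ R N ndN (right_continuousW cN).
pose cuH : cumulative R R := HB.pack H iH.
pose cug : cumulative R R := HB.pack g ig.
pose cuN : cumulative R R := HB.pack N iN.
pose nu := lebesgue_stieltjes_measure cug.
pose nuN := lebesgue_stieltjes_measure cuN.
have lsE (F : cumulative R R) s t : s <= t ->
    lebesgue_stieltjes_measure F `]s, t] = (F t - F s)%:E.
  move=> st; rewrite /lebesgue_stieltjes_measure /measure_extension/=.
  rewrite measurable_mu_extE/=; last exact: is_ocitv.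
  by rewrite wlength_itv_bnd.
have ih0 E : (0 <= induced_charge ih E)%E.
  by apply: integral_ge0 => x _; rewrite lee_fin.
pose nuH := measure_of_charge _ ih0.
have nuHE X : measurable X -> lebesgue_stieltjes_measure cuH X = nuH X.
  apply: lebesgue_stieltjes_measure_unique => _ [[a b] _ <-] /=.
  have [ab|ba] := leP a b; last by rewrite set_itv_ge ?measure0// bnd_simp -leNgt ltW.
  rewrite lsE//= HB// /Rintegral fineK//; apply: integrable_fin_num => //.
  exact: (integrableS measurableT).
have addE X : measurable X -> (nu X + nuN X = nuH X)%E.
  move=> mX; rewrite -nuHE// -[LHS]measure_addE; apply/esym.
  apply: lebesgue_stieltjes_measure_unique mX => _ [[a b] _ <-] /=.
  have [ab|ba] := leP a b; last by rewrite set_itv_ge ?measure0// bnd_simp -leNgt ltW.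
  rewrite /msum !big_ord_recl big_ord0 adde0 /= !lsE//= -EFinD /N.
  by congr (_%:E); lra.
have nule X : measurable X -> (nu X <= nuH X)%E.
  by move=> mX; rewrite -addE// leeDl.
have nudom : nu `<< mu.
  apply/null_content_dominatesP => X mX muX.
  apply/eqP; rewrite eq_le measure_ge0 andbT (le_trans (nule _ mX))//.
  rewrite /nuH /measure_of_charge /= /induced_charge.
  rewrite null_set_integral//.
  by apply: measurable_funTS; exact: measurable_int ih.
have nufin : fin_num_fun nu.
  move=> X mX; rewrite ge0_fin_numE//.
  apply: (le_lt_trans (nule _ mX)); rewrite /nuH /measure_of_charge.
  by rewrite ltey_eq fin_num_measure.
pose ifin := Measure_isFinite.Build _ _ _ nu nufin.
pose nuf : {finite_measure set (measurableTypeR R) -> \bar R} := HB.pack nu ifin.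
have [k [k0 kf ik kE]] := @radon_nikodym_sigma_finite _ _ _ mu nuf nudom.
exists (fine \o k).
have fk : EFin \o (fine \o k) = k by apply/funext => x /=; rewrite fineK.
rewrite fk; split=> // s t st.
have := kE `]s, t]%classic (measurable_itv _); rewrite /= /nu lsE//= => gE.
rewrite /Rintegral; apply: (@EFin_inj R).
rewrite /comp; under eq_integral do rewrite fineK//.
by rewrite -gE.
Qed.

(** Adding the primitive of |h| to [f] makes it nondecreasing, with increments at most those of the
    primitive of 2|h|. The density so obtained minus |h| is a density of [f], and Lebesgue
    differentiation makes it the derivative a.e. *)
Lemma dominated_increments_density f h : mu.-integrable setT (EFin \o h) ->
  (forall s t, s <= t -> `|f t - f s| <= \int[mu]_(r in `]s, t]) h r) ->
  exists k : R -> R, [/\ mu.-integrable setT (EFin \o k),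
    forall s t, s <= t -> f t - f s = \int[mu]_(r in `]s, t]) k r &
    {ae mu, forall x : R, is_derive x (1 : R) f (k x)}].
Proof.
move=> ih fh.
pose h' (r : R) : R := `|h r|.
have ih' : mu.-integrable setT (EFin \o h').
  by rewrite (_ : _ \o _ = abse \o (EFin \o h))//; exact: integrable_abse.
have fh' s t : s <= t -> `|f t - f s| <= \int[mu]_(r in `]s, t]) h' r.
  move=> st; apply: (le_trans (fh _ _ st)); apply: le_Rintegral => //.
  - exact: (integrableS measurableT).
  - exact: (integrableS measurableT).
  - by move=> r _; exact: ler_norm.
pose H t := \int[mu]_(r in `]-oo, t]) h' r.
have HB s t : s <= t -> H t - H s = \int[mu]_(r in `]s, t]) h' r.
  exact: Rintegral_Ny_oc.
pose g t := f t + H t.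
have [||||k [ik kE]] := @nondecreasing_dominated_density g (fun r => 2 * h' r).
- under [X in _.-integrable _ X]eq_fun do rewrite EFinM. exact: integrableZl.
- by move=> r; rewrite mulr_ge0// normr_ge0.
- by move=> s t st; have := fh' _ _ st; rewrite -HB// ler_norml /g; lra.
- move=> s t st; rewrite RintegralZl//; last exact: (integrableS measurableT).
  by have := fh' _ _ st; rewrite -HB// ler_norml /g; lra.
have ikh : mu.-integrable setT (EFin \o (k \- h')).
  rewrite (_ : _ \o _ = (EFin \o k) \- (EFin \o h'))%E; last exact/funext.
  exact: integrableB.
have fE s t : s <= t -> f t - f s = \int[mu]_(r in `]s, t]) (k \- h') r.
  move=> st; rewrite RintegralB//; [|exact: (integrableS measurableT)..].
  by rewrite -kE// -HB// /g; lra.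
exists (k \- h'); split => //.
pose F t := \int[mu]_(r in `]-oo, t]) (k \- h') r.
have fF : f = fun t => F t + (f 0 - F 0).
  apply/funext => t; case: (leP 0 t) => t0.
    by have := fE _ _ t0; rewrite -(Rintegral_Ny_oc ikh t0) -/(F _) -/(F _); lra.
  have := fE _ _ (ltW t0).
  by rewrite -(Rintegral_Ny_oc ikh (ltW t0)) -/(F _) -/(F _); lra.
have : {ae mu, forall x, derivable F x (1 : R) /\ derive1 F x = (k \- h') x}.
  apply: FTC1Ny; first by move=> y; exact: (integrableS measurableT).
  by apply: open_integrable_locally => //; exact: openT.
apply: ae_lebesgueS => x [dF FE]; rewrite fF.
have dFx : is_derive x (1 : R) F ((k \- h') x).
  by rewrite -FE derive1E; exact: derivableP.
by rewrite -[X in is_derive _ _ _ X]addr0; exact: is_deriveD.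
Qed.

Lemma ac01_density f h : mu.-integrable `]0, 1[ (EFin \o h) ->
  (forall s t, 0 <= s -> s <= t -> t <= 1 ->
    (`|f t - f s|%:E <= \int[mu]_(r in `]s, t[) (h r)%:E)%E) ->
  exists k : R -> R, [/\ mu.-integrable setT (EFin \o k),
    forall s t, 0 <= s -> s <= t -> t <= 1 ->
      f t - f s = \int[mu]_(r in `]s, t]) k r &
    {ae mu, forall x : R, 0 < x < 1 -> is_derive x (1 : R) f (k x)}].
Proof.
move=> ih fh.
pose c (t : R) : R := Num.max 0 (Num.min 1 t).
have cE t : 0 <= t <= 1 -> c t = t.
  by move=> /andP[t0 t1]; rewrite /c (min_idPr t1) (max_idPr t0).
have c01 t : 0 <= c t <= 1 by rewrite /c le_max lexx ge_max ler01 ge_min lexx.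
have cle s t : s <= t -> c s <= c t.
  by move=> st; rewrite /c ge_max !le_max lexx/= le_min !ge_min lexx st !orbT.
pose h' : R -> R := (fun r => `|h r| : R) \_ `]0, 1[.
have ih' : mu.-integrable setT (EFin \o h').
  rewrite -restrict_EFin; apply/integrable_restrict => //=.
  rewrite setTI (_ : EFin \o _ = abse \o (EFin \o h)); last exact/funext.
  exact: integrable_abse.
have [|k [ik kE kd]] := @dominated_increments_density (f \o c) h' ih'.
  move=> s t st /=; rewrite -lee_fin.
  have /andP[s0 s1] := c01 s; have /andP[t0 t1] := c01 t.
  apply: (le_trans (fh _ _ s0 (cle _ _ st) t1)).
  rewrite /Rintegral fineK; last first.
    apply: integrable_fin_num => //; exact: (integrableS measurableT).
  apply: (@le_trans _ _ (\int[mu]_(r in `]c s, c t[) (h' r)%:E)%E).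
    apply: le_integral => //.
    - apply: integrableS ih => //.
      by apply: subset_itv; rewrite bnd_simp.
    - exact: (integrableS measurableT).
    - move=> x xst; rewrite lee_fin /h' patchE ifT ?ler_norm//.
      move: xst; rewrite !inE /= !in_itv/= => /andP[sx xt].
      by rewrite (le_lt_trans s0 sx) (lt_le_trans xt t1).
  apply: ge0_subset_integral => //.
  - apply: measurable_funTS; exact: measurable_int ih'.
  - by move=> x _; rewrite lee_fin /h' patchE; case: ifPn => // _; rewrite normr_ge0.
  move=> x /=; rewrite !in_itv/= => /andP[sx xt].
  have x01 : 0 <= x <= 1 by rewrite (le_trans s0 (ltW sx)) (le_trans (ltW xt) t1).
  apply/andP; split.
    by move: sx; rewrite !ltNge -{1}(cE x x01); apply: contra => /cle.
  by apply: ltW; move: xt; rewrite !ltNge -{1}(cE x x01); apply: contra => /cle.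
exists k; split => //.
  move=> s t s0 st t1; rewrite -kE//= !cE//.
    by rewrite s0 (le_trans st t1).
  by rewrite t1 (le_trans s0 st).
apply: ae_lebesgueS kd => x + x01; apply: near_eq_is_derive.
near=> y; rewrite /= cE//; near: y.
have : \forall y \near x, y \in `]0, 1[ by apply: near_in_itvoo; rewrite in_itv.
by apply: filterS => y; rewrite in_itv/= => /andP[/ltW-> /ltW].
Unshelve. all: by end_near. Qed.
End absolute_continuity.

Section clamp.
Context (R : realType).
Implicit Types s t : R.

Definition clamp01 t : R := Num.max 0 (Num.min 1 t).

Lemma clamp01_id t : 0 <= t <= 1 -> clamp01 t = t.
Proof. by move=> /andP[t0 t1]; rewrite /clamp01 (min_idPr t1) (max_idPr t0). Qed.

Lemma clamp01_bounds t : 0 <= clamp01 t <= 1.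
Proof. by rewrite /clamp01 le_max lexx ge_max ler01 ge_min lexx. Qed.

Lemma clamp01_continuous : continuous clamp01.
Proof.
move=> t; have := @max_fun_continuous _ _ R (fun=> 0) (fun s => Num.min 1 s).
apply; first exact: cst_continuous.
apply: (@min_fun_continuous _ _ R (fun=> 1) id); first exact: cst_continuous.
by move=> s; exact: cvg_id.
Qed.

End clamp.

(** Separation is left out: slopes only look at points at positive distance and metric derivatives
    only at distances, so the Wasserstein distance never has to be shown to separate measures. *)
Definition pseudo_metric (R : realType) (X : Type) (d : X -> X -> R) :=
  [/\ forall x y, 0 <= d x y, forall x, d x x = 0,
      forall x y, d x y = d y x & forall x y z, d x z <= d x y + d y z].

Lemma is_derive_quotient (R : realType) (f : R -> R) (x k : R) :
  is_derive x (1 : R) f k -> (f (x + h) - f x) / h @[h --> 0^'] --> k.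
Proof.
move=> [fx <-]; have := fx; rewrite /derivable /derive => /cvg_ex[l].
move=> /[dup] cl /cvg_lim ->//.
move: cl; apply: cvg_trans; apply: near_eq_cvg; near=> h.
by rewrite -[RHS]mulrC (addrC x) -[LHS]/(h^-1 * (f (h * 1 + x) - f x)) mulr1.
Unshelve. all: by end_near. Qed.

Section nonmeasurable_integral.
Context (d : measure_display) (T : measurableType d) (R : realType).
Context (mu : {measure set T -> \bar R}).
Local Open Scope ereal_scope.

(* [g] need not be measurable: its integral is a supremum over simple minorants. *)
Lemma ae_le_integral_minorant (D : set T) (f g : T -> \bar R) :
  measurable D -> measurable_fun D f -> (forall x, D x -> 0 <= f x) ->
  (forall x, D x -> 0 <= g x) -> {ae mu, forall x, D x -> f x <= g x} ->
  \int[mu]_(x in D) f x <= \int[mu]_(x in D) g x.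
Proof.
move=> mD mf f0 g0 [N [mN muN fgN]].
rewrite (ge0_negligible_integral _ _ _ _ muN)//.
rewrite !ge0_integralE//; last by move=> x [Dx _]; exact: f0.
apply: ge_ereal_sup => _ [h hf <-]; apply: ereal_sup_ubound; exists h => //.
move=> x; apply: (le_trans (hf x)); rewrite !patchE.
case: ifPn => [|_]; last by case: ifPn => // /set_mem/g0.
rewrite inE => -[Dx Nx]; rewrite ifT ?inE//.
by apply: contrapT => fg; apply: Nx; apply: fgN => /= /(_ Dx).
Qed.

End nonmeasurable_integral.

Section curves.
Context (R : realType) (X : Type) (d : X -> X -> R).
Hypothesis dpm : pseudo_metric d.
Notation mu := (@lebesgue_measure R).
Implicit Types (g : R -> X) (s t : R).

Let d_ge0 x y : 0 <= d x y. Proof. by case: dpm. Qed.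
Let d_sym x y : d x y = d y x. Proof. by case: dpm. Qed.
Let d_tri x y z : d x z <= d x y + d y z. Proof. by case: dpm. Qed.

Let d_tri2 x y z : `|d x z - d y z| <= d x y.
Proof.
by rewrite ler_norml; have := d_tri x y z; have := d_tri y x z; rewrite (d_sym y x); lra.
Qed.

Lemma metric_derivative_ge0 g t : 0 <= metric_derivative d g t.
Proof.
rewrite /metric_derivative; set F := (X in lim X).
have [cF|/dvgP->//] := pselect (cvg F).
by apply: limr_ge => //; near=> h; rewrite divr_ge0.
Unshelve. all: by end_near. Qed.

(** One real function [H] dominates the increments of the curve, so that continuity along the curve
    reduces to continuity of [H]. *)
Lemma AC01_modulus g : AC01 d g -> exists H k : R -> R,
  [/\ continuous H, mu.-integrable setT (EFin \o k),
   {homo H : s t / s <= t},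
   forall s t, 0 <= s -> s <= t -> t <= 1 -> d (g s) (g t) <= H t - H s &
   {ae mu, forall x : R, 0 < x < 1 -> is_derive x (1 : R) H (k x)}].
Proof.
case=> m im gm.
pose h : R -> R := (fun r => `|m r| : R) \_ `]0, 1[.
have ih : mu.-integrable setT (EFin \o h).
  rewrite -restrict_EFin; apply/integrable_restrict => //=.
  rewrite setTI (_ : EFin \o _ = abse \o (EFin \o m)); last exact/funext.
  exact: integrable_abse.
have h0 r : 0 <= h r by rewrite /h patchE; case: ifPn.
pose H t := \int[mu]_(r in `]-oo, t]) h r.
have HB s t : s <= t -> H t - H s = \int[mu]_(r in `]s, t]) h r.
  exact: Rintegral_Ny_oc.
have ndH : {homo H : s t / s <= t}.
  by move=> s t st; rewrite -subr_ge0 HB//; exact: Rintegral_ge0.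
have [s t st|k [ik _ kd]] := @dominated_increments_density R H h ih.
  by rewrite HB// ger0_norm// Rintegral_ge0.
exists H, k; split => //.
- exact: Rintegral_Ny_continuous.
- move=> s t s0 st t1; rewrite HB// -lee_fin; apply: (le_trans (gm _ _ s0 st t1)).
  rewrite /Rintegral fineK; last first.
    by apply: integrable_fin_num => //; exact: (integrableS measurableT).
  apply: (@le_trans _ _ (\int[mu]_(r in `]s, t[) (h r)%:E)%E).
    apply: le_integral => //.
    - apply: integrableS im => //.
      by apply: subset_itv; rewrite bnd_simp.
    - exact: (integrableS measurableT).
    - move=> x xst; rewrite lee_fin /h patchE ifT ?ler_norm//.
      move: xst; rewrite !inE /= !in_itv/= => /andP[sx xt].
      by rewrite (le_lt_trans s0 sx) (lt_le_trans xt t1).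
  apply: ge0_subset_integral => //.
  - by apply: measurable_funTS; exact: measurable_int ih.
  - by move=> x _; rewrite lee_fin.
  - by apply: subset_itvl; rewrite bnd_simp.
- by apply: ae_lebesgueS kd.
Qed.

Lemma AC01_density g (f : R -> R) (M : R) : AC01 d g ->
  (forall s t, 0 <= s <= 1 -> 0 <= t <= 1 -> `|f t - f s| <= M * d (g s) (g t)) ->
  exists k : R -> R, [/\ mu.-integrable setT (EFin \o k),
    forall s t, 0 <= s -> s <= t -> t <= 1 ->
      f t - f s = \int[mu]_(r in `]s, t]) k r &
    {ae mu, forall x : R, 0 < x < 1 -> is_derive x (1 : R) f (k x)}].
Proof.
case=> m im gm fg; apply: (@ac01_density _ _ (fun r => `|M| * m r)).
  rewrite (_ : _ \o _ = fun r => `|M|%:E * (m r)%:E)%E; last exact/funext.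
  exact: integrableZl.
move=> s t s0 st t1.
have {fg} := fg s t; rewrite s0 t1 (le_trans st t1) (le_trans s0 st).
move=> /(_ erefl erefl) fg.
apply: (@le_trans _ _ (`|M|%:E * (d (g s) (g t))%:E)%E).
  by rewrite -EFinM lee_fin (le_trans fg)// ler_wpM2r// ler_norm.
under eq_integral do rewrite EFinM.
rewrite integralZl//; last first.
  by apply: integrableS im => //; apply: subset_itv; rewrite bnd_simp.
by rewrite lee_wpmul2l ?lee_fin//; exact: gm.
Qed.

(** The times enumerated are the rationals clamped to [0, 1]; codes of no rational fall back on 0.
    Closeness is measured through [H] because [H] is what bounds distances along a curve. *)
Lemma clamp01_rat_dense (H : R -> R) s (e : R) : continuous H -> 0 <= s <= 1 ->
  0 < e -> exists n : nat,
    `|H s - H (clamp01 (ratr (odflt 0 (choice.unpickle n))))| < e.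
Proof.
move=> cH s01 e0.
have cHc : {for s, continuous (H \o clamp01 (R := R))}.
  by apply: continuous_comp; [exact: clamp01_continuous|exact: cH].
have /cvgrPdist_lt /(_ _ e0) [r /= r0 sr] := cHc.
have [q] : exists q : rat, ratr q \in `]s, s + r[ by apply: rat_in_itvoo; rewrite ltrDl.
rewrite in_itv/= => /andP[sq qr]; exists (choice.pickle q); rewrite choice.pickleK/=.
have := sr (ratr q); rewrite /= clamp01_id//; apply.
by rewrite /= distrC gtr0_norm ?subr_gt0// ltrBlDl.
Qed.

(* The metric derivative is the supremum, over a countable dense set of times p, of the
   absolute values of the derivatives of the functions t |-> d (g t) (g p). *)
Lemma metric_derivative_ae g : AC01 d g ->
  {ae mu, forall x : R, 0 < x < 1 ->
    d (g (x + h)) (g x) / `|h| @[h --> 0^'] --> metric_derivative d g x}.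
Proof.
move=> gAC; have [H [kH [cH ikH ndH gH Hd]]] := AC01_modulus gAC.
pose p n : R := clamp01 (ratr (odflt 0 (choice.unpickle n))).
pose phi n t := d (g t) (g (p n)).
have phiB n s t : `|phi n t - phi n s| <= d (g s) (g t).
  by rewrite d_sym /phi; exact: d_tri2.
have /choice[k kP] : forall n, exists k : R -> R, [/\ mu.-integrable setT (EFin \o k),
    forall s t, 0 <= s -> s <= t -> t <= 1 ->
      phi n t - phi n s = \int[mu]_(r in `]s, t]) k r &
    {ae mu, forall x : R, 0 < x < 1 -> is_derive x (1 : R) (phi n) (k x)}].
  by move=> n; apply: (AC01_density gAC (M := 1)) => s t _ _; rewrite mul1r.
(* Truncating by [|kH t|] keeps the supremum finite at every [t], and integrable; a.e. it changes
   nothing, as the increments of [phi n] are dominated by those of [H]. *)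
pose u n (t : R) : R := Num.min `|k n t| `|kH t|.
pose psi t := sup [set u n t | n in setT].
have uub t : has_ubound [set u n t | n in setT].
  by exists `|kH t| => _ [n _ <-]; rewrite /u ge_min lexx orbT.
have psi_ge n t : u n t <= psi t by apply: ub_le_sup => //; exists n.
have psi_le t : psi t <= `|kH t|.
  apply: ge_sup; first by exists (u 0%N t); exists 0%N.
  by move=> _ [n _ <-]; rewrite /u ge_min lexx orbT.
have psi0 t : 0 <= psi t.
  by apply: le_trans (psi_ge 0%N t); rewrite /u le_min !normr_ge0.
have mnorm (f : R -> R) : mu.-integrable setT (EFin \o f) ->
    measurable_fun setT (fun t => `|f t|).
  move=> /measurable_int /measurable_EFinP mf.
  exact: measurableT_comp.
have mpsi : measurable_fun setT psi.
  have := @measurable_fun_sups _ _ R setT u 0.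
  rewrite (_ : (fun x => sups (u^~ x) 0) = psi); last first.
    apply/funext => t; rewrite /sups /sdrop /psi; congr sup.
    by apply/seteqP; split=> y /= [n ? <-]; exists n.
  apply=> [t _|n]; first exact: uub.
  by apply: measurable_minr; apply: mnorm => //; have [] := kP n.
have ipsi : mu.-integrable setT (EFin \o psi).
  apply: le_integrable ikH => //; first exact/measurable_EFinP.
  by move=> t _ /=; rewrite lee_fin ger0_norm.
have dH s t : 0 <= s <= 1 -> 0 <= t <= 1 -> d (g s) (g t) <= `|H t - H s|.
  move=> /andP[s0 s1] /andP[t0 t1]; case: (leP s t) => st.
    by rewrite (le_trans (gH _ _ s0 st t1))// ler_norm.
  by rewrite d_sym distrC (le_trans (gH _ _ t0 (ltW st) s1))// ler_norm.
have near01 (x : R) : 0 < x < 1 -> \forall h \near (0 : R)^', 0 <= x + h <= 1.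
  move=> x01; have : \forall y \near x, y \in `]0, 1[ by apply: near_in_itvoo; rewrite in_itv.
  move=> /nbhs_ballP[e e0 xe]; apply/nbhs_ballP; exists e => // h /= + _.
  rewrite /ball/= sub0r normrN => he; have := xe (x + h).
  rewrite /ball/= opprD addNKr normrN => /(_ he); rewrite in_itv/=.
  by move=> /andP[/ltW-> /ltW].
have quot (f : R -> R) (x l : R) : is_derive x (1 : R) f l ->
    `|f (x + h) - f x| / `|h| @[h --> 0^'] --> `|l|.
  move=> /is_derive_quotient fx.
  under eq_fun do rewrite -normf_div; exact: cvg_norm.
have knH : {ae mu, forall (x : R) n, 0 < x < 1 ->
    is_derive x (1 : R) (phi n) (k n x) /\ `|k n x| = u n x}.
  apply: ae_foralln => n; have [_ _ kn] := kP n.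
  have := ae_lebesgueI kn Hd; apply: ae_lebesgueS => x [/[swap] + /[swap] x01].
  move=> /(_ x01) dHx /(_ x01) dphi; split=> //.
  rewrite /u; apply/esym/min_idPl.
  apply: ler_cvg_to (quot _ _ _ dphi) (quot _ _ _ dHx) _.
  have nx := near01 x x01.
  near=> h; rewrite ler_wpM2r// ?invr_ge0//.
  apply: (le_trans (phiB _ _ _)); apply: dH.
    by case/andP: x01 => /ltW-> /ltW.
  by near: h.
(* If [p n] is close to [s], then [phi n t - phi n s] is close to [d (g s) (g t)]; it is also at
   most the integral of [|k n|], which is at most [psi] a.e. *)
have dpsi s t : 0 <= s -> s <= t -> t <= 1 ->
    d (g s) (g t) <= \int[mu]_(r in `]s, t]) psi r.
  move=> s0 st t1.
  have s01 : 0 <= s <= 1 by rewrite s0 (le_trans st t1).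
  have phile n : phi n t - phi n s <= \int[mu]_(r in `]s, t]) psi r.
    have [ik kE _] := kP n.
    rewrite kE// -lee_fin /Rintegral !fineK; last 2 first.
    - by apply: integrable_fin_num => //; exact: (integrableS measurableT).
    - by apply: integrable_fin_num => //; exact: (integrableS measurableT).
    apply: (@le_trans _ _ (\int[mu]_(r in `]s, t]) `|k n r|%:E)%E).
      apply: le_integral => //.
      - exact: (integrableS measurableT).
      - apply: (integrableS measurableT) => //.
        exact: integrable_abse ik.
      - by move=> r _; rewrite lee_fin ler_norm.
    (* The half-open interval may contain the time 1, where no derivative is available; it is
       discarded as a null set. *)
    have le1 r : r != 1 -> (r \in `]s, t]%classic) -> 0 < r < 1.
      move=> r1; rewrite inE/= in_itv/= => /andP[sr rt].
      by rewrite (le_lt_trans s0 sr) lt_neqAle r1 (le_trans rt t1).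
    apply: ae_ge0_le_integral => //.
    - by apply/measurable_EFinP/measurable_funTS; exact: mnorm.
    - by move=> r _; rewrite lee_fin.
    - by apply/measurable_EFinP/measurable_funTS.
    have n1 : {ae mu, forall r : R, r != 1}.
      exists [set 1]; split => //; first by rewrite lebesgue_measure_set1.
      by move=> r /= /negP; rewrite negbK => /eqP.
    have := ae_lebesgueI knH n1; apply: ae_lebesgueS => r [/(_ n) kn r1] rst.
    by rewrite lee_fin; have [|_ ->] := kn _; [apply: le1 => //; rewrite inE|].
  apply/ler_addgt0Pr => e e0.
  have e20 : 0 < e / 2 by rewrite divr_gt0.
  have [n] := clamp01_rat_dense cH s01 e20; rewrite -/(p n) => pe.
  have p01 : 0 <= p n <= 1 by exact: clamp01_bounds.
  have := phile n; rewrite /phi.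
  have := dH _ _ p01 s01; rewrite d_sym => dsp.
  have := d_tri (g s) (g (p n)) (g t); rewrite (d_sym (g (p n)) (g t)).
  by have := le_lt_trans dsp pe; lra.
pose Psi t := \int[mu]_(r in `]-oo, t]) psi r.
have dPsi : {ae mu, forall x : R, derivable Psi x (1 : R) /\ derive1 Psi x = psi x}.
  apply: FTC1Ny; first by move=> y; exact: (integrableS measurableT).
  by apply: open_integrable_locally => //; exact: openT.
have := ae_lebesgueI knH dPsi; apply: ae_lebesgueS => x [kx [dPx PxE]] x01.
have isPsi : is_derive x (1 : R) Psi (psi x).
  by rewrite -PxE derive1E; exact: derivableP.
suff cl : d (g (x + h)) (g x) / `|h| @[h --> 0^'] --> psi x.
  by rewrite /metric_derivative (cvg_lim _ cl).
have x01' : 0 <= x <= 1 by case/andP: x01 => /ltW-> /ltW.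
have cPsi := quot _ _ _ isPsi; rewrite (ger0_norm (psi0 _)) in cPsi.
have up : \forall h \near (0 : R)^', d (g (x + h)) (g x) / `|h| <= `|Psi (x + h) - Psi x| / `|h|.
  have nx := near01 x x01.
  near=> h; rewrite ler_wpM2r// ?invr_ge0//.
  have xh01 : 0 <= x + h <= 1 by near: h.
  case: (leP 0 h) => h0.
    have xxh : x <= x + h by rewrite lerDl.
    rewrite d_sym /Psi Rintegral_Ny_oc// ger0_norm ?Rintegral_ge0//.
    by case/andP: x01' => ? _; case/andP: xh01 => _ ?; exact: dpsi.
  have xxh : x + h <= x by rewrite gerDl ltW.
  rewrite distrC /Psi Rintegral_Ny_oc// ger0_norm ?Rintegral_ge0//.
  by case/andP: x01' => _ ?; case/andP: xh01 => ? _; exact: dpsi.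
(* Squeeze: from above by the difference quotients of the primitive [Psi], from below by those of a
   single [phi n] whose derivative nearly attains the supremum. *)
apply/cvgrPdist_le => /= e e0.
have [n kn] : exists n, psi x - e / 2 < `|k n x|.
  have [||_ [n _ <-]] := @sup_adherent _ [set u n x | n in setT] (e / 2).
  - by rewrite divr_gt0.
  - by split => //; exists (u 0%N x); exists 0%N.
  by exists n; rewrite (kx n x01).2.
have := quot _ _ _ (kx n x01).1 => /cvgrPdist_lt /(_ (e / 2)).
rewrite divr_gt0// => /(_ erefl) lo.
move/cvgrPdist_lt : cPsi => /(_ e e0) hi.
near=> h.
have A1 : `| `|k n x| - `|phi n (x + h) - phi n x| / `|h| | < e / 2 by near: h.
have A2 : `|psi x - `|Psi (x + h) - Psi x| / `|h| | < e by near: h.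
have A3 : d (g (x + h)) (g x) / `|h| <= `|Psi (x + h) - Psi x| / `|h| by near: h.
have A4 : `|phi n (x + h) - phi n x| / `|h| <= d (g (x + h)) (g x) / `|h|.
  by rewrite ler_wpM2r// ?invr_ge0// d_sym.
move: A1 A2; rewrite !ltr_norml ler_norml => /andP[A1 A1'] /andP[A2 A2'].
by apply/andP; split; lra.
Unshelve. all: by end_near. Qed.

End curves.

(** * The local slope as a strong upper gradient *)

Section slope_upper_gradient.
Context (R : realType) (X : Type) (d : X -> X -> R).
Hypothesis dpm : pseudo_metric d.
Notation mu := (@lebesgue_measure R).
Variable F : X -> R.
Implicit Types (g : R -> X) (s t : R).

Let d_ge0 x y : 0 <= d x y. Proof. by case: dpm. Qed.
Let d_sym x y : d x y = d y x. Proof. by case: dpm. Qed.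
Let d_tri x y z : d x z <= d x y + d y z. Proof. by case: dpm. Qed.
Let d_tri2 x y z : `|d x z - d y z| <= d x y.
Proof.
by rewrite ler_norml; have := d_tri x y z; have := d_tri y x z; rewrite (d_sym y x); lra.
Qed.

Let ratio x y : \bar R :=
  (maxe 0 ((F x)%:E - (F y)%:E) * ((d x y)^-1)%:E)%E.

Let ratioE x y : ratio x y = (Num.max 0 (F x - F y) / d x y)%:E.
Proof. by rewrite /ratio -EFinB -EFin_max -EFinM. Qed.

Definition slope_radius (r : R) x : \bar R :=
  ereal_sup [set ratio x y | y in [set y | 0 < d x y < r]].

(** The suprema shrink with the radius, so the radii 1/(n+1) suffice; from a countable infimum the
    measurability of the slope can be derived. *)
Lemma local_slope_einfs x : local_slope d (EFin \o F) x =
  maxe 0%E (einfs (fun n => slope_radius n.+1%:R^-1 x) 0).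
Proof.
rewrite /local_slope; congr (maxe _ _); apply/eqP; rewrite eq_le.
apply/andP; split.
  apply: le_ereal_inf => _ [n _ <-] /=; exists n.+1%:R^-1 => //=.
apply: le_ereal_inf_tmp => _ [r /= r0 <-].
have [n nr] : exists n, n.+1%:R^-1 < r.
  exists (Num.truncn r^-1); rewrite invf_plt ?posrE//.
  by have /andP[_] := truncn_itv (ltW (eqbRL (invr_gt0 r) r0)).
apply: (@le_trans _ _ (slope_radius n.+1%:R^-1 x)).
  by apply: ereal_inf_lbound; exists n.
apply: le_ereal_sup => _ [y /= /andP[y0 yn] <-]; exists y => //=.
by rewrite y0 (lt_trans yn nr).
Qed.

(** A point [y] witnessing a value above [a] keeps doing so at nearby times: its distance stays
    strictly between 0 and [r], where the ratio is continuous. *)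
Lemma slope_radius_lsc r g :
  (forall y, continuous (fun t => d (g t) y)) -> continuous (F \o g) ->
  lower_semicontinuous (fun t => slope_radius r (g t)).
Proof.
move=> cd cF t a /=; rewrite /slope_radius => /ereal_sup_gt[_ [y /= ty <-]].
rewrite ratioE lte_fin => aty.
exists [set u | 0 < d (g u) y < r /\ a < Num.max 0 (F (g u) - F y) / d (g u) y].
  have t0 : 0 < d (g t) y by case/andP: ty.
  have c1 : d (g u) y @[u --> t] --> d (g t) y by exact: cd.
  have c2 : (Num.max 0 (F (g u) - F y) / d (g u) y) @[u --> t] -->
      Num.max 0 (F (g t) - F y) / d (g t) y.
    apply: cvgM; last by apply: cvgV => //; rewrite gt_eqF.
    apply: (@continuous_max _ _ (fun=> 0) (fun u => F (g u) - F y)).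
      exact: cst_continuous.
    by apply: cvgB; [exact: cF|exact: cvg_cst].
  near=> u; split.
    apply/andP; split; near: u; first exact: (cvgr_gt _ c1).
    by apply: (cvgr_lt _ c1); case/andP: ty.
  by near: u; exact: (cvgr_gt _ c2).
move=> u [uy au] /=; apply: (@lt_le_trans _ _ (ratio (g u) y)).
  by rewrite ratioE lte_fin.
by apply: ereal_sup_ubound; exists y.
Unshelve. all: by end_near. Qed.

(** The constant may depend on the curve: a continuous gradient is bounded on the compact image of a
    curve, but in infinite dimension not on every bounded set. *)
Hypothesis F_lip : forall g, AC01 d g -> exists M, forall s t,
  0 <= s <= 1 -> 0 <= t <= 1 -> `|F (g t) - F (g s)| <= M * d (g s) (g t).

Lemma local_slope_measurable g : AC01 d g ->
  measurable_fun (`[0, 1]%classic : set R) (local_slope d (EFin \o F) \o g).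
Proof.
move=> gAC; have [M FM] := F_lip gAC.
have [H [_ [cH _ _ gH _]]] := AC01_modulus gAC.
have dH s t : 0 <= s <= 1 -> 0 <= t <= 1 -> d (g s) (g t) <= `|H t - H s|.
  move=> /andP[s0 s1] /andP[t0 t1]; case: (leP s t) => st.
    by rewrite (le_trans (gH _ _ s0 st t1))// ler_norm.
  by rewrite d_sym distrC (le_trans (gH _ _ t0 (ltW st) s1))// ler_norm.
pose g' := g \o clamp01 (R := R).
have cg t : d (g' t) (g' u) @[u --> t] --> 0.
  have cHc : {for t, continuous (H \o clamp01 (R := R))}.
    by apply: continuous_comp; [exact: clamp01_continuous|exact: cH].
  apply/cvgr0Pnorm_le => e e0; move/cvgrPdist_le : cHc => /(_ e e0).
  apply: filterS => u; apply: le_trans; rewrite ger0_norm// distrC.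
  by apply: dH; exact: clamp01_bounds.
have cd y : continuous (fun t => d (g' t) y).
  move=> t; apply/cvgrPdist_le => e e0.
  move/cvgr0Pnorm_le : (cg t) => /(_ e e0); apply: filterS => u.
  by rewrite ger0_norm//; apply: le_trans; exact: d_tri2.
have cF : continuous (F \o g').
  move=> t; apply/cvgrPdist_le => e e0.
  have M0 : 0 < `|M| + 1 by rewrite ltr_wpDl.
  move/cvgr0Pnorm_le : (cg t) => /(_ (e / (`|M| + 1)) (divr_gt0 e0 M0)).
  apply: filterS => u; rewrite ger0_norm// ler_pdivlMr// => dM.
  rewrite distrC /= (le_trans (FM _ _ (clamp01_bounds _) (clamp01_bounds _)))//.
  apply: le_trans dM; rewrite mulrC ler_wpM2l//.
  by rewrite (le_trans (ler_norm M))// lerDl.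
have mg : measurable_fun setT (local_slope d (EFin \o F) \o g').
  rewrite (_ : _ \o _ =
    fun t => maxe 0%E (einfs (fun n => slope_radius n.+1%:R^-1 (g' t)) 0)); last first.
    by apply/funext => t /=; rewrite local_slope_einfs.
  apply: measurable_maxe => //; apply: measurable_fun_einfs => n.
  by apply: lower_semicontinuous_measurable; exact: slope_radius_lsc.
apply: (eq_measurable_fun (local_slope d (EFin \o F) \o g')).
  by move=> t; rewrite inE/= in_itv/= /g' => t01; rewrite /= clamp01_id.
exact: measurable_funTS.
Qed.

(** Running along the curve in the direction of time in which [F] decreases, the ratios that define
    the slope converge to [|k| / v], so the supremum at every radius is at least that value. *)
Lemma derivative_le_slope g (x k v : R) :
  is_derive x (1 : R) (F \o g) k ->
  d (g (x + h)) (g x) / `|h| @[h --> (0 : R)^'] --> v ->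
  (exists M, \forall h \near (0 : R)^',
     `|F (g (x + h)) - F (g x)| <= M * d (g (x + h)) (g x)) ->
  (`|k|%:E <= local_slope d (EFin \o F) (g x) * v%:E)%E.
Proof.
move=> /is_derive_quotient kF dv [M FM].
have v0 : 0 <= v.
  rewrite -(cvg_lim (@Rhausdorff R) dv); apply: limr_ge; first exact: cvgP dv.
  by near=> h; rewrite divr_ge0.
have [->|k0] := eqVneq k 0.
  by rewrite normr0 mule_ge0 ?lee_fin// le_max lexx.
(* If [v] vanished, the Lipschitz bound would force [k = 0]. *)
have {}v0 : 0 < v.
  rewrite lt_neqAle v0 andbT; apply: contra k0 => /eqP/esym v0'; rewrite v0' in dv.
  rewrite -normr_le0.
  have kF' : `|F (g (x + h)) - F (g x)| / `|h| @[h --> (0 : R)^'] --> `|k|.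
    by under eq_fun do rewrite -normf_div; exact: cvg_norm.
  have dv' : M * (d (g (x + h)) (g x) / `|h|) @[h --> (0 : R)^'] --> 0.
    by rewrite -[X in _ --> X](mulr0 M); exact: (cvgM (cvg_cst M) dv).
  apply: ler_cvg_to kF' dv' _; near=> h.
  by rewrite mulrA ler_wpM2r ?invr_ge0//; near: h.
pose sg : R := - Num.sg k.
have sg1 : `|sg| = 1 by rewrite /sg normrN normr_sg k0.
have sg0 : sg != 0 by rewrite -normr_gt0 sg1.
have toS : sg * h @[h --> (0 : R)^'+] --> (0 : R)^'.
  move=> A /nbhs_ballP[e /= e0 eA].
  suff : \forall h \near (0 : R)^'+, A (sg * h) by [].
  near=> h; apply: eA.
    rewrite /ball/= sub0r normrN normrM sg1 mul1r gtr0_norm//.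
  by rewrite mulf_neq0// gt_eqF.
have dS : d (g (x + sg * h)) (g x) / h @[h --> (0 : R)^'+] --> v.
  have := cvg_comp _ _ toS dv; apply: cvg_trans; apply: near_eq_cvg; near=> h.
  by rewrite /= normrM sg1 mul1r gtr0_norm.
have fS : (F (g x) - F (g (x + sg * h))) / h @[h --> (0 : R)^'+] --> `|k|.
  have kE : `|k| = - sg * k by rewrite /sg opprK -normrEsg.
  have := cvgM (cvg_cst (- sg)) (cvg_comp _ _ toS kF); rewrite -kE => /(_ _ _).
  apply: cvg_trans; apply: near_eq_cvg; near=> h.
  have hn0 : h != 0 by rewrite gt_eqF.
  by rewrite /=; field; rewrite hn0 sg0.
have rS : (F (g x) - F (g (x + sg * h))) / d (g x) (g (x + sg * h))
    @[h --> (0 : R)^'+] --> `|k| / v.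
  have : ((F (g x) - F (g (x + sg * h))) / h) / (d (g (x + sg * h)) (g x) / h)
      @[h --> (0 : R)^'+] --> `|k| / v.
    by apply: cvgM fS _; apply: cvgV dS; rewrite gt_eqF.
  apply: cvg_trans.
  apply: near_eq_cvg; near=> h.
  have h0 : h != 0 by rewrite gt_eqF.
  have : d (g (x + sg * h)) (g x) / h != 0.
    by rewrite gt_eqF//; near: h; exact: (cvgr_gt _ dS).
  rewrite mulf_eq0 negb_or => /andP[dn0 _].
  by rewrite (d_sym (g x)); field; rewrite h0 dn0.
rewrite -lee_pdivrMr// -EFinM le_max; apply/orP; right.
apply: le_ereal_inf_tmp => _ [r /= r0 <-].
rewrite leNgt; apply/negP => lt.
have : \forall h \near (0 : R)^'+,
  (((F (g x) - F (g (x + sg * h))) / d (g x) (g (x + sg * h)))%:E <=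
   slope_radius r (g x))%E.
  near=> h.
  have h0 : 0 < h by [].
  have d0 : 0 < d (g x) (g (x + sg * h)).
    have : 0 < d (g (x + sg * h)) (g x) / h by near: h; exact: (cvgr_gt _ dS).
    by rewrite pmulr_lgt0 ?invr_gt0// d_sym.
  apply: (@le_trans _ _ (ratio (g x) (g (x + sg * h)))).
    by rewrite ratioE lee_fin ler_wpM2r ?invr_ge0// le_max lexx orbT.
  apply: ereal_sup_ubound; exists (g (x + sg * h)) => //=; rewrite d0/=.
  rewrite d_sym; have : d (g (x + sg * h)) (g x) / h < v + 1.
    by near: h; apply: (cvgr_lt _ dS); rewrite ltrDl.
  rewrite ltr_pdivrMr// => /lt_trans; apply.
  rewrite mulrC -ltr_pdivlMr ?addr_gt0//; near: h; apply: nbhs_right_lt.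
  by rewrite divr_gt0// addr_gt0.
move: lt; rewrite -/(slope_radius r (g x)).
case: (slope_radius r (g x)) => [s||]//=.
  rewrite lte_fin ltNge => /negP ks nr; apply: ks.
  rewrite -(cvg_lim (@Rhausdorff R) rS); apply: limr_le; first exact: cvgP rS.
  by apply: filterS nr => h; rewrite lee_fin.
move=> _ nr; near (0 : R)^'+ => h; exfalso.
suff : (((F (g x) - F (g (x + sg * h))) / d (g x) (g (x + sg * h)))%:E <= -oo)%E.
  by rewrite leeNy_eq.
by near: h.
Unshelve. all: by end_near. Qed.

Lemma local_slope_strong_upper_gradient :
  strong_upper_gradient d (EFin \o F) (local_slope d (EFin \o F)).
Proof.
split=> [x|g gAC]; first by rewrite le_max lexx.
split; first exact: local_slope_measurable.
move=> s t s0 st t1 /=.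
have [M FM] := F_lip gAC.
have [k [ik kE dk]] := AC01_density dpm gAC FM.
have iks : mu.-integrable `[s, t] (EFin \o k) by exact: (integrableS measurableT).
rewrite kE//; [|exact: ltW..].
rewrite Rintegral_itv_obnd_cbnd; last exact: (integrableS measurableT).
apply: (@le_trans _ _ (\int[mu]_(r in `[s, t]) `|k r|%:E)%E).
  rewrite -abse_EFin /Rintegral fineK; last exact: integrable_fin_num.
  by apply: le_abse_integral => //; exact: measurable_int iks.
apply: ae_le_integral_minorant => //.
- apply/measurable_EFinP/measurable_funTS/measurableT_comp => //.
  by apply/measurable_EFinP; exact: measurable_int ik.
- by move=> r _; rewrite mule_ge0 ?lee_fin ?metric_derivative_ge0// le_max lexx.
have := ae_lebesgueI dk (metric_derivative_ae dpm gAC).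
apply: ae_lebesgueS => r [dkr dgr]; rewrite /= in_itv/= => /andP[sr rt].
have r01 : 0 < r < 1 by rewrite (lt_le_trans s0 sr) (le_lt_trans rt t1).
apply: derivative_le_slope (dkr r01) (dgr r01) _.
exists M; have : \forall y \near r, y \in `]0, 1[ by apply: near_in_itvoo; rewrite in_itv.
move=> /nbhs_ballP[e e0 xe]; apply/nbhs_ballP; exists e => // h /= + _.
rewrite /ball/= sub0r normrN => he; have := xe (r + h).
rewrite /ball/= opprD addNKr normrN => /(_ he); rewrite in_itv/= => /andP[a0 a1].
by rewrite d_sym; apply: FM; rewrite ?(ltW a0) ?(ltW a1)//; case/andP: r01 => /ltW-> /ltW.
Qed.

End slope_upper_gradient.

(** * The Wasserstein pseudo-metric of a bounded, finitely approximable pseudo-metric *)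

Section measure_tools.
Context (disp : measure_display) (T : measurableType disp) (R : realType).
Local Open Scope ereal_scope.

(** On [D] the measure is the sum of its restrictions to [D] and to the complement, and the latter
    gives [D] mass 0. *)
Lemma ge0_integral_mrestr (mu : {measure set T -> \bar R}) (D : set T)
    (mD : measurable D) (f : T -> \bar R) :
  measurable_fun setT f -> (forall x, 0 <= f x) ->
  \int[mrestr mu mD]_x f x = \int[mu]_(x in D) f x.
Proof.
move=> mf f0; have mC := measurableC mD.
have mfD (A : set T) : measurable_fun A f by exact: measurable_funTS.
transitivity (\int[mrestr mu mD]_(x in D) f x).
  rewrite (@ge0_negligible_integral _ _ _ _ setT (~` D)) ?setTD ?setCK//.
  by rewrite /= /mrestr setICl measure0.
transitivity (\int[measure_add (mrestr mu mD) (mrestr mu mC)]_(x in D) f x).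
  rewrite ge0_integral_measure_add// [X in _ + X](_ : _ = 0) ?adde0//.
  apply: null_set_integral => //.
  by rewrite /= /mrestr setICr measure0.
apply: eq_measure_integral => A mA AD.
rewrite /= /msum !big_ord_recl big_ord0 adde0 /= /mrestr -measureU//; last 3 first.
- exact: measurableI.
- exact: measurableI.
- by rewrite setIACA setICr setI0.
by rewrite -setIUr setUv setIT.
Qed.

Lemma bounded_integrable (P : probability T R) (f : T -> R) (M : R) :
  measurable_fun setT f -> (forall x, `|f x| <= M)%R ->
  P.-integrable setT (EFin \o f).
Proof.
move=> mf fM; apply: measurable_bounded_integrable => //.
  by rewrite (le_lt_trans (probability_le1 P measurableT))// ltry.
exists M; split; first exact: num_real.
by move=> x Mx y _; exact: le_trans (fM y) (ltW Mx).
Qed.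

End measure_tools.

Section finite_index.
Context (disp : measure_display) (T : measurableType disp).

Lemma measurable_fun_finite_index (I : finType) (c : T -> I) d' (U : measurableType d')
    (phi : I -> U) :
  (forall i, measurable (c @^-1` [set i])) -> measurable_fun setT (phi \o c).
Proof.
move=> mc _ B mB; rewrite setTI.
rewrite (_ : _ @^-1` B = \bigcup_(i in phi @^-1` B) (c @^-1` [set i])).
  by apply: fin_bigcup_measurable => //; exact: finite_finset.
by apply/seteqP; split => x /=; [move=> Bx; exists (c x)|case=> i Bi ->].
Qed.

End finite_index.

(** A measurable form of total boundedness, in the role of separability: Lipschitz functions are
    uniform limits of functions constant on the cells, and the distance of functions constant on
    products of two cells. *)
Definition finitely_approximable (disp : measure_display)
    (T : measurableType disp) (R : realType) (d : T -> T -> R) :=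
  forall e : R, 0 < e -> exists (n : nat) (c : T -> 'I_n) (a : 'I_n -> T),
    (forall i, measurable (c @^-1` [set i])) /\ (forall x, d x (a (c x)) <= e).

Section optimal_transport.
Context (disp : measure_display) (T : measurableType disp) (R : realType).
Context (d : T -> T -> R) (D : R).
Hypothesis dpm : pseudo_metric d.
Hypothesis d_bounded : forall x y, d x y <= D.
Hypothesis d_approx : finitely_approximable d.
Implicit Types mu nu rho : probability T R.

Let d_ge0 x y : 0 <= d x y. Proof. by case: dpm. Qed.
Let d_sym x y : d x y = d y x. Proof. by case: dpm. Qed.
Let d_tri x y z : d x z <= d x y + d y z. Proof. by case: dpm. Qed.

Lemma lipschitz_measurable (f : T -> R) (M : R) :
  (forall x y, `|f x - f y| <= M * d x y) -> measurable_fun setT f.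
Proof.
move=> fM.
have /choice[s sP] : forall k : nat, exists s : T -> R, measurable_fun setT s /\
    forall x, `|f x - s x| <= `|M| * k.+1%:R^-1.
  move=> k; have [|n [c [a [mc ca]]]] := d_approx (e := k.+1%:R^-1).
    by rewrite invr_gt0.
  exists ((f \o a) \o c); split; first exact: measurable_fun_finite_index.
  move=> x /=; apply: (le_trans (fM _ _)).
  apply: (@le_trans _ _ (`|M| * d x (a (c x)))).
    by rewrite ler_wpM2r// ler_norm.
  by rewrite ler_wpM2l.
apply: (measurable_fun_cvg (fun k => (sP k).1)) => x _.
apply/cvgrPdist_le => e e0.
have : `|M| * k.+1%:R^-1 @[k --> \oo] --> (0 : R).
  rewrite -[X in _ --> X](mulr0 `|M|).
  by apply: cvgM; [exact: cvg_cst|exact: cvg_harmonic].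
move=> /cvgr0Pnorm_le /(_ e e0); apply: filterS => k.
rewrite ger0_norm ?mulr_ge0 ?invr_ge0//; apply: le_trans.
by have [_] := sP k; exact.
Qed.

(** Continuity alone would not do, since the product sigma-algebra is generated by measurable
    rectangles; the distance is a uniform limit of functions constant on finitely many of them. *)
Lemma measurable_dist : measurable_fun setT (fun z : T * T => d z.1 z.2).
Proof.
have /choice[s sP] : forall k : nat, exists s : T * T -> R, measurable_fun setT s /\
    forall z, `|d z.1 z.2 - s z| <= 2 * k.+1%:R^-1.
  move=> k; have [|n [c [a [mc ca]]]] := d_approx (e := k.+1%:R^-1).
    by rewrite invr_gt0.
  exists ((fun ij : 'I_n * 'I_n => d (a ij.1) (a ij.2)) \o
          (fun z : T * T => (c z.1, c z.2))); split.
    apply: measurable_fun_finite_index => -[i j].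
    rewrite (_ : _ @^-1` _ = (c @^-1` [set i]) `*` (c @^-1` [set j])).
      exact: measurableX.
    by apply/seteqP; split=> z /= [] <- <-.
  move=> [x y] /=; have := ca x; have := ca y.
  set x' := a (c x); set y' := a (c y) => yy xx.
  have := d_tri x x' y; have := d_tri x' y' y.
  have := d_tri x' x y'; have := d_tri x y y'.
  rewrite (d_sym y' y) (d_sym x' x) => h1 h2 h3 h4.
  move: yy xx; move: k.+1%:R^-1 => e yy xx.
  by rewrite ler_norml; lra.
apply: (measurable_fun_cvg (fun k => (sP k).1)) => x _.
apply/cvgrPdist_le => e e0.
have : (2 : R) * k.+1%:R^-1 @[k --> \oo] --> (0 : R).
  rewrite -[X in _ --> X](mulr0 2).
  by apply: cvgM; [exact: cvg_cst|exact: cvg_harmonic].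
move=> /cvgr0Pnorm_le /(_ e e0); apply: filterS => k.
rewrite ger0_norm ?mulr_ge0 ?invr_ge0//; apply: le_trans.
by have [_] := sP k; exact.
Qed.

Definition transport_cost (P : probability (T * T)%type R) : R :=
  \int[P]_z (d z.1 z.2) ^+ 2.

Let measurable_cost : measurable_fun setT (fun z : T * T => (d z.1 z.2) ^+ 2).
Proof. by apply: measurable_funX; exact: measurable_dist. Qed.

Lemma integrable_cost (P : probability (T * T)%type R) :
  P.-integrable setT (EFin \o (fun z => (d z.1 z.2) ^+ 2)).
Proof.
apply: (@bounded_integrable _ _ _ _ _ (D ^+ 2)) => // z.
by rewrite ger0_norm ?sqr_ge0// ler_sqr ?nnegrE ?d_bounded// (le_trans (d_ge0 z.1 z.2)).
Qed.

Lemma transport_costE (P : probability (T * T)%type R) :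
  (transport_cost P)%:E = (\int[P]_z ((d z.1 z.2) ^+ 2)%:E)%E.
Proof.
by rewrite /transport_cost /Rintegral fineK// integrable_fin_num//; exact: integrable_cost.
Qed.

Lemma transport_cost_ge0 P : 0 <= transport_cost P.
Proof. by apply: Rintegral_ge0 => z _; exact: sqr_ge0. Qed.

Lemma couplings_nonempty mu nu : couplings mu nu !=set0.
Proof.
have E A B : measurable A -> measurable B -> ((mu \x nu) (A `*` B) = mu A * nu B)%E.
  exact: product_measure1E.
exists (mu \x nu)%E => A mA; split; rewrite [LHS]E//.
  by rewrite -[RHS]mule1; congr (_ * _)%E; exact: probability_setT.
by rewrite -[RHS]mul1e; congr (_ * _)%E; exact: probability_setT.
Qed.

(** Costs are finite and couplings exist, so neither [fine] nor the square root takes a default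
    value. *)
Lemma wasserstein2_sqr mu nu : ((wasserstein2 d mu nu ^+ 2)%:E =
  ereal_inf [set (transport_cost P)%:E | P in couplings mu nu])%E.
Proof.
set S := [set _ | _ in _].
have S0 : (0 <= ereal_inf S)%E.
  by apply: le_ereal_inf_tmp => _ [P _ <-]; rewrite lee_fin transport_cost_ge0.
have Sf : ereal_inf S \is a fin_num.
  rewrite ge0_fin_numE//; have [P PC] := couplings_nonempty mu nu.
  apply: (@le_lt_trans _ _ (transport_cost P)%:E); last exact: ltry.
  by apply: ereal_inf_lbound; exists P.
rewrite /wasserstein2 (_ : [set _ | _ in _] = S); last first.
  by apply/seteqP; split=> _ [P PC <-]; exists P => //; rewrite transport_costE.
by rewrite sqr_sqrtr ?fineK// fine_ge0.
Qed.

Lemma wasserstein2_le_cost mu nu P : couplings mu nu P ->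
  wasserstein2 d mu nu ^+ 2 <= transport_cost P.
Proof.
move=> PC; rewrite -lee_fin wasserstein2_sqr.
by apply: ereal_inf_lbound; exists P.
Qed.

Lemma wasserstein2_ge0 mu nu : 0 <= wasserstein2 d mu nu.
Proof. exact: sqrtr_ge0. Qed.

Lemma wasserstein2_coupling mu nu (e : R) : 0 < e ->
  exists2 P, couplings mu nu P & transport_cost P <= wasserstein2 d mu nu ^+ 2 + e.
Proof.
move=> e0; set S := [set (transport_cost P)%:E | P in couplings mu nu].
have Sf : ereal_inf S \is a fin_num by rewrite -wasserstein2_sqr.
have [_ [P PC <-]] := lb_ereal_inf_adherent e0 Sf.
rewrite -wasserstein2_sqr -EFinD lte_fin => /ltW Pe.
by exists P.
Qed.

End optimal_transport.

Lemma sqr_add_weighted (R : realType) (l x y z : R) : 0 < l -> 0 <= z -> z <= x + y ->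
  z ^+ 2 <= (1 + l) * x ^+ 2 + (1 + l^-1) * y ^+ 2.
Proof.
move=> l0 z0 zxy; apply: (@le_trans _ _ ((x + y) ^+ 2)).
  by rewrite ler_sqr ?nnegrE// (le_trans z0).
rewrite -subr_ge0 (_ : _ - _ = (l * x - y) ^+ 2 / l).
  by rewrite divr_ge0 ?sqr_ge0 ?ltW.
by field; rewrite gt_eqF.
Qed.

(* Minkowski's inequality in an arbitrary L^2 follows from its pointwise weighted
   version [sqr_add_weighted] by optimizing the weight, here [l = b / a]. *)
Lemma le_add_of_weighted (R : realType) (z a b : R) : 0 <= z -> 0 <= a -> 0 <= b ->
  (forall l, 0 < l -> z ^+ 2 <= (1 + l) * a ^+ 2 + (1 + l^-1) * b ^+ 2) -> z <= a + b.
Proof.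
move=> z0 a0 b0 key.
(* The shift by [h] makes both [a + h] and [b + h] positive, so that the optimal weight is defined
   even if [a] or [b] vanishes. *)
apply/ler_addgt0Pr => e e0; pose h := e / 2.
have h0 : 0 < h by rewrite divr_gt0.
have ah : 0 < a + h by rewrite ltr_wpDl.
have bh : 0 < b + h by rewrite ltr_wpDl.
have -> : a + b + e = (a + h) + (b + h) by rewrite /h; field.
rewrite -(@ler_sqr _ z) ?nnegrE ?addr_ge0 ?(ltW h0)//.
have l0 : 0 < (b + h) / (a + h) by rewrite divr_gt0.
apply: (le_trans (key _ l0)).
apply: (@le_trans _ _ ((1 + (b + h) / (a + h)) * (a + h) ^+ 2 +
    (1 + ((b + h) / (a + h))^-1) * (b + h) ^+ 2)).
  have i0 : 0 < ((b + h) / (a + h))^-1 by rewrite invr_gt0.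
  apply: lerD; apply: ler_wpM2l; rewrite ?addr_ge0 ?ler01 ?(ltW l0) ?(ltW i0)//.
    by rewrite ler_sqr ?nnegrE ?(ltW ah)// lerDl ltW.
  by rewrite ler_sqr ?nnegrE ?(ltW bh)// lerDl ltW.
rewrite le_eqVlt; apply/orP; left; apply/eqP.
by field; rewrite !gt_eqF.
Qed.

Section image_measures.
Context d1 d2 (U : measurableType d1) (V : measurableType d2) (R : realType).
Local Open Scope ereal_scope.

Definition image_measure (m : {measure set U -> \bar R}) (f : U -> V)
    (mf : measurable_fun setT f) : {measure set V -> \bar R} :=
  measure_function_pushforward__canonical__measure_function_Measure m mf.

Arguments image_measure : simpl never.

Lemma ge0_integral_image_measure (m : {measure set U -> \bar R}) (f : U -> V)
    (mf : measurable_fun setT f) (h : V -> \bar R) :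
  measurable_fun setT h -> (forall y, 0 <= h y) ->
  \int[image_measure m mf]_y h y = \int[m]_x h (f x).
Proof.
move=> mh h0; rewrite [LHS](@ge0_integral_pushforward _ _ _ _ _ _ mf m setT)//.
Qed.

Definition image_probability (P : probability U R) (f : U -> V)
    (mf : measurable_fun setT f) : probability V R :=
  distribution P (HB.pack f (isMeasurableFun.Build _ _ _ _ _ mf) : {mfun U >-> V}).

Lemma ge0_integral_image_probability (P : probability U R) (f : U -> V)
    (mf : measurable_fun setT f) (h : V -> \bar R) :
  measurable_fun setT h -> (forall y, 0 <= h y) ->
  \int[image_probability P mf]_y h y = \int[P]_x h (f x).
Proof. by move=> mh h0; rewrite [LHS]ge0_integral_distribution. Qed.

Lemma finite_product_measure (a : {measure set U -> \bar R})
    (b : {measure set V -> \bar R}) :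
  a setT < +oo -> b setT < +oo ->
  exists c : {measure set (U * V)%type -> \bar R},
    (forall A B, measurable A -> measurable B -> c (A `*` B) = a A * b B) /\
    (forall f, measurable_fun setT f -> (forall z, 0 <= f z) ->
      measurable_fun setT (fun x => \int[b]_y f (x, y)) /\
      \int[c]_z f z = \int[a]_x \int[b]_y f (x, y)).
Proof.
move=> afin bfin.
(* Restricting to the whole space changes no value but records finiteness, on which the product
   measure and Tonelli rely. *)
pose a' := mfrestr measurableT afin; pose b' := mfrestr measurableT bfin.
exists (a' \x b')%E; split=> [A B mA mB|f mf f0].
  rewrite [LHS]product_measure1E// /a' /b' /= /mfrestr /mrestr !setIT//.
have bE x : \int[mfrestr measurableT bfin]_y f (x, y) = \int[b]_y f (x, y).
  by apply: eq_measure_integral => A mA _; rewrite /= /mfrestr /mrestr setIT.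
split.
  have := @measurable_fun_fubini_tonelli_F _ _ _ _ _ b' f mf f0.
  by congr (measurable_fun _ _); apply/funext => x; exact: bE.
rewrite [LHS]fubini_tonelli1//.
transitivity (\int[a]_x \int[mfrestr measurableT bfin]_y f (x, y)).
  by apply: eq_measure_integral => A mA _; rewrite /= /mfrestr /mrestr setIT.
by apply: eq_integral => x _.
Qed.

End image_measures.

Section gluing.
Context (disp : measure_display) (T : measurableType disp) (R : realType).
Context (d : T -> T -> R) (D : R).
Hypothesis dpm : pseudo_metric d.
Hypothesis d_bounded : forall x y, d x y <= D.
Hypothesis d_approx : finitely_approximable d.
Implicit Types mu nu rho : probability T R.

Let d_ge0 x y : 0 <= d x y. Proof. by case: dpm. Qed.
Let d_refl x : d x x = 0. Proof. by case: dpm. Qed.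
Let d_sym x y : d x y = d y x. Proof. by case: dpm. Qed.
Let d_tri x y z : d x z <= d x y + d y z. Proof. by case: dpm. Qed.
Let D_ge0 : 0 <= D. Proof. exact: le_trans (d_ge0 point point) _. Qed.

Let mdist : measurable_fun setT (fun z : T * T => d z.1 z.2).
Proof. exact: measurable_dist. Qed.

Let costE P : ((transport_cost d P)%:E = \int[P]_z ((d z.1 z.2) ^+ 2)%:E)%E.
Proof. exact: (transport_costE dpm d_bounded d_approx). Qed.

Let mdist_l a : measurable_fun setT (fun x => d x a).
Proof.
apply: (@lipschitz_measurable _ _ _ _ dpm d_approx _ 1) => x y; rewrite mul1r ler_norml.
by have := d_tri x y a; have := d_tri y x a; rewrite (d_sym y x); lra.
Qed.

Let mdist_r a : measurable_fun setT (fun x => d a x).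
Proof. by rewrite (_ : d a = d ^~ a)//; apply/funext => x; exact: d_sym. Qed.

(** Routing x to y through [a] bounds the squared distance by a function of x plus a function of y,
    so each leg meets the other measure only through its mass [w]. *)
Lemma iterated_cost_le (al be : {measure set T -> \bar R}) (a : T) (w l : R) :
  0 <= w -> 0 < l -> al setT = w%:E -> be setT = w%:E ->
  measurable_fun setT (fun x => \int[be]_y (d x y ^+ 2)%:E)%E ->
  (\int[al]_x \int[be]_y (d x y ^+ 2)%:E <=
    w%:E * ((1 + l)%:E * \int[al]_x (d x a ^+ 2)%:E +
            (1 + l^-1)%:E * \int[be]_y (d a y ^+ 2)%:E))%E.
Proof.
move=> w0 l0 aT bT mF.
have p0 : 0 <= 1 + l by rewrite addr_ge0 ?ltW.
have q0 : 0 <= 1 + l^-1 by rewrite addr_ge0 ?invr_ge0 ?ltW.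
pose f x := ((d x a) ^+ 2)%:E.
pose h y := ((d a y) ^+ 2)%:E.
have f0 x : (0 <= f x)%E by rewrite lee_fin sqr_ge0.
have h0 x : (0 <= h x)%E by rewrite lee_fin sqr_ge0.
have mf : measurable_fun setT f by apply/measurable_EFinP/measurable_funX.
have mh : measurable_fun setT h by apply/measurable_EFinP/measurable_funX.
rewrite -/f -/h.
set G := (\int[be]_y h y)%E.
have G0 : (0 <= G)%E by exact: integral_ge0.
have inner x : (\int[be]_y (d x y ^+ 2)%:E <=
    (1 + l)%:E * f x * w%:E + (1 + l^-1)%:E * G)%E.
  apply: (@le_trans _ _ (\int[be]_y ((1 + l)%:E * f x + (1 + l^-1)%:E * h y))%E).
    apply: ge0_le_integral => //.
    - by move=> y _; rewrite lee_fin sqr_ge0.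
    - by apply/measurable_EFinP/measurable_funX.
    - by apply: emeasurable_funD => //; exact: measurable_funeM.
    - move=> y _; rewrite -!EFinM -EFinD lee_fin.
      exact: sqr_add_weighted.
  rewrite ge0_integralD//; last 3 first.
  - by move=> y _; rewrite mule_ge0.
  - by move=> y _; rewrite mule_ge0.
  - exact: measurable_funeM.
  by rewrite integral_cst// bT ge0_integralZl.
apply: (@le_trans _ _
    (\int[al]_x (w%:E * ((1 + l)%:E * f x) + (1 + l^-1)%:E * G))%E).
  apply: ge0_le_integral => //.
  - by move=> x _; apply: integral_ge0 => y _; rewrite lee_fin sqr_ge0.
  - apply: emeasurable_funD; last exact: measurable_cst.
    by apply: measurable_funeM; exact: measurable_funeM.
  - by move=> x _; rewrite (muleC w%:E); exact: inner.
rewrite ge0_integralD//; last 3 first.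
- by move=> x _; rewrite !mule_ge0.
- by apply: measurable_funeM; exact: measurable_funeM.
- by move=> x _; rewrite mule_ge0.
rewrite integral_cst// aT ge0_integralZl//; last 2 first.
- exact: measurable_funeM.
- by move=> x _; rewrite mule_ge0.
rewrite ge0_integralZl//; set I := (\int[al]_x f x)%E.
have I0 : (0 <= I)%E by exact: integral_ge0.
by rewrite [leRHS]ge0_muleDr ?mule_ge0// [X in (_ <= _ + X)%E]muleC.
Qed.

(* The part of the glued coupling that passes through the cell [E], at the
   centre [a] of which both legs are made to meet. *)
Lemma glue_cell (P Q : probability (T * T)%type R) (E : set T) (a : T) (e l : R) :
  measurable E -> (forall x, E x -> d x a <= e) -> 0 < l ->
  P (setT `*` E) = Q (E `*` setT) ->
  exists S : {measure set (T * T)%type -> \bar R}, [/\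
    forall A, measurable A -> S (A `*` setT) = P (A `*` E),
    forall A, measurable A -> S (setT `*` A) = Q (E `*` A) &
    (\int[S]_z ((d z.1 z.2) ^+ 2)%:E <=
      (1 + l)%:E * \int[P]_(z in setT `*` E) ((d z.1 z.2 + e) ^+ 2)%:E +
      (1 + l^-1)%:E * \int[Q]_(z in E `*` setT) ((d z.1 z.2 + e) ^+ 2)%:E)%E].
Proof.
move=> mE Ea l0 PQ.
have mTE : measurable ([set: T] `*` E) by exact: measurableX.
have mET : measurable (E `*` [set: T]) by exact: measurableX.
have p0 : 0 <= 1 + l by rewrite addr_ge0 ?ltW.
have q0 : 0 <= 1 + l^-1 by rewrite addr_ge0 ?invr_ge0 ?ltW.
have rhs0 : (0 <= (1 + l)%:E * \int[P]_(z in setT `*` E) ((d z.1 z.2 + e) ^+ 2)%:E +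
      (1 + l^-1)%:E * \int[Q]_(z in E `*` setT) ((d z.1 z.2 + e) ^+ 2)%:E)%E.
  by rewrite adde_ge0// mule_ge0 ?lee_fin// integral_ge0// => z _; rewrite lee_fin sqr_ge0.
have mX A B : measurable A -> measurable B -> measurable (A `*` B : set (T * T)).
  by move=> mA mB; exact: measurableX.
(* A null cell is treated apart because the product below is divided by the mass of the cell. *)
have [w0|w0] := eqVneq (P (setT `*` E)) 0%E.
  exists mzero; split=> [A mA|A mA|].
  - by apply/esym; apply: subset_measure0 w0 => //; [exact: mX|move=> z []].
  - rewrite PQ in w0.
    by apply/esym; apply: subset_measure0 w0 => //; [exact: mX|move=> z []].
  - by rewrite integral_measure_zero.
have wfin : P (setT `*` E) \is a fin_num by exact: fin_num_measure.
set w := fine (P (setT `*` E)).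
have wE : P (setT `*` E) = w%:E by rewrite /w fineK.
have {w0} w0 : 0 < w.
  rewrite /w fine_gt0// -(ge0_fin_numE (measure_ge0 _ _)) wfin andbT.
  by rewrite lt_neqAle eq_sym w0 measure_ge0.
(* [al] is the first marginal of the part of [P] that ends in [E], [be] the second marginal of the
   part of [Q] that starts there. Both have mass [w], so their product divided by [w] has them as
   marginals. *)
pose al := image_measure (mrestr P mTE) (@measurable_fst _ _ T T).
pose be := image_measure (mrestr Q mET) (@measurable_snd _ _ T T).
have alE A : al A = P (A `*` E).
  rewrite /al /image_measure /= /pushforward /mrestr; congr (P _).
  by apply/seteqP; split=> z /=; [case=> ? []|case].
have beE A : be A = Q (E `*` A).
  rewrite /be /image_measure /= /pushforward /mrestr; congr (Q _).
  by apply/seteqP; split=> z /=; [case=> ? []|case].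
have [||g [gE gI]] := @finite_product_measure _ _ T T R al be.
- by rewrite alE wE ltry.
- by rewrite beE -PQ wE ltry.
have wi0 : 0 <= w^-1 by rewrite invr_ge0 ltW.
exists (mscale (NngNum wi0) g); split=> [A mA|A mA|].
- rewrite /= /mscale/= gE// alE beE -PQ wE muleC -muleA -EFinM mulfV ?mule1//.
  by rewrite gt_eqF.
- rewrite /= /mscale/= gE// alE beE wE muleA -EFinM mulVf ?mul1e//.
  by rewrite gt_eqF.
have mcost : measurable_fun setT (fun z : T * T => ((d z.1 z.2) ^+ 2)%:E).
  by apply/measurable_EFinP; apply: measurable_funX.
rewrite ge0_integral_mscale//=; last by move=> z _; rewrite lee_fin sqr_ge0.
have [|mF ->] := gI _ mcost; first by move=> z; rewrite lee_fin sqr_ge0.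
have {}mF : measurable_fun setT (fun x => \int[be]_y (d x y ^+ 2)%:E)%E by exact: mF.
apply: (@le_trans _ _ (w^-1%:E * (w%:E * ((1 + l)%:E * \int[al]_x (d x a ^+ 2)%:E +
    (1 + l^-1)%:E * \int[be]_y (d a y ^+ 2)%:E)))%E).
  rewrite lee_wpmul2l ?lee_fin//; apply: iterated_cost_le => //; first exact: ltW.
    by rewrite alE.
  by rewrite beE -PQ.
rewrite muleA -EFinM mulVf ?gt_eqF// mul1e.
have mf : measurable_fun setT (fun x => ((d x a) ^+ 2)%:E).
  exact/measurable_EFinP/measurable_funX.
have mh : measurable_fun setT (fun y => ((d a y) ^+ 2)%:E).
  exact/measurable_EFinP/measurable_funX.
have sqE0 (z : R) : (0 <= (z ^+ 2)%:E)%E by rewrite lee_fin sqr_ge0.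
have mde (A : set (T * T)) : measurable_fun A (fun z : T * T => ((d z.1 z.2 + e) ^+ 2)%:E).
  apply: measurable_funTS; apply/measurable_EFinP/measurable_funX.
  exact: measurable_funD.
have m1 : measurable_fun setT (fun z : T * T => ((d z.1 a) ^+ 2)%:E).
  exact: (measurableT_comp mf measurable_fst).
have m2 : measurable_fun setT (fun z : T * T => ((d a z.2) ^+ 2)%:E).
  exact: (measurableT_comp mh measurable_snd).
rewrite !ge0_integral_image_measure// !ge0_integral_mrestr//.
apply: leeD; rewrite lee_wpmul2l ?lee_fin//; apply: ge0_le_integral => //.
- exact: measurable_funTS.
- move=> z [_ /Ea Ez]; have := d_tri z.1 z.2 a => tri.
  have dz := d_ge0 z.1 z.2; have dz' := d_ge0 z.2 a.
  by rewrite lee_fin ler_sqr ?nnegrE//; lra.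
- exact: measurable_funTS.
- move=> z [/Ea Ez _]; have := d_tri a z.1 z.2; rewrite (d_sym a z.1) => tri.
  have dz := d_ge0 z.1 z.2; have dz' := d_ge0 z.1 a.
  by rewrite lee_fin ler_sqr ?nnegrE//; lra.
Qed.

Lemma bigcup_ord (U : Type) (n : nat) (F : 'I_n -> set U) :
  \bigcup_i F i = \big[setU/set0]_(i < n) F i.
Proof.
rewrite -(bigcup_seq (index_enum 'I_n)); apply/seteqP; split=> z [i _ Fi]; exists i => //.
by rewrite /= mem_index_enum.
Qed.

Lemma ge0_integral_cells (P : probability (T * T)%type R)
    (n : nat) (F : 'I_n -> set (T * T)) (h : T * T -> \bar R) :
  (forall i, measurable (F i)) -> trivIset setT F -> \bigcup_i F i = setT ->
  measurable_fun setT h -> (forall z, 0 <= h z)%E ->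
  (\sum_(i < n) \int[P]_(z in F i) h z = \int[P]_z h z)%E.
Proof.
move=> mF tF FT mh h0.
rewrite -FT bigcup_ord ge0_integral_bigsetU//.
- exact: index_enum_uniq.
- by apply: sub_trivIset tF.
- exact: measurable_funTS.
Qed.

(** Within each small cell the incoming and the outgoing mass are coupled independently. This
    replaces the conditional measures of the usual gluing lemma, at the price of the cell radius in
    the cost. *)
Lemma glue_couplings mu nu rho (P Q : probability (T * T)%type R) (e l : R) :
  couplings mu nu P -> couplings nu rho Q -> 0 < e -> 0 < l ->
  exists2 S, couplings mu rho S &
    transport_cost d S <= (1 + l) * (transport_cost d P + e) +
                          (1 + l^-1) * (transport_cost d Q + e).
Proof.
move=> PC QC e0 l0.
(* For x in [0, D] the excess 2xr + r^2 is at most r(2D + 1) because r <= 1, hence at most [e]. *)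
pose r := Num.min 1 (e / (2 * D + 1)).
have D1 : 0 < 2 * D + 1 by rewrite ltr_wpDl ?mulr_ge0.
have r0 : 0 < r by rewrite lt_min ltr01 divr_gt0.
have re : forall x, 0 <= x -> x <= D -> (x + r) ^+ 2 <= x ^+ 2 + e.
  move=> x x0 xD; have r1 : r <= 1 by rewrite ge_min lexx.
  have : r * (2 * D + 1) <= e by rewrite -ler_pdivlMr// ge_min lexx orbT.
  have : 0 <= (D - x) * r by rewrite mulr_ge0 ?subr_ge0// ltW.
  have : 0 <= (1 - r) * r by rewrite mulr_ge0 ?subr_ge0// ltW.
  by nra.
have [n [c [a [mc ca]]]] := d_approx r0.
pose E i := c @^-1` [set i].
have mE i : measurable (E i) by exact: mc.
have mTE i : measurable ([set: T] `*` E i) by exact: measurableX.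
have mET i : measurable (E i `*` [set: T]) by exact: measurableX.
have PE A : measurable A -> P (A `*` setT) = mu A by move=> mA; have [] := PC _ mA.
have PE' A : measurable A -> P (setT `*` A) = nu A by move=> mA; have [] := PC _ mA.
have QE A : measurable A -> Q (A `*` setT) = nu A by move=> mA; have [] := QC _ mA.
have QE' A : measurable A -> Q (setT `*` A) = rho A by move=> mA; have [] := QC _ mA.
have cell i : exists S : {measure set (T * T)%type -> \bar R}, [/\
    forall A, measurable A -> S (A `*` setT) = P (A `*` E i),
    forall A, measurable A -> S (setT `*` A) = Q (E i `*` A) &
    (\int[S]_z ((d z.1 z.2) ^+ 2)%:E <=
      (1 + l)%:E * \int[P]_(z in setT `*` E i) ((d z.1 z.2 + r) ^+ 2)%:E +
      (1 + l^-1)%:E * \int[Q]_(z in E i `*` setT) ((d z.1 z.2 + r) ^+ 2)%:E)%E].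
  apply: (@glue_cell P Q (E i) (a i) r l (mc i) _ l0); last by rewrite PE' ?QE.
  by move=> x <-; exact: ca.
have [S SP] := choice cell.
(* [msum] takes a sequence indexed by all naturals; indices beyond [n] get the zero measure. *)
pose S' k : {measure set (T * T)%type -> \bar R} :=
  if insub k is Some i then S i else mzero.
have S'E (i : 'I_n) : S' i = S i by rewrite /S' valK.
have sumS X : msum S' n X = (\sum_(i < n) S i X)%E.
  by apply: eq_bigr => i _; rewrite S'E.
have tE : trivIset setT E by move=> i j _ _ [x [<- <-]].
have ET : \bigcup_i E i = setT by apply/seteqP; split => x //= _; exists (c x).
have cover (p : probability (T * T)%type R) (F : 'I_n -> set (T * T)) (X : set (T * T)) :
    (forall i, measurable (F i)) -> trivIset setT F -> \bigcup_i F i = X ->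
    (\sum_(i < n) p (F i) = p X)%E.
  by move=> mF tF <-; rewrite bigcup_ord measure_bigsetU_ord.
have SA A : measurable A -> msum S' n (A `*` setT) = mu A.
  move=> mA; rewrite sumS -PE//.
  under eq_bigr do rewrite (let: And3 h _ _ := SP _ in h _ mA).
  apply: cover => [i||]; first exact: measurableX.
    by move=> i j _ _ [x [[_ +] [_ +]]]; rewrite /E/= => <- <-.
  by apply/seteqP; split=> [z [i _ []//]|z [Az _]]; exists (c z.2).
have SB A : measurable A -> msum S' n (setT `*` A) = rho A.
  move=> mA; rewrite sumS -QE'//.
  under eq_bigr do rewrite (let: And3 _ h _ := SP _ in h _ mA).
  apply: cover => [i||]; first exact: measurableX.
    by move=> i j _ _ [x [[+ _] [+ _]]]; rewrite /E/= => <- <-.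
  by apply/seteqP; split=> [z [i _ []//]|z [_ Az]]; exists (c z.1).
have ST : msum S' n setT = 1%E.
  by rewrite -setXTT SA// probability_setT.
pose Sp : probability (T * T)%type R :=
  HB.pack (msum S' n) (Measure_isProbability.Build _ _ _ (msum S' n) ST).
have SC : couplings mu rho Sp by move=> A mA; rewrite /Sp /= SA// SB.
exists Sp => //; rewrite -lee_fin costE.
clear SC; rewrite /Sp /= ge0_integral_measure_sum//; last 2 first.
- by move=> z _; rewrite lee_fin sqr_ge0.
- exact/measurable_EFinP/measurable_funX.
have mde (A : set (T * T)) : measurable_fun A (fun z : T * T => ((d z.1 z.2 + r) ^+ 2)%:E).
  apply: measurable_funTS; apply/measurable_EFinP/measurable_funX.
  exact: measurable_funD.
have de0 (z : T * T) : (0 <= ((d z.1 z.2 + r) ^+ 2)%:E)%E by rewrite lee_fin sqr_ge0.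
have inte (p : probability (T * T)%type R) :
    (\int[p]_z ((d z.1 z.2 + r) ^+ 2)%:E <= (transport_cost d p + e)%:E)%E.
  apply: (@le_trans _ _ (\int[p]_z (((d z.1 z.2) ^+ 2)%:E + e%:E))%E).
    apply: ge0_le_integral => //.
    - by apply: emeasurable_funD => //; exact/measurable_EFinP/measurable_funX.
    - by move=> z _; rewrite -EFinD lee_fin re.
  rewrite ge0_integralD//.
  - by rewrite -costE integral_cst// [X in (e%:E * X)%E]probability_setT mule1.
  - by move=> z _; rewrite lee_fin sqr_ge0.
  - exact/measurable_EFinP/measurable_funX.
  - by move=> z _; rewrite lee_fin ltW.
apply: (@le_trans _ _ (\sum_(i < n)
    ((1 + l)%:E * \int[P]_(z in setT `*` E i) ((d z.1 z.2 + r) ^+ 2)%:E +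
     (1 + l^-1)%:E * \int[Q]_(z in E i `*` setT) ((d z.1 z.2 + r) ^+ 2)%:E))%E).
  by apply: lee_sum => i _; rewrite S'E; have [] := SP i.
have p0 : 0 <= 1 + l by rewrite addr_ge0 ?ltW.
have q0 : 0 <= 1 + l^-1 by rewrite addr_ge0 ?invr_ge0 ?ltW.
rewrite big_split/= -!ge0_sume_distrr//=; last 2 first.
- by move=> i _; exact: integral_ge0.
- by move=> i _; exact: integral_ge0.
rewrite !ge0_integral_cells//.
- rewrite [leRHS](EFinD ((1 + l) * _)) (EFinM (1 + l)) (EFinM (1 + l^-1)).
  by apply: leeD; rewrite lee_wpmul2l ?lee_fin.
- by move=> i j _ _ [x [[+ _] [+ _]]]; rewrite /E/= => <- <-.
- by apply/seteqP; split=> // z _; exists (c z.1).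
- by move=> i j _ _ [x [[_ +] [_ +]]]; rewrite /E/= => <- <-.
- by apply/seteqP; split=> // z _; exists (c z.2).
Qed.

Lemma wasserstein2_triangle mu nu rho :
  wasserstein2 d mu rho <= wasserstein2 d mu nu + wasserstein2 d nu rho.
Proof.
set a := wasserstein2 d mu nu; set b := wasserstein2 d nu rho.
have a0 : 0 <= a by exact: wasserstein2_ge0.
have b0 : 0 <= b by exact: wasserstein2_ge0.
apply: le_add_of_weighted => //; first exact: wasserstein2_ge0.
move=> l l0; have li0 : 0 < l^-1 by rewrite invr_gt0.
apply/ler_addgt0Pr => e e0.
(* [k] is the total factor of the error [e / k]: each of the weights 1 + l and 1 + l^-1 carries it
   twice, once for the near-optimality of a plan and once for the gluing. *)
pose k := 2 * (2 + l + l^-1).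
have k0 : 0 < k by rewrite mulr_gt0// !addr_gt0.
have e'0 : 0 < e / k by rewrite divr_gt0.
have [P PC Pa] := wasserstein2_coupling dpm d_bounded d_approx mu nu e'0.
have [Q QC Qb] := wasserstein2_coupling dpm d_bounded d_approx nu rho e'0.
have [S SC Sle] := glue_couplings PC QC e'0 l0.
apply: (le_trans (wasserstein2_le_cost dpm d_bounded d_approx SC)).
apply: (le_trans Sle); rewrite -/a in Pa; rewrite -/b in Qb.
apply: (@le_trans _ _ ((1 + l) * (a ^+ 2 + e / k + e / k) + (1 + l^-1) * (b ^+ 2 + e / k + e / k))).
  by apply: lerD; apply: ler_wpM2l; rewrite ?addr_ge0 ?ler01 ?(ltW l0) ?(ltW li0)// lerD2r.
rewrite le_eqVlt; apply/orP; left; apply/eqP.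
have eE : e = e / k * k by rewrite divfK// gt_eqF.
by rewrite [in RHS]eE; move: (e / k) => t; rewrite /k; ring.
Qed.

Lemma wasserstein2_sym mu nu : wasserstein2 d mu nu = wasserstein2 d nu mu.
Proof.
suff H mu' nu' : wasserstein2 d mu' nu' <= wasserstein2 d nu' mu'.
  by apply/eqP; rewrite eq_le !H.
rewrite -ler_sqr ?nnegrE ?wasserstein2_ge0//.
apply/ler_addgt0Pr => e e0.
have [P PC Pe] := wasserstein2_coupling dpm d_bounded d_approx nu' mu' e0.
have mswap : measurable_fun setT (fun z : T * T => (z.2, z.1)).
  by apply: measurable_fun_pair; [exact: measurable_snd|exact: measurable_fst].
pose P' := image_probability P mswap.
have PC' : couplings mu' nu' P'.
  move=> A mA; have [PA PA'] := PC A mA; split.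
    by rewrite -PA'; congr (P _); apply/seteqP; split=> z [].
  by rewrite -PA; congr (P _); apply/seteqP; split=> z [].
apply: (le_trans (wasserstein2_le_cost dpm d_bounded d_approx PC')).
apply: le_trans Pe; rewrite -lee_fin !costE ge0_integral_image_probability//.
- by under eq_integral do rewrite /= d_sym.
- exact/measurable_EFinP/measurable_funX.
- by move=> z; rewrite lee_fin sqr_ge0.
Qed.

Lemma wasserstein2_refl mu : wasserstein2 d mu mu = 0.
Proof.
have mdiag : measurable_fun setT (fun x : T => (x, x)).
  exact: measurable_fun_pair.
pose P := image_probability mu mdiag.
have PC : couplings mu mu P.
  move=> A mA; split.
    by congr (mu _); apply/seteqP; split=> z // [].
  by congr (mu _); apply/seteqP; split=> z // [].
have := wasserstein2_le_cost dpm d_bounded d_approx PC.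
rewrite (_ : transport_cost d P = 0); last first.
  apply: (@EFin_inj R); rewrite costE ge0_integral_image_probability//.
  - by under eq_integral do rewrite /= d_refl expr0n/=; rewrite integral0.
  - exact/measurable_EFinP/measurable_funX.
  - by move=> z; rewrite lee_fin sqr_ge0.
by move=> W0; apply/eqP; rewrite -sqrf_eq0 eq_le W0 sqr_ge0.
Qed.

Lemma wasserstein2_pseudo_metric : pseudo_metric (wasserstein2 d : probability T R -> _).
Proof.
split; [exact: wasserstein2_ge0|exact: wasserstein2_refl|
        exact: wasserstein2_sym|exact: wasserstein2_triangle].
Qed.

End gluing.

(** * The metric of Omega and weak* compactness of the atoms *)

Definition totally_bounded_dist (R : realType) (X : Type) (d : X -> X -> R) :=
  forall e : R, 0 < e -> exists (I : finType) (p : I -> X),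
    forall x, exists i, d x (p i) < e.

Section borel_approximation.
Context (R : realType) (X : choiceType) (d : X -> X -> R) (x0 : X).
Hypothesis dpm : pseudo_metric d.

Lemma ball_borel_measurable (y : X) (r : R) :
  measurable ([set x | d x y < r] : set (borel d x0)).
Proof.
apply: sub_sigma_algebra => x /= xr; exists (r - d x y); first by rewrite subr_gt0.
move=> z; have [_ _ dS dT] := dpm.
by have := dT z x y; rewrite (dS z x); lra.
Qed.

(** The balls of a finite net are made disjoint by sending each point to the first index whose ball
    contains it; a cell is then a ball minus finitely many balls, hence Borel. *)
Lemma totally_bounded_approximable :
  totally_bounded_dist d -> finitely_approximable (d : borel d x0 -> borel d x0 -> R).
Proof.
move=> tb e e0; have [I [p pe]] := tb e e0.
pose q (i : 'I_#|I|) := p (enum_val i).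
have qe x : exists i, d x (q i) < e.
  by have [i ix] := pe x; exists (enum_rank i); rewrite /q enum_rankK.
pose good x i := d x (q i) < e.
have cP x : exists i, good x i /\ forall j : 'I_#|I|, (j < i)%N -> ~~ good x j.
  have [i ix] := qe x; have [j jx jmin] := @arg_minnP _ i (good x) (fun k => k) ix.
  exists j; split=> // k kj; apply/negP => /jmin; by rewrite leqNgt kj.
have [c cQ] := choice cP.
exists #|I|, c, q; split; last by move=> x; have [/ltW] := cQ x.
move=> i; rewrite (_ : _ @^-1` _ =
    [set x | d x (q i) < e] `\`
    \bigcup_(j in [set j : 'I_#|I| | (j < i)%N]) [set x | d x (q j) < e]).
  apply: measurableD; first exact: ball_borel_measurable.
  apply: fin_bigcup_measurable; first exact: finite_finset.
  by move=> j _; exact: ball_borel_measurable.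
apply/seteqP; split=> x /=.
  by move=> <-; have [gx mx] := cQ x; split=> // -[j /= /mx /negP].
move=> [ix nj]; have [gx mx] := cQ x; apply/val_inj/eqP; rewrite eqn_leq /=.
apply/andP; split; rewrite leqNgt; apply/negP => lt.
  by have /negP := mx _ lt; apply.
by apply: nj; exists (c x).
Qed.

End borel_approximation.

Section omega_metric.
Context (R : realType) (C : normedModType R) (atoms : set (dual C)).
Context (dB : atoms -> atoms -> R).
Hypothesis dB_metric : is_metric dB.

Let dB0 x y : 0 <= dB x y. Proof. by case: dB_metric. Qed.
Let dBS x y : dB x y = dB y x. Proof. by case: dB_metric. Qed.
Let dBT x y z : dB x z <= dB x y + dB y z. Proof. by case: dB_metric. Qed.
Let dBxx x : dB x x = 0. Proof. by case: dB_metric => _ + _ _; move=> /(_ x x)[_ ->]. Qed.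

Lemma dist_Omega_sqr (L : R) (x y : Omega atoms L) :
  dist_Omega dB x y ^+ 2 = `|val x.1 - val y.1| ^+ 2 + dB x.2 y.2 ^+ 2.
Proof. by rewrite sqr_sqrtr// addr_ge0 ?sqr_ge0. Qed.

Lemma dist_OmegaN_sqr (L : R) (n : nat) (x y : OmegaN atoms L n) :
  dist_OmegaN dB x y ^+ 2 =
  n%:R^-1 * \sum_(j < n) dist_Omega dB (x.1 j, x.2 j) (y.1 j, y.2 j) ^+ 2.
Proof.
rewrite sqr_sqrtr; last first.
  by rewrite mulr_ge0 ?invr_ge0// sumr_ge0// => j _; rewrite addr_ge0 ?sqr_ge0.
by congr (_ * _); apply: eq_bigr => j _; rewrite dist_Omega_sqr.
Qed.

(** The weighted form of the triangle inequality is additive over coordinates, so the coordinates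
    are summed before the weight is optimized. *)
Lemma dist_Omega_pseudo_metric (L : R) : pseudo_metric (@dist_Omega _ _ _ dB L).
Proof.
split=> [x y|x|x y|x y z]; first exact: sqrtr_ge0.
- by rewrite /dist_Omega subrr normr0 dBxx expr0n addr0 sqrtr0.
- by rewrite /dist_Omega distrC dBS.
apply: le_add_of_weighted; try exact: sqrtr_ge0.
move=> l l0; rewrite !dist_Omega_sqr !mulrDr addrACA.
apply: lerD; apply: sqr_add_weighted => //.
by rewrite (le_trans _ (ler_normD _ _))// addrA subrK.
Qed.

Lemma dist_OmegaN_pseudo_metric (L : R) (n : nat) :
  pseudo_metric (@dist_OmegaN _ _ _ dB L n).
Proof.
have [d0 dxx dS dT] := dist_Omega_pseudo_metric L.
split=> [x y|x|x y|x y z]; first exact: sqrtr_ge0.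
- rewrite /dist_OmegaN big1 ?mulr0 ?sqrtr0// => j _.
  by rewrite subrr normr0 dBxx expr0n addr0.
- rewrite /dist_OmegaN; congr (Num.sqrt (_ * _)); apply: eq_bigr => j _.
  by rewrite distrC dBS.
apply: le_add_of_weighted; try exact: sqrtr_ge0.
move=> l l0; rewrite !dist_OmegaN_sqr !(mulrCA _ n%:R^-1) -mulrDr.
rewrite ler_wpM2l ?invr_ge0// !mulr_sumr -big_split/=.
by apply: ler_sum => j _; exact: sqr_add_weighted.
Qed.

Lemma dist_Omega_le (L : R) (x y : Omega atoms L) :
  dist_Omega dB x y <= `|val x.1 - val y.1| + dB x.2 y.2.
Proof.
rewrite -ler_sqr ?nnegrE ?sqrtr_ge0 ?addr_ge0// dist_Omega_sqr sqrrD.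
by rewrite -addrA lerD2l addrC lerDl mulrn_wge0// mulr_ge0.
Qed.

Lemma dist_Omega_ge1 (L : R) (x y : Omega atoms L) :
  `|val x.1 - val y.1| <= dist_Omega dB x y.
Proof.
by rewrite -ler_sqr ?nnegrE ?sqrtr_ge0// dist_Omega_sqr lerDl sqr_ge0.
Qed.

Lemma dist_Omega_ge2 (L : R) (x y : Omega atoms L) :
  dB x.2 y.2 <= dist_Omega dB x y.
Proof.
by rewrite -ler_sqr ?nnegrE ?sqrtr_ge0// dist_Omega_sqr lerDr sqr_ge0.
Qed.

Lemma dist_Omega_totally_bounded (L : R) : 0 < L ->
  totally_bounded_dist dB -> totally_bounded_dist (@dist_Omega _ _ _ dB L).
Proof.
move=> L0 tb e e0; have e2 : 0 < e / 2 by rewrite divr_gt0.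
have e4 : 0 < e / 4 by rewrite divr_gt0.
have [I [p pe]] := tb _ e2.
(* A grid of mesh e / 4, capped at [L] to stay in the interval; together with the e / 2 spent on the
   atoms the error stays below [e]. *)
pose N := (Num.truncn (L / (e / 4))).+1.
have gP (k : 'I_N) : `[0, L]%classic (Num.min L (k%:R * (e / 4))).
  by rewrite /= in_itv/= le_min ltW//= mulr_ge0 ?(ltW e4)//= ge_min lexx.
pose grid (k : 'I_N) : `[0, L]%classic := SigSub (mem_set (gP k)).
exists ('I_N * I)%type, (fun ki => (grid ki.1, p ki.2)) => -[t u].
have [i ui] := pe u.
have /set_mem /= := valP t; rewrite in_itv/= => /andP[t0 tL].
pose k := Num.truncn (val t / (e / 4)).
have /andP[k1 k2] := truncn_itv (divr_ge0 t0 (ltW e4)).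
have kN : (k < N)%N by rewrite ltnS le_truncn// ler_pM2r// invr_gt0.
exists (Ordinal kN, i); apply: (le_lt_trans (dist_Omega_le _ _)) => /=.
move: k1 k2; rewrite -/k ler_pdivlMr// ltr_pdivrMr// => k1 k2.
rewrite (min_idPr _); last by rewrite (le_trans k1).
rewrite ger0_norm ?subr_ge0//; move: k2; rewrite -natr1 mulrDl mul1r.
lra.
Qed.

End omega_metric.

Section atoms_compactness.
Context (R : realType) (C : normedModType R) (atoms : set (dual C)).
Context (dB : atoms -> atoms -> R).

(** The metrization hypothesis quantifies over all filters, so it applies to the traces on the atoms
    of the weak* neighbourhoods of [u]. *)
Lemma metrizes_nbhs (u : atoms) (e : R) : metrizes_weakstar dB -> 0 < e ->
  exists2 U : set (weakstar C), nbhs (val u : weakstar C) U &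
    forall v : atoms, U (val v : weakstar C) -> dB v u < e.
Proof.
move=> dBw e0.
pose F : set_system atoms := [set A | exists2 U : set (weakstar C),
  nbhs (val u : weakstar C) U & forall v : atoms, U (val v) -> A v].
have FF : Filter F.
  split; first by exists setT => //; exact: filterT.
    move=> A B [U nU UA] [V nV VB]; exists (U `&` V); first exact: filterI.
    by move=> v [/UA ? /VB].
  by move=> A B AB [U nU UA]; exists U => // v /UA /AB.
have [_ H] := dBw F u FF.
have : dB v u @[v --> F] --> (0 : R).
  by apply: H => U nU; exists U.
move=> /cvgrPdist_lt /(_ e e0) [U nU UA]; exists U => // v /UA /=.
by rewrite sub0r normrN; apply: le_lt_trans; exact: ler_norm.
Qed.

Lemma weakstar_compact_totally_bounded :
  @compact (weakstar C) atoms -> metrizes_weakstar dB -> totally_bounded_dist dB.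
Proof.
rewrite compact_cover => cB dBw e e0.
have /choice[U UP] : forall u : atoms, exists U : set (weakstar C),
    nbhs (val u : weakstar C) U /\ forall v : atoms, U (val v) -> dB v u < e.
  by move=> u; have [U ? ?] := metrizes_nbhs u dBw e0; exists U.
have [|u Bu|D _ Dcov] := cB atoms setT (fun u => (U u)^°).
- by move=> u _; exact: open_interior.
- exists (SigSub (mem_set Bu)) => //.
  by have [+ _] := UP (SigSub (mem_set Bu)).
pose t := in_tuple (finmap.enum_fset D).
exists 'I_(size (finmap.enum_fset D)), (tnth t) => x.
have [u /= uD Uu] := Dcov (val x) (set_mem (valP x)).
have /tnthP[i iE] : u \in t by [].
by exists i; rewrite -iE; have [_] := UP u; apply; exact: interior_subset Uu.
Qed.

Context (Reg : dual C -> \bar R).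

(** Lower semicontinuity makes the unit ball of [Reg] weak* closed, so it contains the closure of
    its extreme points; the atoms are a closed part of this compact ball. *)
Lemma atoms_compact :
  @closed (weakstar C) atoms ->
  atoms `<=` @closure (weakstar C) (extreme_points [set u | (Reg u <= 1)%E]) ->
  @lower_semicontinuous (weakstar C) R Reg ->
  @compact (weakstar C) [set u | (Reg u <= 1%:E)%E] ->
  @compact (weakstar C) atoms.
Proof.
move=> cB Bsub lsc cR.
have clR : @closed (weakstar C) [set u | (Reg u <= 1%:E)%E].
  rewrite (_ : [set _ | _] = ~` [set u | (1%:E < Reg u)%E]); last first.
    by apply/seteqP; split=> u /=; rewrite leNgt => /negP.
  by apply: open_closedC; move/lower_semicontinuousP : lsc; exact.
have sub : atoms `<=` [set u | (Reg u <= 1%:E)%E].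
  move/closure_id : (clR) => ->; apply: subset_trans Bsub _.
  by apply: (@closureS (weakstar C)) => u [].
exact: subclosed_compact cB cR sub.
Qed.

End atoms_compactness.

(** * Curves with weak derivatives in a Hilbert space *)

Section one_sided_mvt.
Context (R : realType).

(** Quotients taken within [0, 1] are two-sided at interior times and still give continuity at 0 and
    1, which is all that the mean value theorem asks of the endpoints. *)
Lemma has_derivative_on01_mvt (f f' : R -> R) (a b : R) :
  has_derivative_on01 f f' -> 0 <= a -> a < b -> b <= 1 ->
  exists c : R, [/\ a <= c, c <= b & f b - f a = f' c * (b - a)].
Proof.
move=> ff' a0 ab b1.
have sub (x : R) : 0 < x < 1 -> x + h @[h --> (0 : R)^'] --> within `[0, 1] x^'.
  move=> /andP[x0 x1] A /= wA.
  have m0 : 0 < Num.min x (1 - x) by rewrite lt_min x0 subr_gt0.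
  have {wA} : \forall s \near x, s != x -> s \in `[0, 1] -> A s.
    by exact: wA.
  move=> /nbhs_ballP[e /= e0 eA].
  suff : \forall h \near (0 : R)^', A (x + h) by [].
  near=> h; have h0 : h != 0 by near: h; exact: nbhs_dnbhs_neq.
  have hm : `|h| < Num.min x (1 - x) by near: h; exact: dnbhs0_lt.
  have he : `|h| < e by near: h; exact: dnbhs0_lt.
  apply: eA.
  - by rewrite /ball/= opprD addNKr normrN.
  - by rewrite -subr_eq0 addrAC subrr add0r.
  - move: hm; rewrite lt_min !ltr_norml in_itv/= => /andP[/andP[? ?] /andP[? ?]].
    by apply/andP; split; lra.
have der (x : R) : x \in `]a, b[ -> is_derive x (1 : R) f (f' x).
  rewrite in_itv/= => /andP[ax xb].
  have x01 : 0 < x < 1 by rewrite (le_lt_trans a0 ax) (lt_le_trans xb b1).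
  have x01' : 0 <= x <= 1 by case/andP: x01 => /ltW-> /ltW.
  have : (h^-1 *: (f (h *: (1 : R) + x) - f x)) @[h --> (0 : R)^'] --> f' x.
    have := cvg_comp _ _ (sub _ x01) (ff' _ x01'); apply: cvg_trans.
    apply: near_eq_cvg; near=> h.
    rewrite /= -[RHS]/(h^-1 * (f (h * 1 + x) - f x)) mulr1 addrAC subrr add0r.
    by rewrite mulrC (addrC x).
  by move=> cl; split; [exact: cvgP cl|rewrite /derive; exact: cvg_lim cl].
have cnt (x : R) (G : set_system R) : 0 <= x <= 1 -> ProperFilter G ->
    G --> within `[0, 1] x^' -> f s @[s --> G] --> f x.
  move=> x01 PG Gx.
  have c1 := cvg_trans (cvg_app _ Gx) (ff' _ x01).
  have c2 : s - x @[s --> G] --> 0.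
    rewrite -[X in _ --> X](subrr x); apply: cvgB; last exact: cvg_cst.
    apply: cvg_trans Gx _; apply: cvg_trans (cvg_within _) _; exact: cvg_within.
  have c3 : (f s - f x) / (s - x) * (s - x) + f x @[s --> G] --> f x.
    rewrite -[X in _ --> X]add0r; apply: cvgD; last exact: cvg_cst.
    by rewrite -[X in _ --> X](mulr0 (f' x)); exact: cvgM.
  move: c3; apply: cvg_trans; apply: near_eq_cvg.
  have : \forall s \near G, s != x.
    by apply: Gx; apply: filterS (nbhs_dnbhs_neq x) => s.
  by apply: filterS => s sx; rewrite divfK ?subr_eq0// subrK.
have cont : {within `[a, b], continuous f}.
  apply/continuous_within_itvP => //; split.
  - move=> x xab; apply: differentiable_continuous; apply/derivable1_diffP.
    by have [] := der x xab.
  - apply: cnt; first by rewrite a0 (le_trans (ltW ab)).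
    move=> A wA.
    have {wA} : \forall s \near a, s != a -> s \in `[0, 1] -> A s.
      by exact: wA.
    move=> /nbhs_ballP[e /= e0 eA]; near=> s.
    have sa : a < s by near: s; exact: nbhs_right_gt.
    have sb : s < b by near: s; exact: nbhs_right_lt.
    apply: eA; rewrite ?gt_eqF//; last first.
      by rewrite in_itv/= (le_trans a0 (ltW sa)) (le_trans (ltW sb) b1).
    rewrite /ball/= distrC gtr0_norm ?subr_gt0// ltrBlDl.
    by near: s; apply: nbhs_right_lt; rewrite ltrDl.
  - apply: cnt; first by rewrite b1 (le_trans a0 (ltW ab)).
    move=> A wA.
    have {wA} : \forall s \near b, s != b -> s \in `[0, 1] -> A s.
      by exact: wA.
    move=> /nbhs_ballP[e /= e0 eA]; near=> s.
    have sa : a < s by near: s; exact: nbhs_left_gt.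
    have sb : s < b by near: s; exact: nbhs_left_lt.
    apply: eA; rewrite ?lt_eqF//; last first.
      by rewrite in_itv/= (le_trans a0 (ltW sa)) (le_trans (ltW sb) b1).
    rewrite /ball/= gtr0_norm ?subr_gt0// ltrBlDr -ltrBlDl.
    by near: s; apply: nbhs_left_gt; rewrite ltrBlDl ltrDr.
have [c cab fE] := MVT ab der cont.
move: cab; rewrite in_itv/= => /andP[ac cb].
by exists c; rewrite !ltW.
Unshelve. all: by end_near. Qed.

End one_sided_mvt.

Section hilbert.
Context (R : realType) (Y : normedModType R) (dot : {dot Y for idfun}).
Hypothesis dotE : forall y : Y, dot y y = `|y| ^+ 2.

Lemma dot_sym x y : dot x y = dot y x.
Proof. by rewrite hermC expr0 mul1r. Qed.

Lemma dotDl x y z : dot (x + y) z = dot x z + dot y z.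
Proof. exact: linearDl. Qed.

Lemma dotBl x y z : dot (x - y) z = dot x z - dot y z.
Proof. exact: linearBl. Qed.

Lemma dotZl (a : R) x y : dot (a *: x) y = a * dot x y.
Proof. exact: linearZl_LR. Qed.

(** Cauchy-Schwarz is read off the triangle inequality of the norm by expanding the square of |x +
    y|. *)
Lemma dot_le x y : dot x y <= `|x| * `|y|.
Proof.
have E (u v : Y) : dot (u + v) (u + v) = dot u u + dot u v *+ 2 + dot v v.
  by rewrite dotDl !(dot_sym _ (u + v)) !dotDl (dot_sym v u); ring.
have h1 : `|x + y| ^+ 2 <= (`|x| + `|y|) ^+ 2.
  by rewrite ler_sqr ?nnegrE ?addr_ge0// ler_normD.
by move: h1; rewrite -dotE E !dotE; nra.
Qed.

Lemma normr_dot_le x y : `|dot x y| <= `|x| * `|y|.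
Proof.
rewrite ler_norml dot_le andbT lerNl.
have -> : - dot x y = dot (- x) y by rewrite -scaleN1r dotZl mulN1r.
by rewrite (le_trans (dot_le _ _))// normrN.
Qed.

Lemma norm_le_of_dot (z : Y) (M : R) : 0 <= M ->
  (forall y, `|dot z y| <= M * `|y|) -> `|z| <= M.
Proof.
move=> M0 zM; have [->|z0] := eqVneq z 0; first by rewrite normr0.
have nz : 0 < `|z| by rewrite normr_gt0.
have := zM z; rewrite dotE ger0_norm ?sqr_ge0// expr2.
by rewrite ler_pM2r.
Qed.

End hilbert.

Section geodesic_bounds.
Context (R : realType) (Y : normedModType R) (dot : {dot Y for idfun}).
Hypothesis dotE : forall y : Y, dot y y = `|y| ^+ 2.
Context (f v1 v2 : R -> Y) (B1 B2 : R).
Hypothesis d1 : weak_derivative_on01 dot f v1.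
Hypothesis d2 : weak_derivative_on01 dot v1 v2.
Hypothesis b1 : forall t : R, 0 <= t <= 1 -> `|v1 t| <= B1.
Hypothesis b2 : forall t : R, 0 <= t <= 1 -> `|v2 t| <= B2.

Lemma weak_derivative_lipschitz : `|f 1 - f 0| <= B1.
Proof.
have B0 : 0 <= B1 by apply: le_trans (b1 (t := 0) _); rewrite ?lexx ?ler01.
apply: (norm_le_of_dot dotE) => // y.
have [c [c0 c1]] := has_derivative_on01_mvt (@d1 y) (lexx 0) ltr01 (lexx 1).
rewrite subr0 mulr1 -dotBl => ->.
rewrite (le_trans (normr_dot_le dotE _ _))// ler_wpM2r// b1//.
by rewrite c0 c1.
Qed.

(** Tested against [y], the gap to the chord is t(1 - t) times a difference of first derivatives at
    two intermediate times, to which the mean value theorem applies again. These times depend on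
    [y], harmlessly, as the norm is recovered from the tests. The factor [t] is kept because the
    error along geodesics must be of order t times the squared distance. *)
Lemma weak_derivative_interpolation (t : R) : 0 <= t <= 1 ->
  `|f t - ((1 - t) *: f 0 + t *: f 1)| <= t * B2.
Proof.
move=> /andP[t0 t1].
have B0 : 0 <= B2 by apply: le_trans (b2 (t := 0) _); rewrite ?lexx ?ler01.
have [->|tn0] := eqVneq t 0.
  by rewrite subr0 scale1r scale0r addr0 subrr normr0 mul0r.
have [->|tn1] := eqVneq t 1.
  by rewrite subrr scale1r scale0r add0r subrr normr0 mul1r.
have {}t0 : 0 < t by rewrite lt_neqAle eq_sym tn0.
have {}t1 : t < 1 by rewrite lt_neqAle tn1.
apply: (norm_le_of_dot dotE); first by rewrite mulr_ge0// ltW.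
move=> y.
have [c [c0 ct cE]] := has_derivative_on01_mvt (@d1 y) (lexx 0) t0 (ltW t1).
have [e [te e1 eE]] := has_derivative_on01_mvt (@d1 y) (ltW t0) t1 (lexx 1).
rewrite dotBl dotDl !dotZl.
have -> : dot (f t) y - ((1 - t) * dot (f 0) y + t * dot (f 1) y) =
    (1 - t) * (dot (f t) y - dot (f 0) y) - t * (dot (f 1) y - dot (f t) y) by ring.
rewrite cE eE subr0.
have -> : (1 - t) * (dot (v1 c) y * t) - t * (dot (v1 e) y * (1 - t)) =
    t * (1 - t) * (dot (v1 c) y - dot (v1 e) y) by ring.
have dv : `|dot (v1 c) y - dot (v1 e) y| <= B2 * `|y|.
  have [->|ce] := eqVneq c e; first by rewrite subrr normr0 mulr_ge0.
  have {}ce : c < e by rewrite lt_neqAle ce (le_trans ct te).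
  have [z [cz ze zE]] := has_derivative_on01_mvt (@d2 y) c0 ce e1.
  rewrite distrC zE normrM (ger0_norm (x := e - c)) ?subr_ge0 ?(ltW ce)//.
  rewrite (@le_trans _ _ `|dot (v2 z) y|)//.
    by rewrite ler_piMr//; lra.
  rewrite (le_trans (normr_dot_le dotE _ _))// ler_wpM2r// b2//.
  by rewrite (le_trans c0 cz) (le_trans ze e1).
rewrite normrM ger0_norm ?mulr_ge0 ?subr_ge0 ?(ltW t0) ?(ltW t1)//.
rewrite -2!mulrA ler_wpM2l ?(ltW t0)//.
apply: le_trans dv; rewrite ler_piMl//.
by lra.
Qed.

End geodesic_bounds.

(** * Bochner integrals of Lipschitz maps *)

Section dual_lemmas.
Context (R : realType) (V : normedModType R).
Implicit Types l : dual V.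

Definition dual_linear_map l : {linear V -> R^o} :=
  HB.pack (l : V -> R^o) (GRing.isLinear.Build _ _ _ _ (l : V -> R^o) (@dual_linear _ _ l)).

Lemma dualD l x y : l (x + y) = l x + l y.
Proof. exact: (raddfD (dual_linear_map l)). Qed.

Lemma dualB l x y : l (x - y) = l x - l y.
Proof. exact: (raddfB (dual_linear_map l)). Qed.

Lemma dualZ l (a : R) x : l (a *: x) = a * l x.
Proof. exact: (linearZ_LR (dual_linear_map l)). Qed.

Lemma dual0 l : l 0 = 0.
Proof. exact: (raddf0 (dual_linear_map l)). Qed.

Lemma dual_sum l (I : Type) (s : seq I) (F : I -> V) :
  l (\sum_(i <- s) F i) = \sum_(i <- s) l (F i).
Proof. exact: (raddf_sum (dual_linear_map l)). Qed.

Lemma dual_norm_ge0 l : 0 <= dual_norm l.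
Proof. by apply: le_trans (dual_norm_ub l (x := 0) _); rewrite ?normr0. Qed.

Lemma dual_le l x : `|l x| <= dual_norm l * `|x|.
Proof.
have [->|x0] := eqVneq x 0; first by rewrite dual0 !normr0 mulr0.
have nx : 0 < `|x| by rewrite normr_gt0.
have := dual_norm_ub l (x := `|x|^-1 *: x).
rewrite normrZ normfV normr_id mulVf ?gt_eqF// => /(_ (lexx _)).
by rewrite dualZ normrM normfV normr_id ler_pdivrMl// mulrC.
Qed.

End dual_lemmas.

Section dot_dual.
Context (R : realType) (Y : normedModType R) (dot : {dot Y for idfun}).
Hypothesis dotE : forall y : Y, dot y y = `|y| ^+ 2.

Lemma dot_linear (y : Y) : linear (fun x : Y => dot x y : R^o).
Proof. by move=> a u v; rewrite dotDl dotZl. Qed.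

Lemma dot_continuous (y : Y) : continuous (fun x : Y => dot x y : R^o).
Proof.
move=> x; apply/cvgrPdist_le => e e0.
have y1 : 0 < `|y| + 1 by rewrite ltr_wpDl.
have : \forall z \near x, `|x - z| <= e / (`|y| + 1).
  have h : z @[z --> x] --> x by exact: cvg_id.
  by move/cvgrPdist_le : h; apply; rewrite divr_gt0.
apply: filterS => z xz; rewrite -dotBl (le_trans (normr_dot_le dotE _ _))//.
rewrite ler_pdivlMr// in xz; apply: le_trans xz.
by rewrite ler_wpM2l// lerDl.
Qed.

Definition dot_dual (y : Y) : dual Y :=
  Dual (mem_set (conj (dot_linear y) (@dot_continuous y)) :
    (fun x : Y => dot x y : R^o) \in @dual_pred R Y).

Lemma dot_dualE y x : dot_dual y x = dot x y.
Proof. by []. Qed.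

End dot_dual.

Section integrable_real.
Context (disp : measure_display) (T : measurableType disp) (R : realType).
Context (nu : {measure set T -> \bar R}).
Implicit Types f g : T -> R.

Lemma integrable_EFinB f g :
  nu.-integrable setT (EFin \o f) -> nu.-integrable setT (EFin \o g) ->
  nu.-integrable setT (EFin \o (fun x => f x - g x)).
Proof.
move=> fi gi; rewrite (_ : _ \o _ = (EFin \o f) \- (EFin \o g))%E.
  exact: integrableB.
exact/funext.
Qed.

Lemma integrable_EFinD f g :
  nu.-integrable setT (EFin \o f) -> nu.-integrable setT (EFin \o g) ->
  nu.-integrable setT (EFin \o (fun x => f x + g x)).
Proof.
move=> fi gi; rewrite (_ : _ \o _ = (EFin \o f) \+ (EFin \o g))%E.
  exact: integrableD.
exact/funext.
Qed.

Lemma integrable_EFinZ (k : R) f :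
  nu.-integrable setT (EFin \o f) -> nu.-integrable setT (EFin \o (fun x => k * f x)).
Proof.
move=> fi; rewrite (_ : _ \o _ = (fun x => k%:E * (f x)%:E)%E); last exact/funext.
exact: integrableZl.
Qed.

End integrable_real.

Section simple_integral.
Context (disp : measure_display) (T : measurableType disp) (R : realType).
Context (Y : normedModType R) (nu : probability T R).
Implicit Types (l : dual Y) (s : T -> Y).

Lemma simple_map_dual l s : simple_map s ->
  nu.-integrable setT (EFin \o (fun x => l (s x))) /\
  l (simple_integral nu s) = \int[nu]_x l (s x).
Proof.
move=> [sfin ms]; pose D : seq Y := finmap.enum_fset (fset_set (range s)).
have sD x : s x \in D.
  by rewrite -[_ \in _]/(s x \in fset_set (range s)) in_fset_set//; apply/mem_set; exists x.
have uD : uniq D by exact: finmap.fset_uniq.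
pose h y x : \bar R := (l y * \1_(s @^-1` [set y]) x)%:E.
have lsE : EFin \o (fun x => l (s x)) = fun x => (\sum_(y <- D) h y x)%E.
  apply/funext => x /=; rewrite sumEFin (bigD1_seq (s x))//=.
  rewrite big1 ?addr0; last first.
    move=> y ys; rewrite indicE memNset ?mulr0//= => sxy.
    by move: ys; rewrite sxy eqxx.
  by rewrite indicE mem_set// mulr1.
have ih y : nu.-integrable setT (h y).
  apply: (@bounded_integrable _ _ _ nu _ `|l y|) => [|x].
    apply: measurable_funM => //; exact: measurable_indic.
  by rewrite normrM ler_piMr// indicE; case: (_ \in _); rewrite ?normr1 ?normr0.
split; first by rewrite lsE; exact: integrable_sum.
rewrite /simple_integral fsbig_finite//= dual_sum -/D /Rintegral.
rewrite -[X in fine X](_ : (\sum_(y <- D) (l y)%:E * nu (s @^-1` [set y]))%E = _).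
  rewrite -[LHS]/(fine (\sum_(i <- D) _)%:E) -sumEFin; congr fine; apply: eq_bigr => y _.
  by rewrite dualZ EFinM fineK ?fin_num_measure// muleC.
transitivity (\int[nu]_x (\sum_(y <- D) h y x))%E; last first.
  by apply: eq_integral => x _; rewrite -[RHS]/((EFin \o (fun x => l (s x))) x) lsE.
rewrite integral_sum//; apply: eq_bigr => y _; rewrite /h.
under eq_integral do rewrite EFinM.
rewrite integralZl//; first by rewrite integral_indic// setIT.
apply: (@bounded_integrable _ _ _ nu _ 1) => [|x]; first exact: measurable_indic.
by rewrite indicE; case: (_ \in _); rewrite ?normr1 ?normr0.
Qed.

End simple_integral.

Section bochner_lipschitz.
Context (disp : measure_display) (T : measurableType disp) (R : realType).
Context (d : T -> T -> R).
Hypothesis dpm : pseudo_metric d.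
Hypothesis d_approx : finitely_approximable d.
Context (Y : completeNormedModType R) (dot : {dot Y for idfun}).
Hypothesis dotE : forall y : Y, dot y y = `|y| ^+ 2.
Context (f : T -> Y) (M B : R).
Hypothesis f_lip : forall x y, `|f x - f y| <= M * d x y.
Hypothesis f_bound : forall x, `|f x| <= B.

Lemma simple_approximation : exists s : nat -> T -> Y,
  (forall k, simple_map (s k)) /\ forall k x, `|f x - s k x| <= `|M| * k.+1%:R^-1.
Proof.
have d0 x y : 0 <= d x y by case: dpm.
suff H (k : nat) : exists s : T -> Y,
    simple_map s /\ forall x, `|f x - s x| <= `|M| * k.+1%:R^-1.
  by have [s sP] := choice H; exists s; split=> k; have [] := sP k.
have [|n [c [a [mc ca]]]] := d_approx (e := k.+1%:R^-1); first by rewrite invr_gt0.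
exists (fun x => f (a (c x))); split; last first.
  move=> x; apply: (le_trans (f_lip _ _)).
  apply: (@le_trans _ _ (`|M| * d x (a (c x)))); first by rewrite ler_wpM2r// ler_norm.
  by rewrite ler_wpM2l.
split=> [|y].
  apply: (@sub_finite_set _ _ [set f (a i) | i in [set: 'I_n]]).
    by move=> _ [x _ <-]; exists (c x).
  by apply: finite_image; exact: finite_finset.
rewrite (_ : _ @^-1` _ = \bigcup_(i in [set i | f (a i) = y]) (c @^-1` [set i])).
  by apply: fin_bigcup_measurable => //; exact: finite_finset.
by apply/seteqP; split => x /=; [move=> xy; exists (c x)|case=> i iy ->].
Qed.

Lemma simple_map2_measurable (s s' : T -> Y) (phi : Y -> Y -> R) :
  simple_map s -> simple_map s' -> measurable_fun setT (fun x => phi (s x) (s' x)).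
Proof.
move=> [fs ms] [fs' ms'] _ A mA; rewrite setTI.
rewrite (_ : _ @^-1` A = \bigcup_(z in (range s `*` range s') `&` [set z | A (phi z.1 z.2)])
   (s @^-1` [set z.1] `&` s' @^-1` [set z.2])).
  apply: fin_bigcup_measurable; last by move=> z _; exact: measurableI.
  by apply: finite_setIl; exact: finite_setX.
apply/seteqP; split => x /=.
  by move=> Ax; exists (s x, s' x) => //=; split => //; split; exists x.
by case=> -[y y'] /= [_ Ay] [-> ->].
Qed.

Lemma lipschitz_sub_simple_measurable (s : T -> Y) :
  simple_map s -> measurable_fun setT (fun x => `|f x - s x|).
Proof.
move=> ss; have [t [st tf]] := simple_approximation.
apply: (measurable_fun_cvg (fun k => simple_map2_measurable (fun y y' => `|y - y'|) (st k) ss)).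
move=> x _; apply: cvg_norm; apply: cvgB; last exact: cvg_cst.
apply/cvgrPdist_le => e e0.
have : `|M| * k.+1%:R^-1 @[k --> \oo] --> (0 : R).
  rewrite -[X in _ --> X](mulr0 `|M|).
  by apply: cvgM; [exact: cvg_cst|exact: cvg_harmonic].
move=> /cvgr0Pnorm_le /(_ e e0); apply: filterS => k.
rewrite ger0_norm ?mulr_ge0 ?invr_ge0//; apply: le_trans.
exact: tf.
Qed.

Lemma lipschitz_dual_measurable (l : dual Y) : measurable_fun setT (fun x => l (f x)).
Proof.
apply: (@lipschitz_measurable _ _ _ _ dpm d_approx _ (dual_norm l * M)) => x y.
by rewrite -dualB (le_trans (dual_le _ _))// -mulrA ler_wpM2l// dual_norm_ge0.
Qed.

Context (nu : probability T R).

Lemma lipschitz_dual_integrable (l : dual Y) :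
  nu.-integrable setT (EFin \o (fun x => l (f x))).
Proof.
apply: (@bounded_integrable _ _ _ nu _ (dual_norm l * B)).
  exact: lipschitz_dual_measurable.
by move=> x; rewrite (le_trans (dual_le _ _))// ler_wpM2l// dual_norm_ge0.
Qed.

Lemma is_bochner_integral_dual (z : Y) (l : dual Y) :
  is_bochner_integral nu f z -> l z = \int[nu]_x l (f x).
Proof.
move=> [s [ss sm s0 sz]].
have lz : l (simple_integral nu (s k)) @[k --> \oo] --> l z.
  by apply: (@continuous_cvg _ _ _ _ _ _ (l : Y -> R^o)) => //; exact: dual_continuous.
suff li : l (simple_integral nu (s k)) @[k --> \oo] --> \int[nu]_x l (f x).
  exact: cvg_unique lz li.
have s0' : (fine (\int[nu]_x `|f x - s k x|%:E))%E @[k --> \oo] --> 0 by exact: fine_cvg s0.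
have sfin : \forall k \near \oo, (\int[nu]_x `|f x - s k x|%:E)%E \is a fin_num.
  exact: cvg_is_fine s0.
apply/cvgrPdist_le => e e0.
have n1 : 0 < dual_norm l + 1 by rewrite ltr_wpDl ?dual_norm_ge0.
move/cvgr0Pnorm_le : s0' => /(_ (e / (dual_norm l + 1)) (divr_gt0 e0 n1)) near0.
near=> k.
have kfin : (\int[nu]_x `|f x - s k x|%:E)%E \is a fin_num by near: k.
have ik : nu.-integrable setT (EFin \o (fun x => `|f x - s k x|)).
  apply/integrableP; split; first exact/measurable_EFinP.
  under eq_integral do rewrite /= normr_id.
  by rewrite ltey_eq kfin.
have [ils ->] := simple_map_dual nu l (ss k).
rewrite -RintegralB//; last exact: lipschitz_dual_integrable.
have ild : nu.-integrable setT (EFin \o (fun x => l (f x) - l (s k x))).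
  by apply: integrable_EFinB => //; exact: lipschitz_dual_integrable.
apply: (le_trans (le_normr_Rintegral _ ild)) => //.
apply: (@le_trans _ _ (\int[nu]_x (dual_norm l * `|f x - s k x|))).
  apply: le_Rintegral => //.
  - exact: integrable_abse ild.
  - by under [X in _.-integrable _ X]eq_fun do rewrite /= EFinM; exact: integrableZl.
  - by move=> x _; rewrite -dualB dual_le.
rewrite RintegralZl//.
have : fine (\int[nu]_x `|f x - s k x|%:E) <= e / (dual_norm l + 1).
  by apply: le_trans (ler_norm _) _; near: k.
rewrite ler_pdivlMr// => h; apply: le_trans h.
rewrite mulrC ler_wpM2l// ?lerDl//.
by apply: fine_ge0; apply: integral_ge0 => x _; rewrite lee_fin.
Unshelve. all: by end_near. Qed.

(** The integrals of uniform simple approximations form a Cauchy sequence: testing their differences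
    with the inner product reduces the estimate to scalar integrals. *)
Lemma is_bochner_integral_exists : exists z, is_bochner_integral nu f z.
Proof.
have [s [ss sf]] := simple_approximation.
pose z k := simple_integral nu (s k).
have zz k m : `|z k - z m| <= `|M| * k.+1%:R^-1 + `|M| * m.+1%:R^-1.
  have P0 (j : nat) : 0 <= `|M| * j.+1%:R^-1 by rewrite mulr_ge0 ?invr_ge0.
  apply: (norm_le_of_dot dotE); first by rewrite addr_ge0.
  move=> y; have [ik kE] := simple_map_dual nu (dot_dual dotE y) (ss k).
  have [im mE] := simple_map_dual nu (dot_dual dotE y) (ss m).
  rewrite dotBl -!(dot_dualE dotE) kE mE -RintegralB//.
  have ikm : nu.-integrable setT
      (EFin \o (fun x => dot_dual dotE y (s k x) - dot_dual dotE y (s m x))).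
    exact: integrable_EFinB.
  apply: (le_trans (le_normr_Rintegral _ ikm)) => //.
  apply: (@le_trans _ _ (\int[nu]_x ((`|M| * k.+1%:R^-1 + `|M| * m.+1%:R^-1) * `|y|))).
    apply: le_Rintegral => //.
    - exact: integrable_abse ikm.
    - apply: (@bounded_integrable _ _ _ nu _ ((`|M| * k.+1%:R^-1 + `|M| * m.+1%:R^-1) * `|y|)).
        exact: measurable_cst.
      by move=> x; rewrite ger0_norm// mulr_ge0// addr_ge0.
    - move=> x _; rewrite !dot_dualE -dotBl (le_trans (normr_dot_le dotE _ _))//.
      rewrite ler_wpM2r// (_ : s k x - s m x = (f x - s m x) - (f x - s k x)).
        by rewrite (le_trans (ler_normB _ _))// addrC lerD.
      by rewrite opprB [RHS]addrC addrA subrK.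
  by rewrite Rintegral_cst// [X in _ * fine X]probability_setT mulr1.
have h0 : `|M| * k.+1%:R^-1 @[k --> \oo] --> (0 : R).
  rewrite -[X in _ --> X](mulr0 `|M|).
  by apply: cvgM; [exact: cvg_cst|exact: cvg_harmonic].
have /cvg_ex[w zw] : cvg (z @ \oo).
  apply/cauchy_cvgP; apply: cauchy_exP => e e0.
  have e2 : 0 < e / 2 by rewrite divr_gt0.
  move/cvgr0Pnorm_lt : h0 => /(_ (e / 2) e2) [N _ hN].
  exists (z N); exists N => // k /= Nk; rewrite -ball_normE /=.
  apply: (le_lt_trans (zz _ _)); have := hN _ Nk; have := hN N (leqnn N).
  move=> /(le_lt_trans (ler_norm _)) h1 /(le_lt_trans (ler_norm _)) h2.
  by rewrite (splitr e) ltrD.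
exists w, s; split => //; first by move=> k; exact: lipschitz_sub_simple_measurable.
apply: (@squeeze_cvge _ _ _ _ (fun=> 0%E) _ (fun k => (`|M| * k.+1%:R^-1)%:E)).
- near=> k; apply/andP; split; first by apply: integral_ge0 => x _; rewrite lee_fin.
  apply: (@le_trans _ _ (\int[nu]_x (`|M| * k.+1%:R^-1)%:E)%E).
    apply: ge0_le_integral => //.
    - exact/measurable_EFinP/lipschitz_sub_simple_measurable.
    - by move=> x _; rewrite lee_fin sf.
  by rewrite integral_cst// [X in (_ * X)%E]probability_setT mule1.
- exact: cvg_cst.
- by apply: cvg_EFin => //; near=> k.
Unshelve. all: by end_near. Qed.

(** Every Bochner integral of [f] passes these tests, so it does not matter which one [xget] picks;
    existence rules out the default 0. *)
Lemma bochner_integral_dual (l : dual Y) :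
  l (bochner_integral nu f) = \int[nu]_x l (f x).
Proof.
apply: is_bochner_integral_dual; rewrite /bochner_integral.
by have [z zP] := is_bochner_integral_exists; exact: xgetI zP.
Qed.

End bochner_lipschitz.

(** * Cauchy-Schwarz, integrals against couplings, and empirical measures *)

Lemma le_mul_of_weighted (R : realType) (z a b : R) : 0 <= a -> 0 <= b ->
  (forall l, 0 < l -> 2 * z <= l * a ^+ 2 + l^-1 * b ^+ 2) -> z <= a * b.
Proof.
move=> a0 b0 key; rewrite leNgt; apply/negP => abz.
have z0 : 0 < z by rewrite (le_lt_trans _ abz)// mulr_ge0.
have [a0'|an0] := eqVneq a 0.
  have [b0'|bn0] := eqVneq b 0.
    by have := key 1 ltr01; rewrite a0' b0' expr0n/= !mulr0 addr0; lra.
  have b1 : 0 < b by rewrite lt_neqAle eq_sym bn0.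
  (* If [a] or [b] is zero, the optimal weight b / a degenerates; the weight is then chosen to make
     the right-hand side equal to [z], against [2 * z] on the left. *)
  have := key (b ^+ 2 / z); rewrite a0' expr0n/= mulr0 add0r.
  rewrite divr_gt0 ?exprn_gt0// => /(_ erefl).
  rewrite invf_div mulrVK ?unitfE ?expf_neq0//.
  by lra.
have a1 : 0 < a by rewrite lt_neqAle eq_sym an0.
have [b0'|bn0] := eqVneq b 0.
  have := key (z / a ^+ 2); rewrite b0' expr0n/= mulr0 addr0.
  rewrite divr_gt0 ?exprn_gt0// => /(_ erefl).
  by rewrite divfK ?expf_neq0//; lra.
have b1 : 0 < b by rewrite lt_neqAle eq_sym bn0.
have := key (b / a); rewrite divr_gt0// => /(_ erefl).
have -> : b / a * a ^+ 2 + (b / a)^-1 * b ^+ 2 = 2 * (a * b).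
  by field; rewrite an0 bn0.
by lra.
Qed.

Section cauchy_schwarz.
Context (disp : measure_display) (T : measurableType disp) (R : realType).
Context (P : probability T R).

Lemma Rintegral_cauchy_schwarz (g h : T -> R) (A B : R) :
  measurable_fun setT g -> measurable_fun setT h ->
  (forall x, `|g x| <= A) -> (forall x, `|h x| <= B) ->
  \int[P]_x (g x * h x) <=
  Num.sqrt (\int[P]_x (g x ^+ 2)) * Num.sqrt (\int[P]_x (h x ^+ 2)).
Proof.
move=> mg mh gA hB.
have sq0 (f : T -> R) : 0 <= \int[P]_x (f x ^+ 2).
  by apply: Rintegral_ge0 => x _; exact: sqr_ge0.
have isq (f : T -> R) (M : R) : measurable_fun setT f -> (forall x, `|f x| <= M) ->
    P.-integrable setT (EFin \o (fun x => f x ^+ 2)).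
  move=> mf fM; apply: (@bounded_integrable _ _ _ P _ (M ^+ 2)); first exact: measurable_funX.
  by move=> x; rewrite normrX ler_sqr ?nnegrE// (le_trans _ (fM x)).
have igh : P.-integrable setT (EFin \o (fun x => g x * h x)).
  apply: (@bounded_integrable _ _ _ P _ (A * B)); first exact: measurable_funM.
  by move=> x; rewrite normrM ler_pM.
apply: le_mul_of_weighted; rewrite ?sqrtr_ge0// => l l0.
rewrite !sqr_sqrtr//.
have li0 : 0 < l^-1 by rewrite invr_gt0.
have ig := integrable_EFinZ l (isq g A mg gA).
have ih := integrable_EFinZ l^-1 (isq h B mh hB).
rewrite -!RintegralZl//; [|exact: isq mh hB|exact: isq mg gA].
rewrite -RintegralD//; apply: le_Rintegral => //.
- exact: integrable_EFinZ.
- exact: integrable_EFinD.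
move=> x _; rewrite -subr_ge0.
have -> : l * g x ^+ 2 + l^-1 * h x ^+ 2 - 2 * (g x * h x) = (l * g x - h x) ^+ 2 / l.
  by field; rewrite gt_eqF.
by rewrite divr_ge0 ?sqr_ge0 ?ltW.
Qed.

End cauchy_schwarz.

Lemma integral_image_probability d1 d2 (U : measurableType d1) (V : measurableType d2)
    (R : realType) (P : probability U R) (f : U -> V) (mf : measurable_fun setT f)
    (h : V -> \bar R) :
  measurable_fun setT h -> P.-integrable setT (h \o f) ->
  (\int[image_probability P mf]_y h y = \int[P]_x h (f x))%E.
Proof. by move=> mh ih; rewrite [LHS]integral_distribution. Qed.

Section coupling_integrals.
Context (disp : measure_display) (T : measurableType disp) (R : realType).
Context (mu nu : probability T R) (P : probability (T * T)%type R).
Hypothesis PC : couplings mu nu P.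

Lemma coupling_integral1 (h : T -> R) (B : R) :
  measurable_fun setT h -> (forall x, `|h x| <= B) ->
  P.-integrable setT (EFin \o (fun z => h z.1)) /\ \int[P]_z h z.1 = \int[mu]_x h x.
Proof.
move=> mh hB.
have mh1 : measurable_fun setT (fun z : T * T => h z.1).
  exact: (measurableT_comp mh measurable_fst).
have ih : P.-integrable setT (EFin \o (fun z => h z.1)).
  exact: (@bounded_integrable _ _ _ P _ B).
split=> //; rewrite /Rintegral; congr fine.
rewrite -[LHS](@integral_image_probability _ _ _ _ R P fst (@measurable_fst _ _ T T) (EFin \o h))//.
- apply: eq_measure_integral => A mA _.
  by have [E _] := PC mA; rewrite -[RHS]E; congr (P _); apply/seteqP; split=> z // [].
- exact/measurable_EFinP.
Qed.

Lemma coupling_integral2 (h : T -> R) (B : R) :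
  measurable_fun setT h -> (forall x, `|h x| <= B) ->
  P.-integrable setT (EFin \o (fun z => h z.2)) /\ \int[P]_z h z.2 = \int[nu]_x h x.
Proof.
move=> mh hB.
have mh1 : measurable_fun setT (fun z : T * T => h z.2).
  exact: (measurableT_comp mh measurable_snd).
have ih : P.-integrable setT (EFin \o (fun z => h z.2)).
  exact: (@bounded_integrable _ _ _ P _ B).
split=> //; rewrite /Rintegral; congr fine.
rewrite -[LHS](@integral_image_probability _ _ _ _ R P snd (@measurable_snd _ _ T T) (EFin \o h))//.
- apply: eq_measure_integral => A mA _.
  by have [_ E] := PC mA; rewrite -[RHS]E; congr (P _); apply/seteqP; split=> z // [].
- exact/measurable_EFinP.
Qed.

End coupling_integrals.

Section bochner_wasserstein.
Context (disp : measure_display) (T : measurableType disp) (R : realType).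
Context (d : T -> T -> R) (D : R).
Hypothesis dpm : pseudo_metric d.
Hypothesis d_bounded : forall x y, d x y <= D.
Hypothesis d_approx : finitely_approximable d.
Implicit Types mu nu : probability T R.

Let d_ge0 x y : 0 <= d x y. Proof. by case: dpm. Qed.

(** The easy half of Kantorovich duality; Cauchy-Schwarz against the constant 1 passes from the mean
    distance to the root of the quadratic cost. *)
Lemma lipschitz_integral_wasserstein (h : T -> R) (M B : R) mu nu :
  (forall x, `|h x| <= B) -> (forall x y, `|h x - h y| <= M * d x y) -> 0 <= M ->
  \int[mu]_x h x - \int[nu]_x h x <= M * wasserstein2 d mu nu.
Proof.
move=> hB hM M0.
have mh : measurable_fun setT h by exact: (lipschitz_measurable dpm d_approx hM).
have md : measurable_fun setT (fun z : T * T => d z.1 z.2).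
  exact: (measurable_dist dpm d_approx).
have bd (z : T * T) : `|d z.1 z.2| <= D by rewrite ger0_norm.
have key P : couplings mu nu P ->
    \int[mu]_x h x - \int[nu]_x h x <= M * Num.sqrt (transport_cost d P).
  move=> PC; have [i1 <-] := coupling_integral1 PC mh hB.
  have [i2 <-] := coupling_integral2 PC mh hB.
  have id : P.-integrable setT (EFin \o (fun z : T * T => d z.1 z.2)).
    exact: (@bounded_integrable _ _ _ P _ D).
  rewrite -RintegralB//; apply: (@le_trans _ _ (\int[P]_z (M * d z.1 z.2))).
    apply: le_Rintegral => //; first exact: integrable_EFinB.
    - exact: integrable_EFinZ.
    - by move=> z _; rewrite (le_trans (ler_norm _)).
  rewrite RintegralZl// ler_wpM2l//.
  have := @Rintegral_cauchy_schwarz _ _ _ P (fun=> 1) (fun z => d z.1 z.2) 1 D.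
  rewrite (_ : Num.sqrt (\int[P]_x (1 ^+ 2)) = 1); last first.
    rewrite expr1n Rintegral_cst// mul1r.
    transitivity (Num.sqrt (fine (1%E : \bar R))); last exact: sqrtr1.
    by congr (Num.sqrt (fine _)); exact: probability_setT.
  rewrite mul1r; under eq_Rintegral do rewrite mul1r.
  by apply => //= ?; rewrite normr1.
have W0 := wasserstein2_ge0 d mu nu.
have [h0|/ltW h0] := leP (\int[mu]_x h x - \int[nu]_x h x) 0.
  by rewrite (le_trans h0)// mulr_ge0.
rewrite -ler_sqr ?nnegrE ?mulr_ge0//.
apply/ler_addgt0Pr => e e0.
have M1 : 0 < M ^+ 2 + 1 by rewrite ltr_wpDl ?sqr_ge0.
have e'0 : 0 < e / (M ^+ 2 + 1) by rewrite divr_gt0.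
have [P PC Pe] := wasserstein2_coupling dpm d_bounded d_approx mu nu e'0.
apply: (@le_trans _ _ ((M * Num.sqrt (transport_cost d P)) ^+ 2)).
  by rewrite ler_sqr ?nnegrE ?mulr_ge0 ?sqrtr_ge0// key.
rewrite !exprMn sqr_sqrtr ?transport_cost_ge0//.
apply: (@le_trans _ _ (M ^+ 2 * (wasserstein2 d mu nu ^+ 2 + e / (M ^+ 2 + 1)))).
  by rewrite ler_wpM2l// sqr_ge0.
rewrite mulrDr lerD2l mulrCA ler_piMr ?(ltW e0)// ler_pdivrMr// mul1r lerDl.
exact: ler01.
Qed.

Context (Y : completeNormedModType R) (dot : {dot Y for idfun}).
Hypothesis dotE : forall y : Y, dot y y = `|y| ^+ 2.
Context (f : T -> Y) (M B : R).
Hypothesis M_ge0 : 0 <= M.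
Hypothesis f_lip : forall x y, `|f x - f y| <= M * d x y.
Hypothesis f_bound : forall x, `|f x| <= B.

(** Testing the difference of the two integrals against itself reduces the claim to a scalar
    Lipschitz function. *)
Lemma bochner_integral_lipschitz mu nu :
  `|bochner_integral mu f - bochner_integral nu f| <= M * wasserstein2 d mu nu.
Proof.
have W0 := wasserstein2_ge0 d mu nu.
set z := _ - _; have [->|z0] := eqVneq z 0; first by rewrite normr0 mulr_ge0.
have nz : 0 < `|z| by rewrite normr_gt0.
rewrite -(ler_pM2r nz) -expr2 -dotE -(dot_dualE dotE) {2}/z dualB.
rewrite !(bochner_integral_dual dpm d_approx dotE f_lip f_bound).
rewrite mulrAC; apply: (@lipschitz_integral_wasserstein _ _ (B * `|z|)) => [x|x y|].
- by rewrite dot_dualE (le_trans (normr_dot_le dotE _ _))// ler_wpM2r.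
- rewrite !dot_dualE -dotBl (le_trans (normr_dot_le dotE _ _))//.
  by rewrite mulrAC ler_wpM2r.
- exact: mulr_ge0.
Qed.

End bochner_wasserstein.

Section empirical_integral.
Context (disp : measure_display) (T : measurableType disp) (R : realType).
Context (n : nat) (n_gt0 : (0 < n)%N).

Lemma ge0_integral_empirical (x : 'I_n -> T) (h : T -> \bar R) :
  measurable_fun setT h -> (forall y, (0 <= h y)%E) ->
  (\int[empirical R x n_gt0]_y h y = (n%:R^-1)%:E * \sum_(j < n) h (x j))%E.
Proof.
move=> mh h0; rewrite [LHS]ge0_integral_mscale//; congr (_ * _)%E.
(* Indices outside ['I_n] default to the index 0; the sum up to [n] never reaches them. *)
pose m_ (k : nat) : {measure set T -> \bar R} :=
  @dirac _ T (x (insubd (Ordinal n_gt0) k)) R.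
transitivity (\int[msum m_ n]_y h y)%E.
  apply: eq_measure_integral => A mA _; rewrite /= /sum_dirac /msum.
  by apply: eq_bigr => j _; rewrite /m_ /= valKd.
rewrite ge0_integral_measure_sum//; apply: eq_bigr => j _.
by rewrite /m_ valKd integral_dirac// diracT mul1e.
Qed.

Lemma Rintegral_empirical (x : 'I_n -> T) (h : T -> R) (B : R) :
  measurable_fun setT h -> (forall y, `|h y| <= B) ->
  \int[empirical R x n_gt0]_y h y = n%:R^-1 * \sum_(j < n) h (x j).
Proof.
move=> mh hB; pose P : probability T R := empirical R x n_gt0.
rewrite -[LHS]/(\int[P]_y h y).
have n0 : n%:R != 0 :> R by rewrite pnatr_eq0 -lt0n.
have ih : P.-integrable setT (EFin \o h).
  exact: (@bounded_integrable _ _ _ P _ B).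
have ib : P.-integrable setT (EFin \o (fun=> B)).
  by apply: (@bounded_integrable _ _ _ P _ `|B|).
have PB : \int[P]_y B = B.
  rewrite Rintegral_cst//; transitivity (B * fine (1%E : \bar R)); last exact: mulr1.
  by congr (_ * fine _); exact: probability_setT.
(* Adding the bound [B] makes the integrand nonnegative, so that the previous formula applies. *)
suff : \int[P]_y (h y + B) = n%:R^-1 * \sum_(j < n) h (x j) + B.
  by rewrite RintegralD// PB => /addIr.
rewrite /Rintegral ge0_integral_empirical; last 2 first.
- exact/measurable_EFinP/measurable_funD.
- by move=> y; rewrite lee_fin -(opprK B) subr_ge0; have := hB y; rewrite ler_norml => /andP[].
rewrite sumEFin /= big_split/= sumr_const card_ord mulrDr; congr (_ + _).
by rewrite -[B *+ n]mulr_natl mulKf.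
Qed.

End empirical_integral.

Section empirical_wasserstein.
Context (disp : measure_display) (T : measurableType disp) (R : realType).
Context (d : T -> T -> R) (D : R).
Hypothesis dpm : pseudo_metric d.
Hypothesis d_bounded : forall x y, d x y <= D.
Hypothesis d_approx : finitely_approximable d.
Context (n : nat) (n_gt0 : (0 < n)%N).

(** Pairing the points index by index gives one admissible coupling. *)
Lemma wasserstein2_empirical (x y : 'I_n -> T) :
  wasserstein2 d (empirical R x n_gt0) (empirical R y n_gt0) ^+ 2 <=
  n%:R^-1 * \sum_(j < n) d (x j) (y j) ^+ 2.
Proof.
pose P : probability (T * T)%type R := empirical R (fun j => (x j, y j)) n_gt0.
have PC : couplings (empirical R x n_gt0) (empirical R y n_gt0) P.
  move=> A mA; rewrite /P /= /empirical /mscale /= /sum_dirac; split;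
    congr (_ * _)%E; apply: eq_bigr => j _; rewrite /dirac /= !indicE.
    by congr ((nat_of_bool _)%:R%:E); apply/idP/idP => /set_mem H; apply/mem_set => //; case: H.
  by congr ((nat_of_bool _)%:R%:E); apply/idP/idP => /set_mem H; apply/mem_set => //; case: H.
apply: (le_trans (wasserstein2_le_cost dpm d_bounded d_approx PC)).
rewrite /transport_cost (@Rintegral_empirical _ _ _ _ n_gt0 _ _ (D ^+ 2))//.
- exact: (measurable_funX 2 (measurable_dist dpm d_approx)).
- move=> z; rewrite ger0_norm ?sqr_ge0// ler_sqr ?nnegrE//; first by case: dpm.
  by apply: le_trans (d_bounded z.1 z.2); case: dpm.
Qed.

End empirical_wasserstein.

(** * Slopes of the lifted energy *)

Section convex_differentiable.
Context (R : realType) (Y : normedModType R) (F : Y -> R) (DF : Y -> dual Y).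
Hypothesis F_convex : convex_function [set: convex_lmodType Y] F.
Hypothesis F_diff : forall x, differentiable (F : Y -> R^o) x /\
  'd (F : Y -> R^o) x = DF x :> (Y -> R^o).

Lemma differentiable_expansion x (e : R) : 0 < e ->
  exists2 r : R, 0 < r & forall v : Y, `|v| < r -> `|F (x + v) - F x - DF x v| <= e * `|v|.
Proof.
move=> e0; have [/diff_locally /eqaddoP/(_ e e0) + dE] := F_diff x.
move=> /nbhs_ballP[r /= r0 rP]; exists r => // v vr.
have := rP v; rewrite -ball_normE/= sub0r normrN => /(_ vr).
by rewrite -dE (addrC x) opprD addrA.
Qed.

Lemma convex_gradient_le x y : F x + DF x (y - x) <= F y.
Proof.
have conv (t : R) : 0 <= t <= 1 -> F (t *: y + (1 - t) *: x) <= t * F y + (1 - t) * F x.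
  move=> /andP[t0 t1].
  pose p := Itv01 t0 t1.
  have inT (z : convex_lmodType Y) : z \in [set: convex_lmodType Y] by exact: mem_set.
  by have := F_convex p (inT y) (inT x).
apply/ler_addgt0Pr => e e0.
have v1 : 0 < `|y - x| + 1 by rewrite ltr_wpDl.
have [r r0 rP] := differentiable_expansion x (divr_gt0 e0 v1).
(* [t] is small enough for the expansion at x to apply to t(y - x), with an error of at most t e. *)
pose t := Num.min 1 (r / 2 / (`|y - x| + 1)).
have t0 : 0 < t by rewrite lt_min ltr01 !divr_gt0.
have t1 : t <= 1 by rewrite ge_min lexx.
have tv : t * (`|y - x| + 1) <= r / 2 by rewrite -ler_pdivlMr// ge_min lexx orbT.
have := rP (t *: (y - x)); rewrite normrZ gtr0_norm//.
have -> : t * `|y - x| < r by move: tv; rewrite mulrDr; lra.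
move=> /(_ isT); have -> : x + t *: (y - x) = t *: y + (1 - t) *: x.
  by rewrite scalerBr scalerBl scale1r addrCA addrA [RHS]addrC addrC addrCA addrC.
have := conv t; rewrite (ltW t0) t1 => /(_ isT).
rewrite dualZ => Ft; rewrite ler_norml => /andP[+ _].
have le1 : e / (`|y - x| + 1) * (t * `|y - x|) <= t * e.
  rewrite mulrCA ler_wpM2l ?(ltW t0)// mulrAC ler_pdivrMr//.
  by rewrite ler_wpM2l ?(ltW e0)// lerDl.
move=> Fl; have : t * (F x + DF x (y - x)) <= t * (F y + e).
  by move: Ft Fl le1; rewrite !mulrDr mulrBl mul1r; lra.
by rewrite ler_pM2l.
Qed.

Lemma convex_differentiable_le x y : `|F y - F x| <= Num.max `|DF x| `|DF y| * `|y - x|.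
Proof.
have Fxy := convex_gradient_le x y; have Fyx := convex_gradient_le y x.
have D1 := dual_le (DF x) (y - x); have D2 := dual_le (DF y) (x - y).
have M1 : `|DF x| * `|y - x| <= Num.max `|DF x| `|DF y| * `|y - x|.
  by rewrite ler_wpM2r// le_max lexx.
have M2 : `|DF y| * `|y - x| <= Num.max `|DF x| `|DF y| * `|y - x|.
  by rewrite ler_wpM2r// le_max lexx orbT.
rewrite distrC in D2; move: D1 D2.
rewrite -[dual_norm (DF x)]/(`|DF x|) -[dual_norm (DF y)]/(`|DF y|).
rewrite !ler_norml => /andP[? ?] /andP[? ?]; apply/andP; split; lra.
Qed.

(** [DF] is bounded on the compact image of the curve. By convexity an increment of [F] is
    controlled by the gradients at its two end points alone, so segments that leave the image do no
    harm. *)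
Lemma convex_differentiable_curve (q : R -> Y) :
  (forall x, {for x, continuous DF}) -> continuous q ->
  exists2 M : R, 0 <= M & forall s t, 0 <= s <= 1 -> 0 <= t <= 1 ->
    `|F (q t) - F (q s)| <= M * `|q t - q s|.
Proof.
move=> cDF cq.
have : compact ((DF \o q) @` `[0, 1]).
  apply: continuous_compact; last exact: segment_compact.
  apply: continuous_subspaceT => t; apply: continuous_comp; [exact: cq|exact: cDF].
move=> /compact_bounded[N [_ NP]].
have DM (t : R) : 0 <= t <= 1 -> `|DF (q t)| <= `|N| + 1.
  move=> t01; apply: (NP (`|N| + 1)); first by rewrite ltr_pwDr// ler_norm.
  by exists t => //=; rewrite in_itv.
exists (`|N| + 1) => [|s t s01 t01]; first by rewrite addr_ge0.
apply: (le_trans (convex_differentiable_le _ _)).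
by rewrite ler_wpM2r// ge_max !DM.
Qed.

End convex_differentiable.

(** * The penalized slope of a Lipschitz function *)

Section penalized_slope.
Context (disp : measure_display) (T : measurableType disp) (R : realType).
Context (d : T -> T -> R) (D : R) (phi : T -> R) (M C : R).
Hypothesis dpm : pseudo_metric d.
Hypothesis d_bounded : forall x y, d x y <= D.
Hypothesis d_open : forall A : set T, metric_open d A -> measurable A.
Hypothesis M_ge0 : 0 <= M.
Hypothesis C_ge0 : 0 <= C.
Hypothesis phi_lip : forall x y, `|phi x - phi y| <= M * d x y.

Let d_ge0 x y : 0 <= d x y. Proof. by case: dpm. Qed.
Let d_sym x y : d x y = d y x. Proof. by case: dpm. Qed.
Let d_tri x y z : d x z <= d x y + d y z. Proof. by case: dpm. Qed.

Let slopes x := [set 0] `|`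
  [set (phi x - phi y) / d x y - C * d x y | y in [set y | 0 < d x y]].

(* The quadratic penalty makes the slope a global supremum, which is lower
   semicontinuous in [x]. *)
Definition penalized_slope x : R := sup (slopes x).

Let slopes_ub x : ubound (slopes x) M.
Proof.
move=> _ [->//|[y /= y0 <-]]; apply: (@le_trans _ _ ((phi x - phi y) / d x y)).
  by rewrite gerBl mulr_ge0.
by rewrite ler_pdivrMr// (le_trans (ler_norm _)).
Qed.

Let slopes_sup x : has_sup (slopes x).
Proof. by split; [exists 0; left|exists M; exact: slopes_ub]. Qed.

Lemma penalized_slope_ge0 x : 0 <= penalized_slope x.
Proof. by apply: ub_le_sup; [case: (slopes_sup x)|left]. Qed.

Lemma penalized_slope_le x : penalized_slope x <= M.
Proof. by apply: ge_sup; [case: (slopes_sup x)|exact: slopes_ub]. Qed.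

Lemma penalized_slope_drop x y :
  phi x - phi y <= penalized_slope x * d x y + C * d x y ^+ 2.
Proof.
have [y0|ny0] := ltP 0 (d x y); last first.
  have d0 : d x y = 0 by apply/eqP; rewrite eq_le ny0 d_ge0.
  by rewrite (le_trans (ler_norm _))// (le_trans (phi_lip _ _))// d0 !mulr0 expr0n/= mulr0 addr0.
have : (phi x - phi y) / d x y - C * d x y <= penalized_slope x.
  by apply: ub_le_sup; [case: (slopes_sup x)|right; exists y].
by rewrite lerBlDr ler_pdivrMr// mulrDl expr2 mulrA.
Qed.

Lemma penalized_slope_gt x (a : R) : 0 <= a -> a < penalized_slope x ->
  exists2 y, 0 < d x y & a * d x y + C * d x y ^+ 2 < phi x - phi y.
Proof.
move=> a0 /(sup_gt (proj1 (slopes_sup x)))[_ [->|[y /= y0 <-]]].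
  by rewrite ltNge a0.
by rewrite ltrBrDr ltr_pdivlMr// => ay; exists y => //; rewrite expr2 mulrA -mulrDl.
Qed.

(** Superlevel sets are open: a point [y] witnessing a value above [a] at [x] remains a witness on a
    ball around [x]. *)
Lemma penalized_slope_measurable : measurable_fun setT penalized_slope.
Proof.
move=> _; apply: (measurability _ (RGenOInfty.measurableE R)) => //.
move=> /= _ [_ [a ->] <-]; rewrite preimage_itvoy setTI.
have [a0|a0] := ltP a 0.
  rewrite (_ : [set _ | _] = setT)//; apply/seteqP; split=> // x _ /=.
  exact: lt_le_trans (penalized_slope_ge0 x).
apply: d_open => x /= /(penalized_slope_gt a0)[y y0 xy].
pose g z := phi z - phi y - (a * d z y + C * d z y ^+ 2).
have gx : 0 < g x by rewrite subr_gt0.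
have D0 : 0 <= D by apply: le_trans (d_bounded x y).
(* A Lipschitz constant of [g] at [x]; the factor 2 D bounds the sum of distances when the
   difference of their squares is factored. *)
pose Q := M + a + C * (2 * D).
have Q0 : 0 <= Q by rewrite !addr_ge0// !mulr_ge0.
have gQ z : g x - g z <= Q * d x z.
  have h1 : phi x - phi z <= M * d x z by rewrite (le_trans (ler_norm _)).
  have h2 : d z y - d x y <= d x z by rewrite lerBlDr (d_sym x z).
  have h3 : d z y + d x y <= 2 * D by rewrite mulr_natl mulr2n lerD.
  have h4 : a * (d z y - d x y) <= a * d x z by rewrite ler_wpM2l.
  have h5 : C * ((d z y - d x y) * (d z y + d x y)) <= C * (d x z * (2 * D)).
    rewrite ler_wpM2l//; apply: (@le_trans _ _ (d x z * (d z y + d x y))).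
      by rewrite ler_wpM2r// addr_ge0.
    by rewrite ler_wpM2l.
  have -> : g x - g z = (phi x - phi z) + a * (d z y - d x y) +
      C * ((d z y - d x y) * (d z y + d x y)) by rewrite /g; ring.
  have -> : Q * d x z = M * d x z + a * d x z + C * (d x z * (2 * D)) by rewrite /Q; ring.
  by rewrite !lerD.
have Q1 : 0 < Q + 1 by rewrite ltr_wpDl.
exists (g x / (Q + 1)); first by rewrite divr_gt0.
move=> z; rewrite ltr_pdivlMr// => xz.
have gz : 0 < g z.
  have := gQ z; have := d_ge0 x z; move: xz; rewrite mulrDr mulr1 (mulrC _ Q); lra.
have z0 : 0 < d z y.
  rewrite lt_neqAle d_ge0 andbT; apply: contraL gz => /eqP zy.
  rewrite -leNgt /g -zy mulr0 expr0n/= mulr0 addr0 subr0.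
  by rewrite (le_trans (ler_norm _))// (le_trans (phi_lip _ _))// -zy mulr0.
apply: (@lt_le_trans _ _ ((phi z - phi y) / d z y - C * d z y)).
  rewrite ltrBrDr ltr_pdivlMr// mulrDl -mulrA -expr2.
  by move: gz; rewrite subr_gt0.
by apply: ub_le_sup; [case: (slopes_sup z)|right; exists y].
Qed.

Hypothesis d_approx : finitely_approximable d.

Lemma penalized_slope_wasserstein (B : R) (mu nu : probability T R) :
  (forall x, `|phi x| <= B) ->
  \int[mu]_x phi x - \int[nu]_x phi x <=
  Num.sqrt (\int[mu]_x (penalized_slope x ^+ 2)) * wasserstein2 d mu nu +
  C * wasserstein2 d mu nu ^+ 2.
Proof.
move=> phiB.
have mphi : measurable_fun setT phi by exact: (lipschitz_measurable dpm d_approx phi_lip).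
have md := measurable_dist dpm d_approx.
have ms := penalized_slope_measurable.
set S := Num.sqrt _; set W := wasserstein2 d mu nu.
have S0 : 0 <= S by exact: sqrtr_ge0.
have W0 : 0 <= W by exact: wasserstein2_ge0.
have bs x : `|penalized_slope x| <= M.
  by rewrite ger0_norm ?penalized_slope_ge0// penalized_slope_le.
have key P : couplings mu nu P ->
    \int[mu]_x phi x - \int[nu]_x phi x <=
    S * Num.sqrt (transport_cost d P) + C * transport_cost d P.
  move=> PC; have [i1 <-] := coupling_integral1 PC mphi phiB.
  have [i2 <-] := coupling_integral2 PC mphi phiB.
  have mss : measurable_fun setT (fun z : T * T => penalized_slope z.1).
    exact: (measurableT_comp ms measurable_fst).
  have isd : P.-integrable setT
      (EFin \o (fun z : T * T => penalized_slope z.1 * d z.1 z.2)).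
    apply: (@bounded_integrable _ _ _ P _ (M * D)); first exact: measurable_funM.
    by move=> z; rewrite normrM ler_pM// ger0_norm.
  have ic : P.-integrable setT (EFin \o (fun z : T * T => d z.1 z.2 ^+ 2)).
    exact: (integrable_cost dpm d_bounded d_approx).
  rewrite -RintegralB//.
  apply: (@le_trans _ _
    (\int[P]_z (penalized_slope z.1 * d z.1 z.2 + C * d z.1 z.2 ^+ 2))).
    apply: le_Rintegral => //; first exact: integrable_EFinB.
      by apply: integrable_EFinD => //; exact: integrable_EFinZ.
    by move=> z _; exact: penalized_slope_drop.
  rewrite RintegralD//; last exact: integrable_EFinZ.
  rewrite RintegralZl// lerD2r.
  have ss x : `|penalized_slope x ^+ 2| <= M ^+ 2.
    by rewrite normrX ler_sqr ?nnegrE.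
  have [_ sE] := coupling_integral1 PC (measurable_funX 2 ms) ss.
  rewrite /S -sE.
  apply: (@Rintegral_cauchy_schwarz _ _ _ P (fun z => penalized_slope z.1) _ M D) => // z.
  by rewrite ger0_norm.
apply/ler_addgt0Pr => e e0.
have Q0 : 0 < S + C + 1 by rewrite ltr_wpDl// addr_ge0.
(* A coupling optimal up to a^2 has root cost at most W + a; since a <= 1, the errors S a and C a^2
   together stay below [e]. *)
pose a := Num.min 1 (e / (S + C + 1)).
have a0 : 0 < a by rewrite lt_min ltr01 divr_gt0.
have a1 : a <= 1 by rewrite ge_min lexx.
have aQ : a * (S + C + 1) <= e by rewrite -ler_pdivlMr// ge_min lexx orbT.
have [P PC Pe] := wasserstein2_coupling dpm d_bounded d_approx mu nu (exprn_gt0 2 a0).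
apply: (le_trans (key P PC)).
have sP : Num.sqrt (transport_cost d P) <= W + a.
  rewrite -ler_sqr ?nnegrE ?sqrtr_ge0 ?addr_ge0 ?(ltW a0)//.
  rewrite sqr_sqrtr ?transport_cost_ge0// (le_trans Pe)// sqrrD lerD2r lerDl.
  by rewrite mulrn_wge0// mulr_ge0// ltW.
have h1 : S * Num.sqrt (transport_cost d P) <= S * (W + a) by rewrite ler_wpM2l.
have h2 : C * transport_cost d P <= C * (W ^+ 2 + a ^+ 2) by rewrite ler_wpM2l.
have h3 : C * a ^+ 2 <= C * a by rewrite ler_wpM2l// expr2 ler_piMr// ltW.
by move: h1 h2 h3 aQ; rewrite !mulrDr mulr1 (mulrC a S) (mulrC a C); lra.
Qed.

End penalized_slope.

(** The first variation of the lifted energy at a measure, when [l] is the gradient of [F] at the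
    integral of [f] against that measure. *)
Definition linear_potential (R : realType) (T : Type) (Y : normedModType R)
  (f : T -> Y) (w : T -> R) (l : dual Y) (x : T) : R := l (f x) + w x.

Section lifted_energy.
Context (disp : measure_display) (T : measurableType disp) (R : realType).
Context (d : T -> T -> R) (D : R).
Hypothesis dpm : pseudo_metric d.
Hypothesis d_bounded : forall x y, d x y <= D.
Hypothesis d_approx : finitely_approximable d.
Context (Y : completeNormedModType R) (dot : {dot Y for idfun}).
Hypothesis dotE : forall y : Y, dot y y = `|y| ^+ 2.
Context (F : Y -> R) (DF : Y -> dual Y).
Hypothesis F_convex : convex_function [set: convex_lmodType Y] F.
Hypothesis F_diff : forall x, differentiable (F : Y -> R^o) x /\
  'd (F : Y -> R^o) x = DF x :> (Y -> R^o).
Context (f : T -> Y) (Mf Bf : R) (w : T -> R) (Mw Bw : R).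
Hypothesis Mf_ge0 : 0 <= Mf.
Hypothesis f_lip : forall x y, `|f x - f y| <= Mf * d x y.
Hypothesis f_bound : forall x, `|f x| <= Bf.
Hypothesis Mw_ge0 : 0 <= Mw.
Hypothesis w_lip : forall x y, `|w x - w y| <= Mw * d x y.
Hypothesis w_bound : forall x, `|w x| <= Bw.
Implicit Types (mu nu : probability T R) (l : dual Y).

Definition lifted_energy nu : R := F (bochner_integral nu f) + \int[nu]_x w x.

Notation potential := (linear_potential f w).

Let mw : measurable_fun setT w.
Proof. exact: (lipschitz_measurable dpm d_approx w_lip). Qed.

Lemma potential_lipschitz l x y :
  `|potential l x - potential l y| <= (`|l| * Mf + Mw) * d x y.
Proof.
rewrite /linear_potential opprD addrACA -dualB mulrDl (le_trans (ler_normD _ _))//.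
rewrite lerD// (le_trans (dual_le _ _))// -mulrA ler_wpM2l//.
exact: dual_norm_ge0.
Qed.

Lemma potential_bounded l x : `|potential l x| <= `|l| * Bf + Bw.
Proof.
rewrite (le_trans (ler_normD _ _))// lerD// (le_trans (dual_le _ _))// ler_wpM2l//.
exact: dual_norm_ge0.
Qed.

Lemma Rintegral_potential l nu :
  \int[nu]_x potential l x = l (bochner_integral nu f) + \int[nu]_x w x.
Proof.
rewrite RintegralD//; last exact: (bounded_integrable nu mw w_bound).
  by rewrite (bochner_integral_dual dpm d_approx dotE f_lip f_bound).
exact: (lipschitz_dual_integrable dpm d_approx f_lip f_bound).
Qed.

Lemma lifted_energy_drop mu nu (l := DF (bochner_integral mu f)) :
  lifted_energy mu - lifted_energy nu <=
  \int[mu]_x potential l x - \int[nu]_x potential l x.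
Proof.
rewrite !Rintegral_potential /lifted_energy.
have := convex_gradient_le F_convex F_diff (bochner_integral mu f) (bochner_integral nu f).
by rewrite -/l dualB; lra.
Qed.

Lemma lifted_energy_curve (g : R -> probability T R) :
  (forall x, {for x, continuous DF}) -> AC01 (wasserstein2 d) g ->
  exists M, forall s t, 0 <= s <= 1 -> 0 <= t <= 1 ->
    `|lifted_energy (g t) - lifted_energy (g s)| <= M * wasserstein2 d (g s) (g t).
Proof.
move=> cDF gAC.
have Wpm := wasserstein2_pseudo_metric dpm d_bounded d_approx.
have Wsym mu nu : wasserstein2 d mu nu = wasserstein2 d nu mu by case: Wpm.
have [H [_ [cH _ _ gH _]]] := AC01_modulus gAC.
have {}gH (s t : R) : 0 <= s <= 1 -> 0 <= t <= 1 -> wasserstein2 d (g s) (g t) <= `|H t - H s|.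
  move=> /andP[s0 s1] /andP[t0 t1].
  have [st|ts] := leP s t; first by rewrite (le_trans (gH _ _ s0 st t1))// ler_norm.
  by rewrite Wsym distrC (le_trans (gH _ _ t0 (ltW ts) s1))// ler_norm.
pose q (t : R) := bochner_integral (g (clamp01 t)) f.
have cq : continuous q.
  move=> t; apply/cvgrPdist_le => e e0.
  have cHc : {for t, continuous (H \o clamp01 (R := R))}.
    by apply: continuous_comp; [exact: clamp01_continuous|exact: cH].
  have M1 : 0 < Mf + 1 by rewrite ltr_wpDl.
  move/cvgrPdist_le : cHc => /(_ _ (divr_gt0 e0 M1)); apply: filterS => s /= Hs.
  apply: (le_trans (bochner_integral_lipschitz dpm d_bounded d_approx dotE Mf_ge0
    f_lip f_bound _ _)).
  apply: (@le_trans _ _ (Mf * (e / (Mf + 1)))).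
    by rewrite ler_wpM2l// (le_trans (gH _ _ _ _)) ?clamp01_bounds// distrC.
  by rewrite mulrCA ler_piMr ?(ltW e0)// ler_pdivrMr// mul1r lerDl.
have [M M0 FM] := convex_differentiable_curve F_convex F_diff cDF cq.
exists (M * Mf + Mw) => s t s01 t01.
have -> : lifted_energy (g t) - lifted_energy (g s) =
    (F (q t) - F (q s)) + (\int[g t]_x w x - \int[g s]_x w x).
  by rewrite /q !clamp01_id// /lifted_energy; ring.
rewrite mulrDl (le_trans (ler_normD _ _))// lerD//.
  apply: (le_trans (FM s t s01 t01)); rewrite -mulrA ler_wpM2l// /q !clamp01_id// Wsym.
  exact: (bochner_integral_lipschitz dpm d_bounded d_approx dotE Mf_ge0 f_lip f_bound).
have wW := lipschitz_integral_wasserstein dpm d_bounded d_approx _ _ w_bound w_lip Mw_ge0.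
by rewrite ler_norml lerNl opprB {1}(wW (g s) (g t)) Wsym wW.
Qed.

Lemma lifted_energy_strong_upper_gradient : (forall x, {for x, continuous DF}) ->
  strong_upper_gradient (wasserstein2 d) (EFin \o lifted_energy)
    (local_slope (wasserstein2 d) (EFin \o lifted_energy)).
Proof.
move=> cDF; apply: local_slope_strong_upper_gradient.
  exact: wasserstein2_pseudo_metric dpm d_bounded d_approx.
by move=> g; exact: lifted_energy_curve.
Qed.

Context (C : dual Y -> R).
Hypothesis C_ge0 : forall l, 0 <= C l.
Hypothesis d_open : forall A : set T, metric_open d A -> measurable A.

Definition potential_slope l : T -> R := penalized_slope d (potential l) (C l).

Lemma local_slope_lifted_energy_le mu (l := DF (bochner_integral mu f)) :
  (local_slope (wasserstein2 d) (EFin \o lifted_energy) mu <=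
   (Num.sqrt (\int[mu]_x (potential_slope l x ^+ 2)))%:E)%E.
Proof.
set S := Num.sqrt _.
have S0 : 0 <= S by exact: sqrtr_ge0.
have M0 : 0 <= `|l| * Mf + Mw by rewrite addr_ge0// mulr_ge0.
rewrite /local_slope ge_max lee_fin S0/=; apply/lee_addgt0Pr => e e0.
have C1 : 0 < C l + 1 by rewrite ltr_wpDl.
(* Within this radius the quadratic term costs at most [e] times the distance. *)
apply: (@le_trans _ _ (ereal_sup [set (maxe 0 ((EFin \o lifted_energy) mu -
    (EFin \o lifted_energy) nu) * ((wasserstein2 d mu nu)^-1)%:E)%E
  | nu in [set nu | 0 < wasserstein2 d mu nu < e / (C l + 1)]])).
  by apply: ereal_inf_lbound; exists (e / (C l + 1)) => //=; rewrite divr_gt0.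
apply: ge_ereal_sup => _ [nu /= /andP[W0 We] <-].
rewrite -EFinB -EFin_max -EFinM -EFinD lee_fin ler_pdivrMr// ge_max.
rewrite mulr_ge0 ?addr_ge0 ?(ltW e0) ?(ltW W0)//=.
apply: (le_trans (lifted_energy_drop mu nu)).
apply: (le_trans (penalized_slope_wasserstein dpm d_bounded d_open M0 (C_ge0 l)
  (potential_lipschitz l) d_approx mu nu (potential_bounded l))).
rewrite -/S mulrDl lerD2l expr2 mulrA ler_wpM2r ?(ltW W0)//.
move: We; rewrite ltr_pdivlMr// => We.
by have := ltW W0; nra.
Qed.

Hypothesis potential_geodesic : forall l x y (t : R), 0 <= t <= 1 -> exists z,
  d x z = t * d x y /\
  potential l z <= (1 - t) * potential l x + t * potential l y + C l * t * d x y ^+ 2.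

(** A possibly distant [y] nearly attaining the penalized slope is replaced by a point of the
    geodesic towards it: the penalty in the choice of [y] exactly absorbs the quadratic error there.
    The distance is [h] times the slope, so that points moved for the same [h] travel at speeds
    proportional to their slopes. *)
Lemma potential_slope_descent l x (eta : R) : 0 < eta ->
  exists2 h0 : R, 0 < h0 & forall h, 0 <= h <= h0 -> exists z,
    d x z = h * potential_slope l x /\
    h * potential_slope l x * (potential_slope l x - eta) <= potential l x - potential l z.
Proof.
move=> eta0; set s := potential_slope l x.
have M0 : 0 <= `|l| * Mf + Mw by rewrite addr_ge0// mulr_ge0.
have s0 : 0 <= s by exact: (penalized_slope_ge0 dpm M0 (C_ge0 l) (potential_lipschitz l)).
have [s_eq0|s_neq0] := eqVneq s 0.
  exists 1 => // h _; exists x; rewrite s_eq0 !mulr0 mul0r subrr; split=> //.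
  by case: dpm.
have s1 : 0 < s by rewrite lt_neqAle eq_sym s_neq0.
pose a := Num.max 0 (s - eta).
have a0 : 0 <= a by rewrite le_max lexx.
have sa : a < s by rewrite gt_max s1/= ltrBlDr ltrDl.
have [y y0 ay] := penalized_slope_gt dpm M0 (C_ge0 l) (potential_lipschitz l) a0 sa.
exists (d x y / s); first by rewrite divr_gt0.
move=> h /andP[h0 hd].
have hs : h * s <= d x y by rewrite -ler_pdivlMr.
have t01 : 0 <= h * s / d x y <= 1.
  by rewrite divr_ge0 ?mulr_ge0 ?(ltW y0)//= ler_pdivrMr// mul1r.
have [z [dz pz]] := potential_geodesic l x y t01.
exists z; split; first by rewrite dz divfK// gt_eqF.
move: pz t01; set t := h * s / d x y => pz /andP[t0 _].
have td : t * d x y = h * s by rewrite divfK// gt_eqF.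
have sea : s - eta <= a by rewrite le_max lexx orbT.
have h1 : h * s * (s - eta) <= t * (a * d x y).
  by rewrite mulrCA td mulrC ler_wpM2r// mulr_ge0.
have h2 : t * (a * d x y + C l * d x y ^+ 2) <= t * (potential l x - potential l y).
  by rewrite ler_wpM2l// ltW.
move: pz h1 h2.
move: (potential l x) (potential l y) (potential l z) (h * s * (s - eta)) => px py pz k.
rewrite -[C l * t * _]mulrA (mulrCA (C l)) mulrBl mul1r mulrDr [t * (px - py)]mulrBr.
lra.
Qed.

Context (n : nat) (n_gt0 : (0 < n)%N).
Notation emp x := (empirical R x n_gt0 : probability T R).

Lemma bochner_integral_empirical (x : 'I_n -> T) :
  bochner_integral (emp x) f = n%:R^-1 *: \sum_(j < n) f (x j).
Proof.
set z := n%:R^-1 *: _; apply/eqP; rewrite -subr_eq0 -normr_eq0 -sqrf_eq0 -dotE.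
rewrite -[X in X == _](dot_dualE dotE) {1}/z dualB subr_eq0.
rewrite (bochner_integral_dual dpm d_approx dotE f_lip f_bound).
rewrite (@Rintegral_empirical _ _ _ _ n_gt0 _ _
  (`|dot_dual dotE (bochner_integral (emp x) f - z)| * Bf)).
- by rewrite dualZ dual_sum.
- exact: (lipschitz_dual_measurable dpm d_approx f_lip).
- by move=> y; rewrite (le_trans (dual_le _ _))// ler_wpM2l// dual_norm_ge0.
Qed.

Lemma lifted_energy_empirical (x : 'I_n -> T) :
  lifted_energy (emp x) =
  F (n%:R^-1 *: \sum_(j < n) f (x j)) + n%:R^-1 * \sum_(j < n) w (x j).
Proof.
by rewrite /lifted_energy bochner_integral_empirical (Rintegral_empirical n_gt0 x mw w_bound).
Qed.

(** [X] stands for the n-fold product: [e] reads off the points, and [e'] builds an element from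
    arbitrary ones, which is what allows them to move independently. *)
Context (X : Type) (dX : X -> X -> R) (e : X -> 'I_n -> T) (e' : ('I_n -> T) -> X).
Hypothesis dX_ge0 : forall x y, 0 <= dX x y.
Hypothesis dX_sqr : forall x y, dX x y ^+ 2 = n%:R^-1 * \sum_(j < n) d (e x j) (e y j) ^+ 2.
Hypothesis e'K : forall z, e (e' z) = z.

(** Moving each point by [h] times its own slope is the equality case of Cauchy-Schwarz: the
    displacement is h S and the drop h S^2 up to small errors, so the ratio tends to S. *)
Lemma local_slope_empirical_ge x (l := DF (bochner_integral (emp (e x)) f)) :
  ((Num.sqrt (n%:R^-1 * \sum_(j < n) potential_slope l (e x j) ^+ 2))%:E <=
   local_slope dX (EFin \o (fun x => lifted_energy (emp (e x)))) x)%E.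
Proof.
set S := Num.sqrt _.
have n0 : 0 < n%:R^-1 :> R by rewrite invr_gt0 ltr0n.
have S2 : S ^+ 2 = n%:R^-1 * \sum_(j < n) potential_slope l (e x j) ^+ 2.
  by rewrite sqr_sqrtr// mulr_ge0 ?(ltW n0)// sumr_ge0// => j _; exact: sqr_ge0.
have S_ge0 : 0 <= S by exact: sqrtr_ge0.
rewrite /local_slope le_max; have [S_eq0|S_neq0] := eqVneq S 0.
  by rewrite S_eq0 lexx.
have S0 : 0 < S by rewrite lt_neqAle eq_sym S_neq0.
apply/orP; right; apply: le_ereal_inf_tmp => _ [r /= r0 <-].
apply/lee_addgt0Pr => eps eps0.
have M0 : 0 <= `|l| * Mf + Mw by rewrite addr_ge0// mulr_ge0.
have s_ge0 j : 0 <= potential_slope l (e x j).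
  exact: (penalized_slope_ge0 dpm M0 (C_ge0 l) (potential_lipschitz l)).
pose S1 := n%:R^-1 * \sum_(j < n) potential_slope l (e x j).
have S1_ge0 : 0 <= S1 by rewrite mulr_ge0 ?(ltW n0)// sumr_ge0.
have S11 : 0 < S1 + 1 by rewrite ltr_wpDl.
have Mf1 : 0 < Mf + 1 by rewrite ltr_wpDl.
(* [eta] and [a] make the loss in the descent of the potentials and the linearization error of [F]
   each cost at most half of eps h S. *)
pose eta := eps / 2 * S / (S1 + 1).
have eta0 : 0 < eta by rewrite !(divr_gt0, mulr_gt0).
pose a := eps / 2 / (Mf + 1).
have a0 : 0 < a by rewrite !divr_gt0.
have /choice[h0_ h0P] j : exists h0 : R, 0 < h0 /\ forall h, 0 <= h <= h0 -> exists z,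
    d (e x j) z = h * potential_slope l (e x j) /\
    h * potential_slope l (e x j) * (potential_slope l (e x j) - eta) <=
    potential l (e x j) - potential l z.
  by have [h0 ? ?] := potential_slope_descent l (e x j) eta0; exists h0.
(* Convexity bounds the energy drop only from above; the lower bound needed here comes from
   differentiability at the mean. The step [h] below respects the limit of every point, keeps h S
   under [r], and keeps the increment of the mean under [rho]. *)
have [rho rho0 rhoP] := differentiable_expansion F_diff (bochner_integral (emp (e x)) f) a0.
pose h := Num.min (\big[Num.min/1]_(j < n) h0_ j)
  (Num.min (r / 2 / S) (rho / 2 / ((Mf + 1) * S))).
have MS0 : 0 < (Mf + 1) * S by exact: mulr_gt0.
have h_gt0 : 0 < h.
  rewrite !lt_min !divr_gt0//= !andbT; elim/big_ind : _ => //.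
  - by move=> u v u0 v0; rewrite lt_min u0.
  - by move=> j _; case: (h0P j).
have hr : h * S <= r / 2 by rewrite -ler_pdivlMr// !ge_min lexx orbT.
have hrho : h * ((Mf + 1) * S) <= rho / 2 by rewrite -ler_pdivlMr// !ge_min lexx !orbT.
have hj j : 0 <= h <= h0_ j.
  rewrite (ltW h_gt0)/= ge_min; apply/orP; left.
  by rewrite (bigD1 j)//= ge_min lexx.
have /choice[z zP] j : exists z, d (e x j) z = h * potential_slope l (e x j) /\
    h * potential_slope l (e x j) * (potential_slope l (e x j) - eta) <=
    potential l (e x j) - potential l z by case: (h0P j) => _; apply.
have sum_s2 : n%:R^-1 * \sum_(j < n) d (e x j) (z j) ^+ 2 = (h * S) ^+ 2.
  rewrite exprMn S2 mulrCA; congr (_ * _); rewrite mulr_sumr; apply: eq_bigr => j _.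
  by have [-> _] := zP j; rewrite exprMn.
have hS0 : 0 <= h * S by rewrite mulr_ge0// ltW.
have dxz : dX x (e' z) = h * S.
  by apply/eqP; rewrite -(eqrXn2 (n := 2))// dX_sqr e'K sum_s2.
have Wxz : wasserstein2 d (emp (e x)) (emp z) <= h * S.
  rewrite -ler_sqr ?nnegrE ?wasserstein2_ge0//.
  by rewrite (le_trans (wasserstein2_empirical dpm d_bounded d_approx n_gt0 (e x) z)) ?sum_s2.
pose p := bochner_integral (emp (e x)) f; rewrite -/p -/l in rhoP.
pose v := bochner_integral (emp z) f - p.
have v_le : `|v| <= Mf * (h * S).
  rewrite distrC (le_trans (bochner_integral_lipschitz dpm d_bounded d_approx dotE
    Mf_ge0 f_lip f_bound _ _))//.
  by rewrite ler_wpM2l.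
have drop : n%:R^-1 * (\sum_(j < n) potential l (e x j) -
      \sum_(j < n) potential l (z j)) - a * `|v| <=
    lifted_energy (emp (e x)) - lifted_energy (emp z).
  have := rhoP v; have -> : `|v| < rho.
    apply: (le_lt_trans v_le); apply: (@le_lt_trans _ _ (rho / 2)); last by have := rho0; lra.
    by apply: le_trans hrho; rewrite mulrCA ler_wpM2l ?(ltW h_gt0)// ler_wpM2r// lerDl.
  move=> /(_ isT); rewrite ler_norml => /andP[_].
  have -> : p + v = bochner_integral (emp z) f by rewrite addrC subrK.
  have iP y : n%:R^-1 * \sum_(j < n) potential l (y j) =
      l (bochner_integral (emp y) f) + \int[emp y]_x w x.
    rewrite -Rintegral_potential (Rintegral_empirical n_gt0 _ _ (potential_bounded l))//.
    exact: (lipschitz_measurable dpm d_approx (potential_lipschitz l)).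
  rewrite mulrBr !iP /lifted_energy -/p -/l /v dualB.
  lra.
have lower : h * S * (S - eps) <= lifted_energy (emp (e x)) - lifted_energy (emp z).
  apply: le_trans drop.
  have sums : n%:R^-1 * \sum_(j < n) (h * potential_slope l (e x j) *
      (potential_slope l (e x j) - eta)) <= n%:R^-1 *
      (\sum_(j < n) potential l (e x j) - \sum_(j < n) potential l (z j)).
    rewrite ler_wpM2l ?(ltW n0)// -sumrB; apply: ler_sum => j _.
    by have [_] := zP j.
  have sE : n%:R^-1 * \sum_(j < n) (h * potential_slope l (e x j) *
      (potential_slope l (e x j) - eta)) = h * S ^+ 2 - h * eta * S1.
    rewrite S2 /S1 !mulr_sumr -sumrB; apply: eq_bigr => j _; ring.
  have eS : eta * S1 <= eps / 2 * S.
    rewrite /eta mulrAC ler_pdivrMr// ler_wpM2l//; last by rewrite lerDl.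
    by rewrite mulr_ge0 ?divr_ge0// ltW.
  have av : a * `|v| <= eps / 2 * (h * S).
    apply: (@le_trans _ _ (a * (Mf * (h * S)))); first by rewrite ler_wpM2l// ltW.
    have aMf : a * Mf <= eps / 2.
      rewrite /a [leLHS]mulrAC ler_pdivrMr// ler_wpM2l ?lerDl//.
      by rewrite divr_ge0// ltW.
    by rewrite mulrA ler_wpM2r.
  have heS : h * (eta * S1) <= h * (eps / 2 * S) by rewrite ler_wpM2l// ltW.
  move: sums; rewrite sE => sums; move: heS av sums; rewrite mulrBr; nra.
have hS : 0 < h * S by exact: mulr_gt0.
apply: (@le_trans _ _ ((Num.max 0 (lifted_energy (emp (e x)) - lifted_energy (emp z))
   / (h * S))%:E + eps%:E)%E).
  rewrite -EFinD lee_fin -lerBlDr ler_pdivlMr// mulrC (le_trans lower)//.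
  by rewrite le_max lexx orbT.
apply: leeD2r; apply: ereal_sup_ubound; exists (e' z) => /=.
  by rewrite dxz hS/=; move: hr; have := r0; lra.
by rewrite dxz e'K [RHS]EFinM EFin_max.
Qed.

Lemma local_slope_empirical_le x :
  (local_slope (wasserstein2 d) (EFin \o lifted_energy) (emp (e x)) <=
   local_slope dX (EFin \o (fun x => lifted_energy (emp (e x)))) x)%E.
Proof.
apply: (le_trans (local_slope_lifted_energy_le _)).
apply: le_trans (local_slope_empirical_ge x).
set l := DF _; rewrite lee_fin.
have M0 : 0 <= `|l| * Mf + Mw by rewrite addr_ge0// mulr_ge0.
have ms : measurable_fun setT (potential_slope l).
  exact: (penalized_slope_measurable dpm d_bounded d_open M0 (C_ge0 l) (potential_lipschitz l)).
rewrite (@Rintegral_empirical _ _ _ _ n_gt0 _ _ ((`|l| * Mf + Mw) ^+ 2))//.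
  exact: (measurable_funX 2 ms).
move=> y; rewrite normrX ler_sqr ?nnegrE// ger0_norm.
  exact: (penalized_slope_le dpm M0 (C_ge0 l) (potential_lipschitz l)).
exact: (penalized_slope_ge0 dpm M0 (C_ge0 l) (potential_lipschitz l)).
Qed.

End lifted_energy.

(** * The objective on atoms *)

(** The same [phi] serves for the image curve: both squares in its differential inequality can only
    shrink. *)
Lemma max_slope_curve_image (R : realType) (X X' : Type) (d : X -> X -> R)
    (d' : X' -> X' -> R) (F G : X -> \bar R) (F' G' : X' -> \bar R) (h : X -> X')
    (g : R -> X) :
  pseudo_metric d -> pseudo_metric d' ->
  (forall x y, d' (h x) (h y) <= d x y) -> (forall x, F' (h x) = F x) ->
  (forall x, (G' (h x) <= G x)%E) -> strong_upper_gradient d' F' G' ->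
  max_slope_curve d F G g -> max_slope_curve d' F' G' (h \o g).
Proof.
move=> dpm d'pm hd hF hG sug [_ gAC [phi [phi_dec Fphi dphi]]].
have hAC : AC01 d' (h \o g).
  case: (gAC) => m im gm; exists m => // s t s0 st t1.
  by apply: (le_trans _ (gm s t s0 st t1)); rewrite lee_fin; exact: hd.
split=> //; exists phi; split=> //.
  by apply: ae_lebesgueS Fphi => t Ft t01; rewrite /= hF Ft.
have G'0 := proj1 sug.
(* Comparing the two metric derivatives requires that both limits exist, which holds a.e. for
   absolutely continuous curves. *)
have := ae_lebesgueI (ae_lebesgueI dphi (metric_derivative_ae dpm gAC))
  (metric_derivative_ae d'pm hAC).
apply: ae_lebesgueS => t [[dt ct] ct'] t01; have [? le_t] := dt t01; split=> //.
apply: (le_trans le_t); apply: leeB; rewrite ?leeN2.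
  rewrite lee_fin ler_wpM2l ?invr_ge0// ler_sqr ?nnegrE.
  - apply: (ler_lim (cvgP _ (ct' t01)) (cvgP _ (ct t01))).
    by near=> r; apply: ler_wpM2r; [rewrite invr_ge0|exact: hd].
  - exact: metric_derivative_ge0.
  - exact: metric_derivative_ge0.
apply: lee_wpmul2l; first by rewrite lee_fin invr_ge0.
by rewrite !expe2; apply: lee_pmul; rewrite ?G'0 ?hG.
Unshelve. all: by end_near. Qed.

Lemma totally_bounded_dist_bounded (R : realType) (X : Type) (d : X -> X -> R) :
  pseudo_metric d -> totally_bounded_dist d -> exists D, forall x y, d x y <= D.
Proof.
move=> [d0 _ dS dT] tb; have [I [p pP]] := tb 1 ltr01.
exists (2 + \sum_(i : I) \sum_(j : I) d (p i) (p j)) => x y.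
have [i xi] := pP x; have [j yj] := pP y.
have ij : d (p i) (p j) <= \sum_(i : I) \sum_(j : I) d (p i) (p j).
  rewrite (bigD1 i)//= (bigD1 j)//= -addrA lerDl.
  by rewrite addr_ge0 ?sumr_ge0// => k _; rewrite sumr_ge0.
have h1 := dT x (p i) y; have h2 := dT (p i) (p j) y.
by move: xi yj ij h1 h2; rewrite (dS y); lra.
Qed.

Section regularizer_on_atoms.
Context (R : realType) (V : lmodType R) (Reg : V -> \bar R).
Hypothesis Reg_ge0 : forall u, (0 <= Reg u)%E.
Hypothesis Reg_homogeneous :
  forall (a : R) u, 0 <= a -> Reg (a *: u) = (a%:E * Reg u)%E.

(* If r = Reg u < 1 then u is the midpoint of (2 - r) u and r u, both in the
   unit ball of Reg. *)
Lemma extreme_point_eq1 u :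
  extreme_points [set u | (Reg u <= 1)%E] u -> u <> 0 -> Reg u = 1%E.
Proof.
move=> [/= u1 ext] u0; have := Reg_ge0 u; case E : (Reg u) u1 => [r||]//.
rewrite !lee_fin => r1 r0; congr EFin; apply/eqP; rewrite eq_le r1/= leNgt.
apply/negP => r_lt1; apply: u0.
have r2 : 0 <= 2 - r by lra.
have [||||| _ ru] := ext ((2 - r) *: u) (r *: u) 2^-1.
- by rewrite /= Reg_homogeneous// E -EFinM lee_fin; nra.
- by rewrite /= Reg_homogeneous// E -EFinM lee_fin; nra.
- by rewrite invr_gt0.
- by lra.
- rewrite !scalerA -scalerDl -[LHS]scale1r; congr (_ *: _); lra.
have : (1 - r) *: u = 0 by rewrite scalerBl scale1r ru subrr.
by move=> /eqP; rewrite scaler_eq0 subr_eq0 gt_eqF//= => /eqP.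
Qed.

End regularizer_on_atoms.

Section omega_objective.
Context (R : realType) (C : normedModType R).
Context (Y : completeNormedModType R) (dot : {dot Y for idfun}).
Hypothesis dotE : forall y : Y, dot y y = `|y| ^+ 2.
Context (K : {linear dual C -> Y}) (atoms : set (dual C)) (dB : atoms -> atoms -> R).
Hypothesis dB_metric : is_metric dB.
Hypothesis dB_totally_bounded : totally_bounded_dist dB.
Hypothesis dB_geodesic : geodesically_complete dB.
Context (A : R).
Hypothesis A_gt0 : 0 < A.
Hypothesis K_geodesic : forall g : R -> atoms, geodesic dB g ->
  exists v1 v2 : R -> Y,
  [/\ weak_derivative_on01 dot (fun t => K (val (g t))) v1,
      weak_derivative_on01 dot v1 v2,
      (forall t : R, 0 <= t <= 1 -> `|v1 t| <= A * dB (g 0) (g 1)) &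
      (forall t : R, 0 <= t <= 1 -> `|v2 t| <= A * dB (g 0) (g 1) ^+ 2)].
Context (L : R) (x0 : Omega atoms L).

Let dB_ge0 u v : 0 <= dB u v. Proof. by case: dB_metric. Qed.
Let dpm := dist_Omega_pseudo_metric dB_metric L.
Let d_ge0 (x y : Omega atoms L) : 0 <= dist_Omega dB x y. Proof. by case: dpm. Qed.

Lemma K_atoms_lipschitz (u v : atoms) : `|K (val u) - K (val v)| <= A * dB u v.
Proof.
have [g [gg g0 g1]] := dB_geodesic u v.
have [v1 [_ [d1 _ b1 _]]] := K_geodesic gg.
by have := weak_derivative_lipschitz dotE d1 b1; rewrite g0 g1 distrC.
Qed.

Lemma K_atoms_bounded : exists B, forall u : atoms, `|K (val u)| <= B.
Proof.
have dBpm : pseudo_metric dB.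
  by case: dB_metric => ? dB0 ? ?; split=> // u; apply/dB0.
have [D DP] := totally_bounded_dist_bounded dBpm dB_totally_bounded.
exists (`|K (val x0.2)| + A * D) => u.
rewrite -[K (val u)](subrK (K (val x0.2))) addrC (le_trans (ler_normD _ _))//.
by rewrite lerD2l (le_trans (K_atoms_lipschitz _ _))// ler_wpM2l// ltW.
Qed.

Lemma mass_bounds (c : `[0, L]%classic) : 0 <= val c <= L.
Proof. by have := set_mem (valP c); rewrite /= in_itv. Qed.

Lemma sqr_mass_lipschitz (x y : Omega atoms L) :
  `|val x.1 ^+ 2 - val y.1 ^+ 2| <= 2 * L * dist_Omega dB x y.
Proof.
have /andP[x1 xL] := mass_bounds x.1; have /andP[y1 yL] := mass_bounds y.1.
rewrite subr_sqr normrM mulrC ler_pM//; last exact: dist_Omega_ge1.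
by rewrite ger0_norm ?addr_ge0// mulr_natl mulr2n lerD.
Qed.

Lemma sqr_mass_bounded (x : Omega atoms L) : `|val x.1 ^+ 2| <= L ^+ 2.
Proof.
have /andP[x1 xL] := mass_bounds x.1.
by rewrite normrX ger0_norm// ler_sqr ?nnegrE// (le_trans x1).
Qed.

Definition weighted_K (x : Omega atoms L) : Y := val x.1 ^+ 2 *: K (val x.2).

Lemma weighted_K_lipschitz (B : R) (x y : Omega atoms L) :
  (forall u : atoms, `|K (val u)| <= B) ->
  `|weighted_K x - weighted_K y| <= (2 * L * B + L ^+ 2 * A) * dist_Omega dB x y.
Proof.
move=> KB; have -> : weighted_K x - weighted_K y =
    (val x.1 ^+ 2 - val y.1 ^+ 2) *: K (val x.2) + val y.1 ^+ 2 *: (K (val x.2) - K (val y.2)).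
  by rewrite scalerBl scalerBr addrA subrK.
rewrite (le_trans (ler_normD _ _))// !normrZ mulrDl lerD//.
  by rewrite mulrAC ler_pM// sqr_mass_lipschitz.
rewrite -normrM -[L ^+ 2 * A * _]mulrA ler_pM ?sqr_mass_bounded//.
rewrite (le_trans (K_atoms_lipschitz _ _))//.
by rewrite ler_wpM2l ?(ltW A_gt0)// (dist_Omega_ge2 dB_metric).
Qed.

Lemma weighted_K_bounded (B : R) (x : Omega atoms L) :
  (forall u : atoms, `|K (val u)| <= B) -> `|weighted_K x| <= L ^+ 2 * B.
Proof. by move=> KB; rewrite normrZ ler_pM// sqr_mass_bounded. Qed.

Let sqr_mass (x : Omega atoms L) : R := val x.1 ^+ 2.

(* With P_t = (1-t) P_0 + t P_1 and Q_t = (1-t) Q_0 + t Q_1,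
   P_t Q_t = (1-t) P_0 Q_0 + t P_1 Q_1 - t (1-t) (P_1 - P_0) (Q_1 - Q_0);
   here P is the squared mass and Q the value of l (K u) + 1, up to errors
   that are quadratic in the distance. *)
Lemma potential_along_geodesic (B : R) (l : dual Y) (x y : Omega atoms L) (t : R) :
  (forall u : atoms, `|K (val u)| <= B) -> 0 <= t <= 1 ->
  exists z : Omega atoms L, dist_Omega dB x z = t * dist_Omega dB x y /\
    linear_potential weighted_K sqr_mass l z <=
    (1 - t) * linear_potential weighted_K sqr_mass l x +
    t * linear_potential weighted_K sqr_mass l y +
    (2 * L * (`|l| * A) + (`|l| * B + 1) + L ^+ 2 * (`|l| * A)) * t * dist_Omega dB x y ^+ 2.
Proof.
move=> KB t01; have /andP[t0 t1] := t01.
have t1' : 0 <= 1 - t by rewrite subr_ge0.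
have /andP[xc xL] := mass_bounds x.1; have /andP[yc yL] := mass_bounds y.1.
have [g [gg g0 g1]] := dB_geodesic x.2 y.2.
have [v1 [v2 [d1 d2 _ b2]]] := K_geodesic gg.
have cP : (1 - t) * val x.1 + t * val y.1 \in `[0, L]%classic.
  apply/mem_set; rewrite /= in_itv/= addr_ge0 ?mulr_ge0//=.
  rewrite [leRHS](_ : L = (1 - t) * L + t * L); last by ring.
  by rewrite lerD ?ler_wpM2l.
pose z : Omega atoms L := (SigSub cP, g t).
exists z; split.
  apply/eqP; rewrite -(eqrXn2 (n := 2)) ?mulr_ge0// exprMn !dist_Omega_sqr/=.
  rewrite -{1}g0 gg ?lexx ?ler01// g0 g1 sub0r normrN (ger0_norm t0).
  rewrite -normrX -[in X in _ == X]normrX !ger0_norm ?sqr_ge0//.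
  by apply/eqP; ring.
set d := dist_Omega dB x y.
have d0 : 0 <= d by exact: d_ge0.
set Dl := val y.1 - val x.1.
have Dd : `|Dl| <= d by rewrite distrC dist_Omega_ge1.
have Bd : dB x.2 y.2 <= d by exact: (dist_Omega_ge2 dB_metric).
pose a (u : atoms) := l (K (val u)) + 1.
have potE (p : Omega atoms L) : linear_potential weighted_K sqr_mass l p = val p.1 ^+ 2 * a p.2.
  by rewrite /linear_potential /weighted_K dualZ /a mulrDr mulr1.
rewrite !potE -[val z.1]/((1 - t) * val x.1 + t * val y.1) -[z.2]/(g t).
have l0 : 0 <= `|l| by exact: dual_norm_ge0.
have Ba u : `|a u| <= `|l| * B + 1.
  rewrite (le_trans (ler_normD _ _))// normr1 lerD2r (le_trans (dual_le _ _))//.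
  by rewrite ler_wpM2l.
set Q := (1 - t) * a x.2 + t * a y.2.
have QB : `|Q| <= `|l| * B + 1.
  rewrite (le_trans (ler_normD _ _))// !normrM (ger0_norm t0) (ger0_norm t1').
  rewrite [leRHS](_ : _ = (1 - t) * (`|l| * B + 1) + t * (`|l| * B + 1)); last by ring.
  by rewrite lerD ?ler_wpM2l.
have errE : `|a (g t) - Q| <= `|l| * A * (t * d ^+ 2).
  have -> : a (g t) - Q = l (K (val (g t)) - ((1 - t) *: K (val (g 0)) + t *: K (val (g 1)))).
    by rewrite dualB dualD !dualZ /Q /a g0 g1; ring.
  rewrite (le_trans (dual_le _ _))// -mulrA ler_wpM2l//.
  apply: (le_trans (weak_derivative_interpolation dotE d1 d2 b2 t01)).
  rewrite g0 g1 mulrCA ler_wpM2l ?(ltW A_gt0)// ler_wpM2l//.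
  by rewrite ler_sqr ?nnegrE.
set c := (1 - t) * val x.1 + t * val y.1 in cP z |- *.
have c2 : c ^+ 2 = (1 - t) * val x.1 ^+ 2 + t * val y.1 ^+ 2 - t * (1 - t) * Dl ^+ 2.
  by rewrite /c /Dl; ring.
have cL : 0 <= c ^+ 2 <= L ^+ 2.
  have /andP[c0 cL] : 0 <= c <= L by exact: (mass_bounds z.1).
  by rewrite sqr_ge0 ler_sqr ?nnegrE// (le_trans c0).
have aD : `|a y.2 - a x.2| <= `|l| * A * d.
  have -> : a y.2 - a x.2 = l (K (val y.2) - K (val x.2)) by rewrite dualB /a; ring.
  rewrite (le_trans (dual_le _ _))// -mulrA ler_wpM2l// distrC.
  by rewrite (le_trans (K_atoms_lipschitz _ _))// ler_wpM2l// ltW.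
have PD : `|val y.1 ^+ 2 - val x.1 ^+ 2| <= 2 * L * d.
  by rewrite distrC sqr_mass_lipschitz.
(* Three remainders: the product of the increments of the squared mass and of [a], the convexity gap
   of the squared mass, and the deviation of [a] from its chord. They give the three summands of the
   constant, in this order. *)
have -> : c ^+ 2 * a (g t) = (1 - t) * (val x.1 ^+ 2 * a x.2) + t * (val y.1 ^+ 2 * a y.2)
    - t * (1 - t) * ((val y.1 ^+ 2 - val x.1 ^+ 2) * (a y.2 - a x.2))
    - t * (1 - t) * (Dl ^+ 2 * Q) + c ^+ 2 * (a (g t) - Q).
  by rewrite c2 /Q; ring.
have tt : 0 <= t * (1 - t) <= t by rewrite mulr_ge0//= ler_piMr// gerBl.
have le_tt (r : R) M : `|r| <= M -> - (t * (1 - t) * r) <= t * M.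
  move=> rM; apply: (le_trans (ler_norm _)); rewrite normrN normrM.
  by case/andP: tt => tt0 ttt; rewrite (ger0_norm tt0) ler_pM.
have e1 : - (t * (1 - t) * ((val y.1 ^+ 2 - val x.1 ^+ 2) * (a y.2 - a x.2))) <=
    t * (2 * L * d * (`|l| * A * d)).
  by apply: le_tt; rewrite normrM ler_pM.
have e2 : - (t * (1 - t) * (Dl ^+ 2 * Q)) <= t * (d ^+ 2 * (`|l| * B + 1)).
  by apply: le_tt; rewrite normrM ler_pM// normrX ler_sqr ?nnegrE.
have e3 : c ^+ 2 * (a (g t) - Q) <= L ^+ 2 * (`|l| * A * (t * d ^+ 2)).
  apply: (le_trans (ler_norm _)); rewrite normrM ler_pM//.
  by case/andP: cL => c0 ?; rewrite ger0_norm.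
have -> : (2 * L * (`|l| * A) + (`|l| * B + 1) + L ^+ 2 * (`|l| * A)) * t * d ^+ 2 =
    t * (2 * L * d * (`|l| * A * d)) + t * (d ^+ 2 * (`|l| * B + 1)) +
    L ^+ 2 * (`|l| * A * (t * d ^+ 2)) by ring.
lra.
Qed.

End omega_objective.

(** * Transfer of curves of maximal slope to the lifted objective *)

Theorem theorem5p1 (R : realType)
  (C : completeNormedModType R) (sepC : separable C)
  (Y : completeNormedModType R) (dot : {dot Y for idfun})
  (dotE : forall y : Y, dot y y = `|y| ^+ 2)
  (K : {linear dual C -> Y}) (F : Y -> R) (Reg : dual C -> \bar R)
  (Reg_ge0 : forall u, (0 <= Reg u)%E)
  (atoms : set (dual C))
  (atoms_closed : @closed (weakstar C) atoms)
  (atoms_sub : atoms `<=`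
     @closure (weakstar C) (extreme_points [set u | (Reg u <= 1)%E]))
  (dB : atoms -> atoms -> R)
  (dB_metric : is_metric dB)
  (dB_weakstar : metrizes_weakstar dB)
  (dB_geodesic : geodesically_complete dB)
  (K_weak : continuous (K : weakstar C -> weak Y))
  (F_bounded : exists m : R, forall y, m <= F y)
  (F_convex : convex_function [set: convex_lmodType Y] F)
  (F_diff : twice_differentiable F)
  (Reg_convex : econvex Reg)
  (Reg_lsc : @lower_semicontinuous (weakstar C) R Reg)
  (Reg_homogeneous : forall (a : R) u, 0 <= a -> Reg (a *: u) = (a%:E * Reg u)%E)
  (Reg_compact : forall a : R, 0 <= a ->
     @compact (weakstar C) [set u | (Reg u <= a%:E)%E])
  (K_strong : forall (v : nat -> dual C) (u : dual C),
     (forall k, edom Reg (v k)) -> edom Reg u ->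
     (v k : weakstar C) @[k --> \oo] --> (u : weakstar C) ->
     K (v k) @[k --> \oo] --> K u)
  (no_mass_loss : forall (m : nat) (a : 'I_m -> R) (v : 'I_m -> atoms),
     (forall j, 0 <= a j) ->
     Reg (\sum_(j < m) a j *: val (v j))
     = (\sum_(j < m) (a j)%:E * Reg (val (v j)))%E)
  (atoms_neq0 : ~ atoms 0)
  (K_geodesic : exists2 A : R, 0 < A & forall g : R -> atoms, geodesic dB g ->
     exists v1 v2 : R -> Y,
     [/\ weak_derivative_on01 dot (fun t => K (val (g t))) v1,
         weak_derivative_on01 dot v1 v2,
         (forall t : R, 0 <= t <= 1 -> `|v1 t| <= A * dB (g 0) (g 1)) &
         (forall t : R, 0 <= t <= 1 -> `|v2 t| <= A * dB (g 0) (g 1) ^+ 2)])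
  (* no mass is lost at the non-extremal limit points either; at extremal points
     this follows from atoms_neq0 *)
  (Reg_atoms : forall u, atoms u ->
     ~ extreme_points [set u | (Reg u <= 1)%E] u -> Reg u = 1%E)
  (n : nat) (n_gt0 : (0 < n)%N) (L : R) (L_gt0 : 0 < L)
  (x0 : Omega atoms L) (g : R -> OmegaN atoms L n) :
  max_slope_curve (dist_OmegaN dB) (objectiveN K F Reg)
    (local_slope (dist_OmegaN dB) (objectiveN K F Reg)) g ->
  max_slope_curve (W2 dB x0) (lifted_objective dB K F x0)
    (local_slope (W2 dB x0) (lifted_objective dB K F x0))
    (fun t => curve_measure dB x0 n_gt0 (g t)).
Proof.
move=> g_max; case: K_geodesic => A A_gt0 K_geod; have [DF [F_d DF_d]] := F_diff.
have DF_cont y : {for y, continuous DF} by exact: differentiable_continuous.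
have atoms_cpt :=
  atoms_compact atoms_closed atoms_sub Reg_lsc (Reg_compact 1 ler01).
have dB_tb := weakstar_compact_totally_bounded atoms_cpt dB_weakstar.
have dOpm := dist_Omega_pseudo_metric dB_metric L.
have dO_tb := dist_Omega_totally_bounded dB_metric L_gt0 dB_tb.
have [D dO_bounded] := totally_bounded_dist_bounded dOpm dO_tb.
pose T : measurableType _ := borel (@dist_Omega R C atoms dB L) x0.
pose d : T -> T -> R := @dist_Omega R C atoms dB L.
have dpm : pseudo_metric d := dOpm.
have d_bounded (x y : T) : d x y <= D := dO_bounded x y.
have d_approx : finitely_approximable d := totally_bounded_approximable x0 dOpm dO_tb.
have [B KB] := K_atoms_bounded dotE dB_metric dB_tb dB_geodesic A_gt0 K_geod x0.
have B_ge0 : 0 <= B by apply: le_trans (KB x0.2).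
(* Lower semicontinuity yields only Reg <= 1 on the closure. Equality holds at extreme points
   because they are nonzero atoms, and at the other limit points by [Reg_atoms]. *)
have Reg1 (u : atoms) : Reg (val u) = 1%E.
  have [/(extreme_point_eq1 Reg_ge0 Reg_homogeneous)|] :=
      pselect (extreme_points [set u | (Reg u <= 1)%E] (val u)).
    by apply=> u0; apply: atoms_neq0; rewrite -u0; exact: set_mem (valP u).
  exact: (Reg_atoms _ (set_mem (valP u))).
pose f : T -> Y := @weighted_K _ _ _ K atoms L.
pose w : T -> R := fun x => val x.1 ^+ 2.
have Mf_ge0 : 0 <= 2 * L * B + L ^+ 2 * A.
  by rewrite addr_ge0 ?mulr_ge0 ?sqr_ge0 ?(ltW L_gt0) ?(ltW A_gt0).
have Mw_ge0 : 0 <= 2 * L by rewrite mulr_ge0 ?(ltW L_gt0).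
have f_lip (x y : T) : `|f x - f y| <= (2 * L * B + L ^+ 2 * A) * d x y.
  exact: (weighted_K_lipschitz dotE dB_metric dB_geodesic A_gt0 K_geod).
have f_bound (x : T) : `|f x| <= L ^+ 2 * B by exact: weighted_K_bounded.
have w_lip (x y : T) : `|w x - w y| <= 2 * L * d x y.
  exact: sqr_mass_lipschitz.
have w_bound (x : T) : `|w x| <= L ^+ 2 by exact: sqr_mass_bounded.
pose G : P2 dB x0 -> R := lifted_energy F f w.
have w_meas : measurable_fun setT w := lipschitz_measurable dpm d_approx w_lip.
have liftedE : lifted_objective dB K F x0 = EFin \o G.
  apply/funext => nu; rewrite /lifted_objective /G /lifted_energy /= EFinD; congr (_ + _)%E.
  rewrite /Rintegral fineK//; apply: integrable_fin_num => //.
  exact: (bounded_integrable nu w_meas w_bound).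
pose mu (x : OmegaN atoms L n) : P2 dB x0 := curve_measure dB x0 n_gt0 x.
have objE x : objectiveN K F Reg x = (G (mu x))%:E.
  rewrite /objectiveN /objective /G.
  rewrite (lifted_energy_empirical dpm d_approx dotE F f_lip f_bound w_lip w_bound).
  rewrite EFinD; congr (_%:E + _)%E.
    by rewrite linearZ linear_sum; congr (F (_ *: _)); apply: eq_bigr => j _; rewrite linearZ.
  (* The coefficients are squared masses, hence nonnegative; as [Reg] is 1 on atoms, the regularizer
     becomes the mean squared mass, the linear term of [G]. *)
  rewrite Reg_homogeneous ?invr_ge0// no_mass_loss; last by move=> j; exact: sqr_ge0.
  rewrite EFinM -sumEFin; congr (_ * _)%E; apply: eq_bigr => j _.
  by rewrite Reg1 mule1.
rewrite liftedE.
pose q (x : OmegaN atoms L n) (j : 'I_n) : T := (x.1 j, x.2 j).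
pose q' (z : 'I_n -> T) : OmegaN atoms L n := (fun j => (z j).1, fun j => (z j).2).
have q'K z : q (q' z) = z by apply/funext => j; rewrite /q /q' /=; case: (z j).
have dNpm := dist_OmegaN_pseudo_metric dB_metric L n.
have dN_ge0 (x y : OmegaN atoms L n) : 0 <= dist_OmegaN dB x y by case: dNpm.
apply: (max_slope_curve_image (h := mu) dNpm _ _ _ _ _ g_max).
- exact: wasserstein2_pseudo_metric.
- move=> x y; rewrite -ler_sqr ?nnegrE//.
    rewrite dist_OmegaN_sqr.
    exact: (wasserstein2_empirical dpm d_bounded d_approx n_gt0 (q x) (q y)).
  exact: wasserstein2_ge0.
- by move=> x; rewrite objE.
- move=> x; have -> : objectiveN K F Reg = EFin \o (G \o mu) :> (OmegaN atoms L n -> \bar R).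
    by apply/funext => y; rewrite objE.
  (* The penalty is the constant of the quadratic error along geodesics. *)
  pose Cl (l : dual Y) : R := 2 * L * (`|l| * A) + (`|l| * B + 1) + L ^+ 2 * (`|l| * A).
  apply: (local_slope_empirical_le dpm d_bounded d_approx dotE F_convex F_d Mf_ge0 f_lip
    f_bound Mw_ge0 w_lip w_bound (C := Cl) _ _ _ n_gt0 (e := q) (e' := q')) => //.
  + move=> l; have l0 : 0 <= `|l| by exact: dual_norm_ge0.
    by rewrite !addr_ge0// ?mulr_ge0 ?sqr_ge0 ?(ltW L_gt0) ?(ltW A_gt0).
  + by move=> S; exact: sub_sigma_algebra.
  + move=> l y z t t01.
    exact: (potential_along_geodesic dotE dB_metric dB_geodesic A_gt0 K_geod l y z KB t01).
  + by move=> y z; rewrite dist_OmegaN_sqr.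
- exact: (lifted_energy_strong_upper_gradient dpm d_bounded d_approx dotE F_convex F_d
    Mf_ge0 f_lip f_bound Mw_ge0 w_lip w_bound DF_cont).
Qed.
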